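(* Let $H$, $A$, $V=D(A^{1/2})$, $\mathcal{H}=V\times H\times V\times H$ and the constants $a,b,\gamma>0$ be as in the context, and for $\theta\in[-1,1]$ let $\mathcal{A}_\theta$ be the operator on $\mathcal{H}$ defined in the context by $$\mathcal{A}_\theta(u,v,w,z)=\big(v,\,-aAu-\gamma A^\theta(v+z),\,z,\,-bAw-\gamma A^\theta(v+z)\big),$$ with $(S_\theta(t))_{t\ge0}$ the $C_0$-semigroup of contractions it generates on $\mathcal{H}$. Assume $a\neq b$. For every $\theta\in(0,1/2]$, the semigroup $(S_\theta(t))_{t\ge0}$ is of Gevrey class $\delta$ for every $\delta>1/s$, where $$s=2\theta\ \text{ if }\theta\in(0,1/4],\qquad s=\frac{3\theta}{1+2\theta}\ \text{ if }\theta\in(1/4,1/2].$$ More precisely, there exists a positive constant $C$ such that $$|\lambda|^{s}\,\big\|(i\lambda I-\mathcal{A}_\theta)^{-1}\big\|_{\mathcal{L}(\mathcal{H})}\le C\qquad\text{for all }\lambda\in\mathbb{R}.$$ Moreover, for every $\theta\in(0,1/2)$ and every $r\in(2\theta,1]$, $$\limsup_{|\lambda|\to\infty,\ \lambda\in\mathbb{R}}|\lambda|^{r}\,\big\|(i\lambda I-\mathcal{A}_\theta)^{-1}\big\|_{\mathcal{L}(\mathcal{H})}=\infty .$$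
   Context: $H$ is a complex Hilbert space with inner product $(\cdot,\cdot)$ and norm $|\cdot|$. $A$ is a positive unbounded self-adjoint operator on $H$ with domain $D(A)$ dense in $H$, and $V=D(A^{1/2})$. It is assumed that $V\hookrightarrow H\hookrightarrow V'$, each injection being dense and compact, where $V'$ is the topological dual of $V$, and that there exists $a_0>0$ such that $|u|\le a_0|A^{1/2}u|$ for all $u\in V$. The numbers $a,b,\gamma$ are positive constants, and $\theta\in[-1,1]$. The space $\mathcal{H}=V\times H\times V\times H$, over $\mathbb{C}$, is a Hilbert space with the norm $$\|Z\|^2=a|A^{1/2}u|^2+|v|^2+b|A^{1/2}w|^2+|z|^2,\qquad Z=(u,v,w,z)\in\mathcal{H}.$$ The operator $\mathcal{A}_\theta$ is defined by $\mathcal{A}_\theta(u,v,w,z)=(v,\,-(aAu+\gamma A^\theta(v+z)),\,z,\,-(bAw+\gamma A^\theta(v+z)))$ on the domain $$D(\mathcal{A}_\theta)=\{(u,v,w,z)\in V^4:\ aAu+\gamma A^\theta(v+z)\in H\ \text{and}\ bAw+\gamma A^\theta(v+z)\in H\},$$ where the sums are understood in $V'$ (with $A$ extended to a bounded operator $V\to V'$). It is the generator associated with the system $y_{tt}+aAy+\gamma A^\theta(y_t+z_t)=0$, $z_{tt}+bAz+\gamma A^\theta(y_t+z_t)=0$. It generates a $C_0$-semigroup of contractions $(S_\theta(t))_{t\ge0}$ on $\mathcal{H}$, and, when $a\ne b$, $i\mathbb{R}\subset\rho(\mathcal{A}_\theta)$, the resolvent set of $\mathcal{A}_\theta$. A $C_0$-semigroup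 $(T(t))_{t\ge0}$ on a Hilbert space $X$ is of Gevrey class $\delta$ (for $t>0$) if $t\mapsto T(t)$ is infinitely differentiable on $(0,\infty)$ in $\mathcal{L}(X)$ and for every compact set $K\subset(0,\infty)$ and every $\eta>0$ there is a constant $C=C(\eta,K)$ such that $\|T^{(n)}(t)\|_{\mathcal{L}(X)}\le C\,\eta^n(n!)^{\delta}$ for all $t\in K$ and all $n=0,1,2,\dots$ *)

(* Defs.v *)
From HB Require Import structures.
From mathcomp Require Import all_boot all_order all_algebra.
From mathcomp Require Import complex.
From mathcomp Require Import all_classical all_reals all_analysis.

Set Implicit Arguments.
Unset Strict Implicit.
Unset Printing Implicit Defensive.

Import Order.TTheory GRing.Theory Num.Theory.
Import numFieldNormedType.Exports.

Local Open Scope classical_set_scope.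
Local Open Scope ring_scope.
Local Open Scope complex_scope.

(* The norm of a normed space over R[i] takes its values in R[i]; its values
   are real and [rnorm] is the corresponding element of R. *)
Definition rnorm (R : realType) (W : normedZmodType R[i]) (x : W) : R :=
  complex.Re `|x|.

(* D(A^(1/2)), its dual and the energy space are used as subsets, with their
   own norms, of H, of the functions on H and of H^4. All the notions below
   only depend on the restrictions to [carrier X]. *)
Record nspace (R : realType) (W : lmodType R[i]) := NSpace {
  carrier : set W;
  nrm : W -> R
}.

Record operator (R : realType) (W : lmodType R[i]) := Operator {
  dom : set W;
  fn :> W -> W
}.

Section NormedSubspaces.
Context (R : realType) (W : lmodType R[i]).
Implicit Types (X : nspace W) (T : W -> W) (S : R -> W -> W) (G : operator W).

Definition linear_on (D : set W) T : Prop :=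
  forall (c : R[i]) x y, D x -> D y -> T (c *: x + y) = c *: T x + T y.

Definition vsubspace (D : set W) : Prop :=
  D 0 /\ forall (c : R[i]) x y, D x -> D y -> D (c *: x + y).

Definition opnorm X T : \bar R :=
  ereal_sup [set (nrm X (T x))%:E | x in [set x | carrier X x /\ nrm X x <= 1]].

Definition bounded_linear X T : Prop :=
  [/\ forall x, carrier X x -> carrier X (T x),
      linear_on (carrier X) T
    & (opnorm X T < +oo)%E].

Definition C0_semigroup X S : Prop :=
  [/\ forall t, 0 <= t -> bounded_linear X (S t),
      forall x, carrier X x -> S 0 x = x,
      forall s t x, 0 <= s -> 0 <= t -> carrier X x ->
        S (s + t) x = S s (S t x)
    & forall x, carrier X x -> nrm X (S t x - x) @[t --> 0^'+] --> 0].

Definition contraction_semigroup X S : Prop :=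
  C0_semigroup X S /\ forall t, 0 <= t -> (opnorm X (S t) <= 1)%E.

Definition is_generator X S G : Prop :=
  forall x y,
    (dom G x /\ G x = y) <->
    [/\ carrier X x, carrier X y
      & nrm X ((t^-1)%:C *: (S t x - x) - y) @[t --> 0^'+] --> 0].

(* The value of (zI - G)^-1 at y; meaningful for z in [resolvent_set X G]. *)
Definition resolvent G (z : R[i]) (y : W) : W :=
  xget 0 [set x | dom G x /\ z *: x - G x = y].

Definition resolvent_set X G : set R[i] :=
  [set z | (forall y, carrier X y -> exists! x, dom G x /\ z *: x - G x = y)
           /\ bounded_linear X (resolvent G z)].

Definition resolvent_norm X G (lambda : R) : \bar R :=
  opnorm X (resolvent G ('i * lambda%:C)).

(* [D n] is the n-th derivative of S on ]0, +oo[ for the norm of L(X). *)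
Definition is_derivatives X S (D : nat -> R -> W -> W) : Prop :=
  [/\ forall t x, 0 < t -> carrier X x -> D 0%N t x = S t x,
      forall n t, 0 < t -> bounded_linear X (D n t)
    & forall n t, 0 < t ->
        opnorm X (fun x => (h^-1)%:C *: (D n (t + h) x - D n t x)
                           - D n.+1 t x) @[h --> 0^'] --> 0%E].

Definition gevrey X S (delta : R) : Prop :=
  exists2 D, is_derivatives X S D &
    forall (K : set R) (eta : R),
      compact K -> K `<=` [set t | 0 < t] -> 0 < eta ->
      exists C : R, forall t n, K t ->
        (opnorm X (D n t) <= (C * eta ^+ n * (n`!)%:R `^ delta)%:E)%E.

End NormedSubspaces.

Section Embeddings.
Context (R : realType) (W1 W2 : lmodType R[i]).
Implicit Types (X : nspace W1) (Y : nspace W2) (j : W1 -> W2).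

Definition dense_embedding X Y j : Prop :=
  (forall x, carrier X x -> carrier Y (j x)) /\
  (forall y (e : R), carrier Y y -> 0 < e ->
     exists2 x, carrier X x & nrm Y (y - j x) < e).

Definition compact_embedding X Y j : Prop :=
  (forall x, carrier X x -> carrier Y (j x)) /\
  (forall u : nat -> W1, (forall n, carrier X (u n) /\ nrm X (u n) <= 1) ->
     exists (phi : nat -> nat) (y : W2),
       [/\ {homo phi : m n / (m < n)%N}, carrier Y y
         & nrm Y (j (u (phi n)) - y) @[n --> \oo] --> 0]).

End Embeddings.

(* The filter of neighbourhoods of |x| = +oo in R. *)
Definition abs_infty {R : realType} : set_system R :=
  filter_from [set: R] (fun M => [set x | M < `|x|]).

Section FunctionalCalculus.
Context (R : realType) (H : completeNormedModType R[i]).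
Variable dot : {dot H for Num.conj}.
Implicit Types (A : operator H) (E : set R -> H -> H) (f : R -> R).

(* The last clause says that the graphs of A and of its adjoint coincide. *)
Definition self_adjoint A : Prop :=
  [/\ vsubspace (dom A), linear_on (dom A) A, dense (dom A)
    & forall y g, (forall x, dom A x -> dot (A x) y = dot x g)
                  <-> (dom A y /\ A y = g)].

Definition positive_operator A : Prop :=
  forall x, dom A x -> 0 <= dot (A x) x.

Definition unbounded A : Prop :=
  ~ exists M : R, forall x, dom A x -> rnorm (A x) <= M * rnorm x.

Definition projection_valued_measure E : Prop :=
  [/\ forall B, measurable B -> linear (E B) /\
        (forall x y, dot (E B x) y = dot x (E B y)),
      forall x, E setT x = x,
      forall B C x, measurable B -> measurable C ->
        E (B `&` C) x = E B (E C x)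
    & forall (F : nat -> set R) x, (forall n, measurable (F n)) ->
        trivIset setT F ->
        (\sum_(0 <= i < n) E (F i) x) @[n --> \oo] --> E (\bigcup_n F n) x].

(* B |-> (E(B)x, x) *)
Definition scalar_measure E (x : H) (B : set R) : \bar R :=
  (complex.Re (dot (E B x) x))%:E.

Definition spectral_dom E f : set H :=
  [set x | (\int[scalar_measure E x]_l ((f l) ^+ 2)%:E < +oo)%E].

Definition spectral_quad E f (x : H) : R :=
  fine (\int[scalar_measure E x]_l (f l)%:E)%E.

(* The integral of f against the complex measure B |-> (E(B)x, y), which is
   defined by polarization. *)
Definition spectral_form E f (x y : H) : R[i] :=
  4^-1 * \sum_(k < 4) 'i ^+ k * (spectral_quad E f (x + 'i ^+ k *: y))%:C.

(* f(A), where E is the spectral measure of A. *)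
Definition spectral_integral E f : operator H :=
  Operator (spectral_dom E f)
    (fun x => xget 0 [set g | forall y, spectral_dom E f y ->
                                dot g y = spectral_form E f x y]).

Definition is_spectral_measure A E : Prop :=
  [/\ projection_valued_measure E,
      dom A = spectral_dom E id
    & forall x y, dom A x -> dom A y -> dot (A x) y = spectral_form E id x y].

(* By the spectral theorem, every self-adjoint operator has exactly one
   spectral measure (up to its values on non-measurable sets). *)
Definition spectral_measure A : set R -> H -> H :=
  xget (fun _ _ => 0) [set E | is_spectral_measure A E].

Definition fpow A (s : R) : operator H :=
  spectral_integral (spectral_measure A) (fun l => l `^ s).

Definition spaceH : nspace H := NSpace setT (@rnorm R H).

Definition spaceV A : nspace H :=
  NSpace (dom (fpow A 2^-1)) (fun u => rnorm (fpow A 2^-1 u)).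

(* V' consists of the bounded antilinear functionals on V, so that the
   inclusion [pivot] of H into V' is linear. *)
Definition spaceV' A : nspace (H -> R[i]^o) :=
  NSpace
    [set l | (forall (c : R[i]) p q, carrier (spaceV A) p ->
                carrier (spaceV A) q ->
                l (c *: p + q) = Num.conj c * l p + l q) /\
             exists M : R, forall p, carrier (spaceV A) p ->
                complex.Re `|l p| <= M * nrm (spaceV A) p]
    (fun l => sup [set complex.Re `|l p| |
                   p in [set p | carrier (spaceV A) p /\
                                 nrm (spaceV A) p <= 1]]).

Definition pivot (g : H) : H -> R[i]^o := fun p => dot g p.

(* A^s as an operator from V to V', for s <= 1. *)
Definition fpowV' A (s : R) (u : H) : H -> R[i]^o :=
  fun p => dot (fpow A (s / 2) u) (fpow A (s / 2) p).

(* The functional l on V is the element g of H. *)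
Definition represents A (l : H -> R[i]^o) (g : H) : Prop :=
  forall p, carrier (spaceV A) p -> l p = pivot g p.

Definition inH A (l : H -> R[i]^o) : Prop := exists g, represents A l g.

Definition toH A (l : H -> R[i]^o) : H := xget 0 [set g | represents A l g].

Definition energy_space A (a b : R) : nspace (H * H * H * H)%type :=
  NSpace
    [set Z | let: (u, v, w, z) := Z in
       carrier (spaceV A) u /\ carrier (spaceV A) w]
    (fun Z => let: (u, v, w, z) := Z in
       Num.sqrt (a * rnorm (fpow A 2^-1 u) ^+ 2 + rnorm v ^+ 2
                 + b * rnorm (fpow A 2^-1 w) ^+ 2 + rnorm z ^+ 2)).

(* c A u + gamma A^theta y, the sum being taken in V' *)
Definition stiff_damp A (gamma theta c : R) (u y : H) : H -> R[i]^o :=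
  c%:C *: fpowV' A 1 u + gamma%:C *: fpowV' A theta y.

Definition coupled_operator A (a b gamma theta : R) :
    operator (H * H * H * H)%type :=
  Operator
    [set Z | let: (u, v, w, z) := Z in
       [/\ [/\ carrier (spaceV A) u, carrier (spaceV A) v,
               carrier (spaceV A) w & carrier (spaceV A) z],
           inH A (stiff_damp A gamma theta a u (v + z))
         & inH A (stiff_damp A gamma theta b w (v + z))]]
    (fun Z => let: (u, v, w, z) := Z in
       (v, - toH A (stiff_damp A gamma theta a u (v + z)),
        z, - toH A (stiff_damp A gamma theta b w (v + z)))).

End FunctionalCalculus.

Definition decay_exponent (R : realType) (theta : R) : R :=
  if theta <= 4^-1 then 2 * theta else 3 * theta / (1 + 2 * theta).

(* Main.v *)
(* Compactness of [V] in [H] makes the spectral measure of [A] atomic, so that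
   [H] is the orthogonal sum of ranges of projections [P n] on which [A] acts
   as [m n >= m0 > 0], and the generator acts on the n-th component of the
   energy space as the 4 x 4 block [mode_op a b gamma mu d], with [mu = m n] and
   [d = mu `^ theta].  Since [a != b], a quadratic form [lyapunov], equivalent to
   the energy uniformly in [n], decays at rate [c d] along the n-th block.
   - Hence the resolvent of the n-th block at [i lam] is O(mu^-theta).  It is
     also O(1/|lam|) when lam^2 is large compared with mu, so the full resolvent
     is O(|lam|^(-2 theta)), and [decay_exponent theta <= 2 * theta].
   - Quasimodes with lam^2 = a mu show that the rate [2 * theta] is optimal.
   - The k-th derivative of the n-th block of the semigroup is of order at most
     mu^(k/2) e^(-c d t) <= (B / t^p)^k (k!)^p with p = 1 / (2 theta). *)

Require Import Defs.
From HB Require Import structures.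
From mathcomp Require Import all_boot all_order all_algebra.
From mathcomp Require Import complex ring lra.
From mathcomp Require Import all_classical all_reals all_analysis measurable_realfun.

Set Implicit Arguments.
Unset Strict Implicit.
Unset Printing Implicit Defensive.

Import Order.TTheory GRing.Theory Num.Theory.
Import numFieldNormedType.Exports.

Local Open Scope classical_set_scope.
Local Open Scope ring_scope.
Local Open Scope complex_scope.

(** * Real part of the inner product and the real-valued norm *)

Section InnerProduct.
Context (R : realType) (H : completeNormedModType R[i]).
Variable dot : {dot H for Num.conj}.
Hypothesis dot_norm : forall x : H, `|x| ^+ 2 = dot x x.
Implicit Types (x y : H) (r : R).

(** The energy of a block decays only through gamma d |v + z|^2, which controls a single combination
    of the velocities. The cross terms of [lyapunov] transfer this dissipation to all four
    components; their weight d matches the strength of the damping. The error they create has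
    relative size d^2 / mu, so the constants stay uniform in n because mu^(2 theta - 1) is bounded
    for theta <= 1/2. One real form per block then serves three times: paired with the resolvent
    equation, where the term in i lam drops out; as a decaying quantity along the flow; and as the
    seminorm in which the flow is differentiated. The semigroup is known only through its generator,
    so it must be shown to respect the blocks before anything can be summed. Its derivatives are
    then assembled from powers of [mode_op] applied to the flow in each block, and the difference
    quotients converge in operator norm thanks to a bound on the derivative of order k + 2 that is
    uniform in n. *)

Definition rip x y : R := complex.Re (dot x y).
Local Notation ip := rip.

Lemma ReD (p q : R[i]) : complex.Re (p + q) = complex.Re p + complex.Re q.
Proof. by case: p q => ? ? []. Qed.

Lemma ReN (p : R[i]) : complex.Re (- p) = - complex.Re p.
Proof. by case: p. Qed.

Lemma ReM (p q : R[i]) :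
  complex.Re (p * q) = complex.Re p * complex.Re q - complex.Im p * complex.Im q.
Proof. by case: p q => ? ? []. Qed.

Lemma ReCM r (p : R[i]) : complex.Re (r%:C * p) = r * complex.Re p.
Proof. by rewrite ReM /= mul0r subr0. Qed.

Lemma dotZl (c : R[i]) x y : dot (c *: x) y = c * dot x y.
Proof. exact: linearZl_LR. Qed.

Lemma dotDl x x' y : dot (x + x') y = dot x y + dot x' y.
Proof. exact: linearDl. Qed.

Lemma dotNl x y : dot (- x) y = - dot x y.
Proof. exact: linearNl. Qed.

Lemma dotC x y : dot x y = Num.conj (dot y x).
Proof. by rewrite hermC /= expr0 mul1r. Qed.

Lemma Re_conj (p : R[i]) : complex.Re (Num.conj p) = complex.Re p.
Proof.
by apply: complexI; rewrite !complexRe Re_conj.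
Qed.

Lemma ipDl x x' y : ip (x + x') y = ip x y + ip x' y.
Proof. by rewrite /rip linearDl ReD. Qed.

Lemma ipNl x y : ip (- x) y = - ip x y.
Proof. by rewrite /rip linearNl ReN. Qed.

Lemma ipC x y : ip x y = ip y x.
Proof. by rewrite /rip dotC Re_conj. Qed.

Lemma ipDr x x' y : ip y (x + x') = ip y x + ip y x'.
Proof. by rewrite ipC ipDl !(ipC y). Qed.

Lemma ipNr x y : ip y (- x) = - ip y x.
Proof. by rewrite ipC ipNl ipC. Qed.

Lemma ipZl r x y : ip (r%:C *: x) y = r * ip x y.
Proof. by rewrite /rip dotZl ReCM. Qed.

Lemma ipZr r x y : ip y (r%:C *: x) = r * ip y x.
Proof. by rewrite ipC ipZl ipC. Qed.

Lemma ip0l x : ip 0 x = 0.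
Proof. by rewrite /rip linear0l. Qed.

Lemma ip0r x : ip x 0 = 0.
Proof. by rewrite ipC ip0l. Qed.

Lemma ip_il x y : ip ('i *: x) y = - ip x ('i *: y).
Proof.
rewrite [in RHS]/rip dotC Re_conj dotZl /rip dotZl dotC.
rewrite (_ : Num.conj (dot y x) = (dot y x)^*%C); last first.
  apply/eqP; rewrite eq_complex -[_^*%C]/(conjc _) /=.
  rewrite Re_conj /=.
  have -> : complex.Im (Num.conj (dot y x)) = - complex.Im (dot y x).
    by apply: complexI; rewrite rmorphN /= !complexIm Im_conj.
  by case: (dot y x) => ? ? /=; rewrite !eqxx.
by case: (dot y x) => s t /=; rewrite !mul0r !mul1r !sub0r opprK.
Qed.

Lemma ip_ixx x : ip ('i *: x) x = 0.
Proof. by have := ip_il x x; rewrite [in X in _ = X -> _]ipC; lra. Qed.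

(** The imaginary part of [dot x y] is minus the real part of [dot ('i *: x) y], so identities
    proved for [rip] on all vectors carry over to [dot]. *)
Lemma dotE x y : dot x y = (ip x y +i* - ip ('i *: x) y)%C.
Proof.
by rewrite /rip dotZl; case: (dot x y) => s t /=; rewrite mul0r mul1r sub0r opprK.
Qed.

Lemma rnormE x : `|x| = (rnorm x)%:C.
Proof. by rewrite /rnorm RRe_real // ger0_real. Qed.

Lemma rnorm_ge0 x : 0 <= rnorm x.
Proof. by rewrite -ler0c -rnormE. Qed.

Lemma rnorm_sqr x : rnorm x ^+ 2 = ip x x.
Proof.
apply: complexI; rewrite rmorphXn /= -rnormE dot_norm dotE ip_ixx oppr0.
by [].
Qed.

Lemma ipxx_ge0 x : 0 <= ip x x.
Proof. by rewrite -rnorm_sqr sqr_ge0. Qed.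

Lemma rnorm0 : rnorm (0 : H) = 0.
Proof. by apply: complexI; rewrite -rnormE normr0. Qed.

Lemma rnorm_eq0 x : rnorm x = 0 -> x = 0.
Proof. by move=> h; apply/eqP; rewrite -normr_eq0 rnormE h. Qed.

Lemma ipxx_eq0 x : ip x x = 0 -> x = 0.
Proof. by rewrite -rnorm_sqr => /eqP; rewrite expf_eq0 /= => /eqP/rnorm_eq0. Qed.

Lemma rnormD x y : rnorm (x + y) <= rnorm x + rnorm y.
Proof. by rewrite -lecR rmorphD /= -!rnormE ler_normD. Qed.

Lemma rnormN x : rnorm (- x) = rnorm x.
Proof. by rewrite /rnorm normrN. Qed.

Lemma rnormZ r x : rnorm (r%:C *: x) = `|r| * rnorm x.
Proof.
apply: complexI; rewrite rmorphM /= -!rnormE normrZ; congr (_ * _).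
by rewrite normc_def /= expr0n addr0 sqrtr_sqr.
Qed.

Lemma ip_inj x y : (forall e, ip x e = ip y e) -> x = y.
Proof.
move=> h; apply/eqP; rewrite -subr_eq0; apply/eqP/ipxx_eq0.
by rewrite ipDl ipNl h subrr.
Qed.

Lemma dot_inj x y : (forall e, dot x e = dot y e) -> x = y.
Proof. by move=> h; apply: ip_inj => e; rewrite /rip h. Qed.

Lemma rip_sqr_le x y : ip x y ^+ 2 <= ip x x * ip y y.
Proof.
have [->|/eqP y0] := eqVneq y 0; first by rewrite !ip0r expr0n mulr0.
have yy : 0 < ip y y by rewrite lt_neqAle ipxx_ge0 andbT eq_sym; apply/eqP => /ipxx_eq0.
have := ipxx_ge0 (x - (ip x y / ip y y)%:C *: y).
rewrite !(ipDl, ipDr, ipNl, ipNr, ipZl, ipZr) (ipC y x).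
set s := ip x y; set t := ip y y in yy *; set p := ip x x.
have -> : p + - (s / t * s) + (- (s / t * s) - (s / t * - (s / t * t))) = p - s ^+ 2 / t.
  by field; rewrite gt_eqF.
by rewrite subr_ge0 ler_pdivrMr.
Qed.

Lemma rip_le x y : `|ip x y| <= rnorm x * rnorm y.
Proof.
rewrite -(ler_pXn2r (n := 2)) ?nnegrE ?normr_ge0 ?mulr_ge0 ?rnorm_ge0 //.
by rewrite real_normK ?num_real // exprMn !rnorm_sqr rip_sqr_le.
Qed.

Lemma cvg_rnorm (T : Type) (F : set_system T) {FF : Filter F} (u : T -> H) x :
  (u @ F --> x) <-> (rnorm (u t - x) @[t --> F] --> 0).
Proof.
split.
  move/cvgrPdist_lt => h; apply/cvgrPdist_lt => e e0.
  have e0' : 0 < e%:C by rewrite ltcR.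
  apply: filterS (h _ e0') => t.
  rewrite sub0r normrN ger0_norm ?rnorm_ge0 // -opprB normrN rnormE ltcR; apply.
move/cvgrPdist_lt => h; apply/cvgrPdist_lt => e e0.
have eE : e = (complex.Re e)%:C by rewrite RRe_real // gtr0_real.
have e0' : 0 < complex.Re e by rewrite -ltcR -eE.
apply: filterS (h _ e0') => t.
by rewrite sub0r normrN ger0_norm ?rnorm_ge0 // distrC rnormE {2}eE ltcR.
Qed.

Lemma rnorm_complete (u : nat -> H) :
  (forall e : R, 0 < e ->
     exists N, forall m n, (N <= m)%N -> (N <= n)%N -> rnorm (u m - u n) < e) ->
  exists x, rnorm (u n - x) @[n --> \oo] --> 0.
Proof.
move=> h.
suff : cvg (u @ \oo).
  by move=> c; exists (lim (u @ \oo)); apply/cvg_rnorm.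
apply/cauchy_cvgP/cauchy_ballP => e e0; rewrite near_simpl.
have eE : e = (complex.Re e)%:C by rewrite RRe_real // gtr0_real.
have e0' : 0 < complex.Re e by rewrite -ltcR -eE.
have [N hN] := h _ e0'.
exists ([set n | (N <= n)%N], [set n | (N <= n)%N]).
  by split; exists N.
by move=> [m n] /= [Nm Nn]; rewrite -ball_normE /ball_ /= eE rnormE ltcR; exact: hN.
Qed.

End InnerProduct.

(** * Projection-valued measures *)

Section ProjectionValuedMeasure.
Context (R : realType) (H : completeNormedModType R[i]).
Variable dot : {dot H for Num.conj}.
Hypothesis dot_norm : forall x : H, `|x| ^+ 2 = dot x x.
Variable E : set R -> H -> H.
Hypothesis pvmE : projection_valued_measure dot E.
Implicit Types (x y : H) (B C : set R) (f : R -> R).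
Local Notation ip := (rip dot).

Definition null B := forall x, E B x = 0.

Lemma pvm_linear B (c : R[i]) x y : measurable B -> E B (c *: x + y) = c *: E B x + E B y.
Proof. by move=> mB; case: pvmE => /(_ B mB)[+ _] _ _ _; apply. Qed.

Lemma pvmD B x y : measurable B -> E B (x + y) = E B x + E B y.
Proof. by move=> mB; rewrite -{1}[x]scale1r pvm_linear // scale1r. Qed.

Lemma pvm0 B : measurable B -> E B 0 = 0.
Proof.
move=> mB; have := pvmD 0 0 mB; rewrite addr0 => /eqP.
by rewrite -subr_eq0 opprD addNKr oppr_eq0 => /eqP.
Qed.

Lemma pvmZ B (c : R[i]) x : measurable B -> E B (c *: x) = c *: E B x.
Proof. by move=> mB; rewrite -[c *: x]addr0 pvm_linear // pvm0 // addr0. Qed.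

Lemma pvm_dot B x y : measurable B -> dot (E B x) y = dot x (E B y).
Proof. by move=> mB; case: pvmE => /(_ B mB)[_ +] _ _ _; apply. Qed.

Lemma pvm_ip B x y : measurable B -> ip (E B x) y = ip x (E B y).
Proof. by move=> mB; rewrite /rip pvm_dot. Qed.

Lemma pvmT x : E setT x = x.
Proof. by case: pvmE. Qed.

Lemma pvmI B C x : measurable B -> measurable C -> E (B `&` C) x = E B (E C x).
Proof. by move=> mB mC; case: pvmE => _ _ + _; apply. Qed.

Lemma pvm_sub B C x : measurable B -> measurable C -> B `<=` C -> E B (E C x) = E B x.
Proof. by move=> mB mC /setIidPl BC; rewrite -pvmI // BC. Qed.

Lemma pvm_idem B x : measurable B -> E B (E B x) = E B x.
Proof. by move=> mB; rewrite pvm_sub. Qed.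

Lemma pvm_ipE B x y : measurable B -> ip (E B x) y = ip (E B x) (E B y).
Proof. by move=> mB; rewrite -pvm_ip // pvm_idem. Qed.

Lemma pvm_sigma (F : nat -> set R) x : (forall n, measurable (F n)) ->
  trivIset setT F ->
  rnorm (\sum_(0 <= i < n) E (F i) x - E (\bigcup_n F n) x) @[n --> \oo] --> 0.
Proof.
move=> mF tF; apply/(cvg_rnorm (FF := _) _ _).
by case: pvmE => _ _ _; apply.
Qed.

(** For the constant family of empty sets, countable additivity makes the partial sums of a constant
    series converge to its term v; shifting the index gives v = v + v. *)
Lemma pvm_set0 x : E set0 x = 0.
Proof.
have [_ _ _ h] := pvmE.
have {}h := h (fun=> set0) x (fun=> measurable0) (@trivIset_set0 _ _ _).
rewrite bigcup0 // in h; set v := E set0 x in h *.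
have h2 : (\sum_(0 <= i < n.+1) v) @[n --> \oo] --> v.
  by rewrite (cvg_shiftS (fun n => \sum_(0 <= i < n) v)).
have h3 : (\sum_(0 <= i < n.+1) v) @[n --> \oo] --> v + v.
  under eq_fun do rewrite big_nat_recr //=.
  by apply: cvgD => //; exact: cvg_cst.
have /eqP : v = v + v by exact: (cvg_unique (@norm_hausdorff _ _) h2 h3).
by rewrite -subr_eq0 opprD addNKr oppr_eq0 => /eqP.
Qed.

Lemma pvmU B C x : measurable B -> measurable C -> [disjoint B & C] ->
  E (B `|` C) x = E B x + E C x.
Proof.
move=> mB mC dBC.
have [_ _ _ h] := pvmE.
have mF n : measurable (bigcup2 B C n) by case: n => [|[|n]] //=.
have tF : trivIset setT (bigcup2 B C) by rewrite -trivIset_bigcup2; apply/eqP.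
have := h _ x mF tF; rewrite bigcup2E => h1.
have h2 : (\sum_(0 <= i < n.+2) E (bigcup2 B C i) x) @[n --> \oo] --> E (B `|` C) x.
  rewrite (cvg_shiftS (fun n => \sum_(0 <= i < n.+1) E (bigcup2 B C i) x)).
  by rewrite (cvg_shiftS (fun n => \sum_(0 <= i < n) E (bigcup2 B C i) x)).
apply: (cvg_unique (@norm_hausdorff _ _) h2).
rewrite (_ : (fun _ => _) = cst (E B x + E C x)); first exact: cvg_cst.
apply/funext => n; rewrite !big_nat_recl //= big1 ?addr0 // => i _.
by rewrite pvm_set0.
Qed.

Lemma pvmC B x : measurable B -> E B x + E (~` B) x = x.
Proof.
move=> mB; rewrite -pvmU //; [by rewrite setUv pvmT | exact: measurableC |].
by rewrite /disj_set setICr.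
Qed.

Lemma null_sub B C : measurable B -> measurable C -> B `<=` C -> null C -> null B.
Proof. by move=> mB mC BC nC x; rewrite -(pvm_sub _ mB mC BC) nC pvm0. Qed.

Lemma null_bigcup (F : nat -> set R) : (forall n, measurable (F n)) ->
  (forall n, null (F n)) -> null (\bigcup_n F n).
Proof.
move=> mF nF x; rewrite seqDU_bigcup_eq.
have [_ _ _ h] := pvmE.
have mU := seqDU_measurable mF.
have := h _ x mU (trivIset_seqDU F) => h1.
apply: (cvg_unique (@norm_hausdorff _ _) h1).
rewrite (_ : (fun _ => _) = cst 0); first exact: cvg_cst.
apply/funext => n; rewrite big1 // => i _.
exact: (null_sub (mU i) (mF i) (@subset_seqDU _ F i) (nF i)).
Qed.

(** Agrees with [scalar_measure] on measurable sets and is cut off to 0 elsewhere, where E is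
    arbitrary and nonnegativity could fail. The proof argument is kept in the term so that the
    measure instance can be attached to it. *)
Definition smeasure (_ : projection_valued_measure dot E) x B : \bar R :=
  if `[< measurable B >] then (rnorm (E B x) ^+ 2)%:E else 0%E.

Lemma smeasureE x B : measurable B -> smeasure pvmE x B = (rnorm (E B x) ^+ 2)%:E.
Proof. by move=> mB; rewrite /smeasure asboolT. Qed.

Lemma smeasure_scalar x B : measurable B -> smeasure pvmE x B = scalar_measure dot E x B.
Proof.
by move=> mB; rewrite smeasureE // (rnorm_sqr dot_norm) -pvm_ipE.
Qed.

Section SMeasure.
Variable x : H.

Let smeasure0 : smeasure pvmE x set0 = 0%E.
Proof. by rewrite smeasureE // pvm_set0 rnorm0 expr0n. Qed.

Let smeasure_ge0 B : (0 <= smeasure pvmE x B)%E.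
Proof. by rewrite /smeasure; case: ifP => // _; rewrite lee_fin sqr_ge0. Qed.

Let smeasure_sigma : semi_sigma_additive (smeasure pvmE x).
Proof.
move=> F mF tF mU; rewrite smeasureE //.
have -> : (fun n => (\sum_(0 <= i < n) smeasure pvmE x (F i))%E) =
          (fun n => (ip (\sum_(0 <= i < n) E (F i) x) x)%:E).
  apply/funext => n; elim: n => [|n ih]; first by rewrite !big_geq // ip0l.
  by rewrite !big_nat_recr //= ih ipDl smeasureE // (rnorm_sqr dot_norm) -pvm_ipE.
apply: cvg_EFin; first exact: nearW.
rewrite (rnorm_sqr dot_norm) -pvm_ipE //.
apply/cvgrPdist_le => e e0.
have e1 : 0 < e / (rnorm x + 1) by rewrite divr_gt0 // ltr_wpDl // rnorm_ge0.
have /cvgrPdist_le/(_ _ e1) := pvm_sigma x mF tF.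
apply: filterS => n; rewrite sub0r normrN ger0_norm ?rnorm_ge0 // => h.
rewrite /= distrC -ipNl -ipDl (le_trans (rip_le dot_norm _ _)) //.
rewrite (le_trans (ler_wpM2r (rnorm_ge0 _) h)) // mulrAC ler_pdivrMr; last first.
  by rewrite ltr_wpDl // rnorm_ge0.
by apply: ler_wpM2l; [exact: ltW | rewrite lerDl].
Qed.

HB.instance Definition _ := isMeasure.Build _ _ _ (smeasure pvmE x)
  smeasure0 smeasure_ge0 smeasure_sigma.

End SMeasure.

Import HBNNSimple.

(** The integral is a supremum over simple functions, whose level sets are measurable, so only the
    values on measurable sets enter. This gives access to measure theory for the raw set function
    [scalar_measure]. *)
Lemma integral_raw (mu nu : set R -> \bar R) (f : R -> \bar R) :
  (forall B, measurable B -> mu B = nu B) ->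
  (\int[mu]_t f t = \int[nu]_t f t)%E.
Proof.
move=> h; rewrite /integral.
congr (ereal_sup _ - ereal_sup _)%E; apply/seteqP; split => _ [g gf <-];
  exists g => //; apply: eq_fsbigr => t _; rewrite h //; exact: measurable_funPTI.
Qed.

Lemma spectral_integralE x (f : R -> \bar R) :
  (\int[scalar_measure dot E x]_t f t = \int[smeasure pvmE x]_t f t)%E.
Proof. by apply: integral_raw => B mB; rewrite smeasure_scalar. Qed.

Section Nonnegative.
Variables (f : R -> R).
Hypothesis f0 : forall t, 0 <= f t.
Hypothesis mf : measurable_fun setT f.

Let mfE : measurable_fun setT (EFin \o f).
Proof. exact/measurable_EFinP. Qed.

Lemma smeasure_integral_le x B (K : R) : measurable B -> 0 <= K ->
  (forall t, B t -> f t <= K) ->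
  (\int[smeasure pvmE x]_(t in B) (f t)%:E <= (K * rnorm (E B x) ^+ 2)%:E)%E.
Proof.
move=> mB K0 fK; rewrite EFinM -smeasureE // -integral_cst //.
apply: ge0_le_integral => //.
- by move=> t _; rewrite lee_fin.
- exact: measurable_funTS.
Show.
Qed.

Lemma smeasure_integral_eq x y B : measurable B ->
  (forall C, measurable C -> C `<=` B -> rnorm (E C x) = rnorm (E C y)) ->
  (\int[smeasure pvmE x]_(t in B) (f t)%:E = \int[smeasure pvmE y]_(t in B) (f t)%:E)%E.
Proof.
move=> mB h; apply: eq_measure_integral => C mC CB.
by rewrite /= !smeasureE // h.
Qed.

Lemma smeasure_integral_split x B : measurable B ->
  (\int[smeasure pvmE x]_t (f t)%:E = \int[smeasure pvmE x]_(t in B) (f t)%:E +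
     \int[smeasure pvmE x]_(t in ~` B) (f t)%:E)%E.
Proof.
move=> mB; rewrite -ge0_integral_setU //; last first.
- by rewrite /disj_set setICr.
- by rewrite setUv => t _; rewrite lee_fin.
- by rewrite setUv.
- exact: measurableC.
by rewrite setUv.
Qed.

Lemma smeasure_integral_null x B : measurable B -> E B x = 0 ->
  (\int[smeasure pvmE x]_(t in B) (f t)%:E = 0)%E.
Proof.
move=> mB Bx; apply: null_set_integral => //; first exact: measurable_funTS.
by rewrite /= smeasureE // Bx rnorm0 expr0n.
Qed.

Lemma smeasure_integral_range x B (K : R) : measurable B -> 0 <= K ->
  (forall t, B t -> f t <= K) -> E B x = x ->
  (\int[smeasure pvmE x]_t (f t)%:E <= (K * rnorm x ^+ 2)%:E)%E.
Proof.
move=> mB K0 fK Bx; rewrite (smeasure_integral_split _ mB).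
rewrite (@smeasure_integral_null _ (~` B)) ?adde0.
- by rewrite -{2}Bx; exact: smeasure_integral_le.
- exact: measurableC.
rewrite -Bx -pvmI //; last exact: measurableC.
by rewrite setICl pvm_set0.
Qed.

End Nonnegative.

Lemma spectral_dom_range (f : R -> R) x B (K : R) : measurable_fun setT f ->
  (forall t, 0 <= f t) -> measurable B ->
  (forall t, B t -> f t <= K) -> E B x = x -> spectral_dom dot E f x.
Proof.
move=> mf f0 mB fK Bx; rewrite /spectral_dom /= spectral_integralE.
have mf2 : measurable_fun setT (fun t => f t ^+ 2) by exact: measurable_funX.
have := @smeasure_integral_range (fun t => f t ^+ 2)
  (fun t => sqr_ge0 _) mf2 x B (K ^+ 2) mB (sqr_ge0 _) _ Bx.
move=> h; apply: le_lt_trans (h _) _; last by rewrite ltry.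
move=> t Bt; have := fK _ Bt; have := f0 t => h1 h2.
by rewrite ler_sqr ?nnegrE //; lra.
Qed.

Lemma sum4 (V : zmodType) (F : nat -> V) : \sum_(k < 4) F k = F 0 + F 1 + F 2 + F 3.
Proof. by rewrite !big_ord_recr big_ord0 /= add0r. Qed.

(** Stated for any real function q, so that it applies to [spectral_quad] before anything is known
    about its quadratic structure. *)
Lemma polarE (q : H -> R) x y :
  4^-1 * \sum_(k < 4) 'i ^+ k * (q (x + 'i ^+ k *: y))%:C =
  ((4^-1 * (q (x + y) - q (x - y))) +i*
   (4^-1 * (q (x + 'i *: y) - q (x - 'i *: y))))%C.
Proof.
rewrite (_ : 4^-1 = (4^-1)%:C); last by rewrite fmorphV rmorph_nat.
rewrite (sum4 (fun k => 'i ^+ k * (q (x + 'i ^+ k *: y))%:C)) !expr0 !expr1 !scale1r.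
have -> : 'i%C ^+ 3 = - 'i%C :> R[i] by rewrite exprS sqr_i mulrN1.
rewrite sqr_i scaleN1r scaleNr.
by apply/eqP; rewrite eq_complex /=; apply/andP; split; apply/eqP; ring.
Qed.

Lemma polarization x y :
  4^-1 * \sum_(k < 4) 'i ^+ k * (rnorm (x + 'i ^+ k *: y) ^+ 2)%:C = dot x y.
Proof.
rewrite (polarE (fun z => rnorm z ^+ 2)) dotE !(rnorm_sqr dot_norm).
rewrite !(ipDl, ipDr, ipNl, ipNr) (ip_il dot x y) opprK (ipC dot y x).
by congr (_ +i* _)%C; rewrite ?(ipC dot ('i *: y) x); field.
Qed.

Lemma parallelogram x y : rnorm (x + y) ^+ 2 + rnorm (x - y) ^+ 2 =
  2 * (rnorm x ^+ 2 + rnorm y ^+ 2).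
Proof.
rewrite !(rnorm_sqr dot_norm) !(ipDl, ipDr, ipNl, ipNr) (ipC _ y x); ring.
Qed.

Lemma rnorm_pvm_le B x : measurable B -> rnorm (E B x) <= rnorm x.
Proof.
move=> mB; have := rip_le dot_norm (E B x) x.
rewrite pvm_ipE // -(rnorm_sqr dot_norm) ger0_norm ?sqr_ge0 // expr2.
have := rnorm_ge0 (E B x); rewrite le_eqVlt => /predU1P[<-|Bx0].
  by rewrite rnorm_ge0.
by rewrite ler_pM2l.
Qed.

(* Testing the defining identity of [f(A) x] with a small multiple of the
   truncation of [f(A) x] to the set where [f <= n]. *)
Lemma spectral_integral_norm_le (f : R -> R) x B (K : R) :
  measurable_fun setT f -> (forall t, 0 <= f t) -> measurable B -> 0 < K ->
  (forall t, B t -> f t <= K) -> E B x = x ->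
  rnorm (spectral_integral dot E f x) <= K * rnorm x.
Proof.
move=> mf f0 mB K0 fK Bx; rewrite /spectral_integral /=.
set P := (X in xget 0 X).
have [[g Pg]|nP] := pselect (exists g, P g); last first.
  (* Without a solution, [xget] returns the default 0, which satisfies the bound. *)
  rewrite xgetPN ?rnorm0 ?mulr_ge0 ?rnorm_ge0 ?ltW // => g Pg.
  by apply: nP; exists g.
have : P (xget 0 P) by exact: xgetI Pg.
move: (xget 0 P) => {Pg}g Pg.
pose C (n : nat) : set R := [set t | f t <= n%:R].
have mC n : measurable (C n).
  by rewrite -[C n]setTI (_ : C n = f @^-1` `]-oo, n%:R]%classic) //; exact: mf.
have gC n : rnorm (E (C n) g) ^+ 2 <= K ^+ 2 * rnorm x ^+ 2.
  (* With N = |E(C n) g|^2 and X = |x|^2, polarization and the parallelogram law will give N / K <=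
     (K / 2) (X + N / K^2), that is N <= K^2 X; the factor 1 / K balances the two terms. *)
  pose y := (K^-1)%:C *: E (C n) g.
  have Cy : E (C n) y = y by rewrite pvmZ // pvm_idem.
  have ydom : spectral_dom dot E f y.
    by apply: (@spectral_dom_range f y (C n) n%:R).
  have := Pg y ydom; move/(congr1 (@complex.Re R)).
  rewrite /spectral_form polarE /=.
  rewrite [X in X = _ -> _](_ : _ = K^-1 * rnorm (E (C n) g) ^+ 2); last first.
    rewrite -/(rip dot g y) /y ipZr ipC pvm_ipE // (rnorm_sqr dot_norm).
    by [].
  pose I z : \bar R := (\int[smeasure pvmE z]_(t in B) (f t)%:E)%E.
  pose J z : \bar R := (\int[smeasure pvmE z]_(t in ~` B) (f t)%:E)%E.
  have quadE z : spectral_quad dot E f z = fine (I z + J z)%E.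
    by rewrite /spectral_quad spectral_integralE (smeasure_integral_split f0 mf _ mB).
  have xB : E (~` B) x = 0.
    by rewrite -Bx -pvmI ?setICl ?pvm_set0 //; exact: measurableC.
  (* The vector x has no mass off B, so only y contributes there, and these contributions cancel in
     the polarized difference. *)
  have JE (c : R[i]) : `|c| = 1 -> J (x + c *: y) = J y.
    move=> c1; apply: smeasure_integral_eq; first exact: measurableC.
    move=> D mD DB.
    have Dx : E D x = 0 by rewrite -(pvm_sub x mD (measurableC mB) DB) xB pvm0.
    by rewrite pvmD // pvmZ // Dx add0r /rnorm normrZ c1 mul1r.
  have I0 z : (0 <= I z)%E by apply: integral_ge0 => t _; rewrite lee_fin.
  have J0 z : (0 <= J z)%E by apply: integral_ge0 => t _; rewrite lee_fin.
  have IK z : (I z <= (K * rnorm (E B z) ^+ 2)%:E)%E.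
    by apply: smeasure_integral_le => //; exact: ltW.
  have Jfin : J y \is a fin_num.
    rewrite ge0_fin_numE //; apply: (@le_lt_trans _ _ (I y + J y)%E).
      by rewrite leeDr.
    rewrite -(smeasure_integral_split f0 mf _ mB).
    apply: le_lt_trans (ltry (n%:R * rnorm y ^+ 2)).
    by apply: (@smeasure_integral_range _ f0 mf y (C n)).
  have Ifin z : I z \is a fin_num.
    by rewrite ge0_fin_numE // (le_lt_trans (IK z)) // ltry.
  rewrite !quadE -[y]scale1r JE ?normr1 // -scaleNr JE ?normrN1 // !scaleNr !scale1r.
  rewrite !(fineD (Ifin _) Jfin) => h.
  have h1 : fine (I (x + y)) <= K * rnorm (E B (x + y)) ^+ 2.
    by rewrite -lee_fin fineK.
  have h2 : 0 <= fine (I (x - y)) by rewrite fine_ge0.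
  have := parallelogram x (E B y); rewrite -{1 2}Bx -pvmD // => h3.
  have h4 := sqr_ge0 (rnorm (x - E B y)).
  have h5 : rnorm (E B y) ^+ 2 <= K^-1 ^+ 2 * rnorm (E (C n) g) ^+ 2.
    rewrite -exprMn ler_sqr ?nnegrE ?rnorm_ge0 //; last first.
      by rewrite mulr_ge0 ?invr_ge0 ?rnorm_ge0 // ltW.
    apply: le_trans (rnorm_pvm_le _ mB) _.
    by rewrite /y rnormZ // ger0_norm // invr_ge0 ltW.
  rewrite Bx in h3.
  have Kn : K != 0 by rewrite gt_eqF.
  set N := rnorm (E (C n) g) ^+ 2 in h h5 *; set X := rnorm x ^+ 2 in h3 *.
  have h6 : K^-1 * N <= 2^-1 * K * (X + K^-1 ^+ 2 * N).
    have : K * rnorm (E B (x + y)) ^+ 2 <= K * (2 * (X + K^-1 ^+ 2 * N)).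
      by rewrite ler_pM2l //; lra.
    by lra.
  have : K^-1 * N <= 2^-1 * K * X + 2^-1 * (K^-1 * N).
    apply: le_trans h6 _; rewrite le_eqVlt; apply/orP; left; apply/eqP.
    by field.
  move=> h7; have : K * (K^-1 * N) <= K * (K * X) by rewrite ler_pM2l //; lra.
  by rewrite mulVKf // mulrA -expr2.
(* The sets [C n] increase to the whole line, so continuity from below removes the truncation. *)
have cvgC : smeasure pvmE g (C n) @[n --> \oo] --> smeasure pvmE g (\bigcup_n C n).
  apply: nondecreasing_cvg_mu => //; first exact: bigcup_measurable.
  move=> m n mn; apply/subsetPset => t /= h; apply: le_trans h _.
  by rewrite ler_nat.
have CT : \bigcup_n C n = setT.
  apply/seteqP; split => // t _; exists (Num.truncn (f t)).+1 => //=.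
  by apply/ltW; rewrite truncnS_gt.
rewrite CT smeasureE // pvmT in cvgC.
have K0' := ltW K0.
rewrite -(ler_pXn2r (n := 2)) ?nnegrE ?mulr_ge0 ?rnorm_ge0 // exprMn -lee_fin.
apply: (closed_cvg (fun z => z <= (K ^+ 2 * rnorm x ^+ 2)%:E)%E _ _ _ cvgC).
  exact: closed_ereal_ge_ereal.
by apply: nearW => n; rewrite smeasureE // lee_fin.
Qed.

Section Atoms.
(* Compactness of [{x | rnorm (f(A) x) <= 1}] in [H], for some [f] which is
   bounded on bounded sets. *)
Variable f : R -> R.
Hypothesis f0 : forall t, 0 <= f t.
Hypothesis mf : measurable_fun setT f.
Hypothesis f_le : forall t, f t <= `|t| + 1.
Hypothesis f_compact : compact_embedding
  (NSpace (spectral_dom dot E f) (fun u => rnorm (spectral_integral dot E f u)))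
  (spaceH H) id.

Lemma orthogonal_ranges B C x y : measurable B -> measurable C ->
  B `&` C = set0 -> ip (E B x) (E C y) = 0.
Proof.
by move=> mB mC BC; rewrite pvm_ip // -pvmI // BC pvm_set0 ip0r.
Qed.

(** Vectors u_n of norm 1 / K in the ranges of the [E (B n)], where K bounds f on all the [B n],
    satisfy |f(A) u_n| <= 1. They are orthogonal, hence at mutual distance sqrt 2 / K, and no
    subsequence can converge, against compactness. *)
Lemma no_disjoint_bounded (B : nat -> set R) (M : R) :
  (forall n, measurable (B n)) -> (forall n t, B n t -> `|t| <= M) ->
  (forall m n, m != n -> B m `&` B n = set0) ->
  ~ (forall n, ~ null (B n)).
Proof.
move=> mB BM dB nB.
have M1 : 0 < `|M| + 1 by rewrite ltr_wpDl.
set K := `|M| + 1 in M1.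
have fK n t : B n t -> f t <= K.
  move=> /BM h; apply: le_trans (f_le t) _; rewrite lerD2r.
  by rewrite (le_trans h) // ler_norm.
have /choice[u uP] n : exists u, E (B n) u = u /\ rnorm u = K^-1.
  have [x Bx] : exists x, E (B n) x <> 0.
    by apply: contrapT => h; apply: (nB n) => x; apply: contrapT => ?; apply: h; exists x.
  have x0 : rnorm (E (B n) x) != 0 by apply/eqP => /rnorm_eq0.
  exists ((K^-1 / rnorm (E (B n) x))%:C *: E (B n) x); split.
    by rewrite pvmZ // pvm_idem.
  rewrite rnormZ // ger0_norm ?divr_ge0 ?rnorm_ge0 ?invr_ge0 ?(ltW M1) //.
  by rewrite mulfVK.
have [_ /(_ u)] := f_compact.
case=> [n|phi [y [phiM _ cvgy]]].
  have [un ru] := uP n; split.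
    exact: (spectral_dom_range mf f0 (mB n) (fK n) un).
  have := spectral_integral_norm_le mf f0 (mB n) M1 (fK n) un.
  by rewrite ru mulfV ?gt_eqF.
have cvg1 : rnorm (u (phi n.+1) - y) @[n --> \oo] --> 0.
  by rewrite (cvg_shiftS (fun n => rnorm (u (phi n) - y))).
have cvg2 : rnorm (u (phi n) - y) + rnorm (u (phi n.+1) - y) @[n --> \oo] --> (0 : R).
  by rewrite -[0]addr0; exact: cvgD.
have Ki : 0 < K^-1 by rewrite invr_gt0.
have /cvgrPdist_lt/(_ _ Ki)[n _ /(_ n (leqnn _))] := cvg2.
rewrite sub0r normrN ger0_norm ?addr_ge0 ?rnorm_ge0 //= => h.
have := le_lt_trans (rnormD (u (phi n) - y) (- (u (phi n.+1) - y))) _.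
rewrite rnormN => /(_ _ h).
rewrite opprB addrA subrK -ltr_sqr ?nnegrE ?rnorm_ge0 ?ltW //.
have [e1 r1] := uP (phi n); have [e2 r2] := uP (phi n.+1).
rewrite (rnorm_sqr dot_norm) !(ipDl, ipDr, ipNl, ipNr).
have o : ip (u (phi n)) (u (phi n.+1)) = 0.
  rewrite -e1 -e2 orthogonal_ranges // dB //.
  by rewrite neq_ltn phiM.
rewrite (ipC _ (u (phi n.+1))) o -!(rnorm_sqr dot_norm) r1 r2.
by have := sqr_ge0 (K^-1); lra.
Qed.

(** Otherwise every punctured ball around l carries spectral mass, hence so does some annulus inside
    it; iterating towards l produces infinitely many disjoint bounded sets that are not null. *)
Lemma isolated (l : R) : exists2 r : R, 0 < r & null (ball l r `\` [set l]).
Proof.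
apply: contrapT => h.
have mA (s r : R) : measurable (ball l r `\` ball l s : set R).
  by apply: measurableD; exact: measurable_ball.
(* The punctured ball is the union of the annuli with inner radii r / (n + 1), and a countable union
   of null sets is null, so one of these annuli is not null. *)
have /choice[g gP] (r : R) : exists s : R, 0 < r ->
    [/\ 0 < s, s <= r & ~ null (ball l r `\` ball l s)].
  have [r0|r0] := boolP (0 < r); last by exists 0.
  apply: contrapT => h2; apply: h; exists r => //.
  rewrite (_ : _ `\` _ = \bigcup_n (ball l r `\` ball l (r / n.+1%:R))).
    apply: null_bigcup => // n; apply: contrapT => h3; apply: h2.
    exists (r / n.+1%:R) => _; split => //; first by rewrite divr_gt0.
    by rewrite ler_pdivrMr // ler_peMr ?ler1n // ltW.
  apply/seteqP; split => t.
    move=> [tr /eqP tl]; have d0 : 0 < `|l - t| by rewrite normr_gt0 subr_eq0 eq_sym.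
    exists (Num.truncn (r / `|l - t|)) => //; split => //.
    rewrite /ball /= => /ltW; apply/negP; rewrite -ltNge.
    by rewrite ltr_pdivrMr // mulrC -ltr_pdivrMr // truncnS_gt.
  move=> [n _ [tr tn]]; split => //= tl; apply: tn; rewrite tl.
  by apply: ballxx; rewrite divr_gt0.
pose rho n := iter n g 1.
have rho0 n : 0 < rho n.
  by elim: n => [|n ih] /=; [exact: ltr01 | have [] := gP _ ih].
have rhoS n : rho n.+1 <= rho n by have [] := gP _ (rho0 n).
have rho_le m n : (m <= n)%N -> rho n <= rho m.
  move=> /subnK <-; elim: (n - m)%N => [|k ih] //.
  by rewrite addSn (le_trans (rhoS _)).
apply: (@no_disjoint_bounded (fun n => ball l (rho n) `\` ball l (rho n.+1)) (`|l| + 1)).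
- by move=> n; exact: mA.
- move=> n t [+ _]; rewrite /ball /= => tr.
  have := rho_le 0 n isT; rewrite {2}/rho /= => r1.
  rewrite -[t](subrK l) addrC (le_trans (ler_normD _ _)) // lerD2l distrC.
  by rewrite (le_trans (ltW tr)).
- move=> m n; wlog mn : m n / (m < n)%N => [hw|_].
    by rewrite neq_ltn => /orP[mn|mn]; [|rewrite setIC]; rewrite hw // neq_ltn mn // orbT.
  apply/seteqP; split => // t [[_ h1] [h2 _]]; apply: h1.
  by apply: le_ball h2; exact: rho_le.
- by move=> n; have [] := gP _ (rho0 n).
Qed.

(* By Lindelof: countably many isolating intervals with rational endpoints
   cover the line. *)
Lemma atoms_exist : exists l : nat -> R, null (~` (\bigcup_n [set l n])).
Proof.
pose I (n : nat) : set R := if unpickle n is Some pq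
  then [set` `](ratr (pq : rat * rat).1 : R), ratr pq.2[] else set0.
have mI n : measurable (I n) by rewrite /I; case: unpickle.
have /choice[l lP] n : exists l, (exists l', null (I n `\` [set l'])) -> null (I n `\` [set l]).
  by have [[l' h]|h] := pselect (exists l', null (I n `\` [set l'])); [exists l'|exists 0].
exists l.
(* The guard makes every [G n] null: intervals that are not isolating are replaced by the empty
   set. *)
pose G n := if `[< null (I n `\` [set l n]) >] then I n `\` [set l n] else set0.
have mG n : measurable (G n) by rewrite /G; case: ifP => // _; exact: measurableD.
have nG n : null (G n).
  by rewrite /G; case: ifPn => [/asboolP //|_] x; rewrite pvm_set0.
apply: (null_sub _ _ _ (null_bigcup mG nG)).
- by apply: measurableC; exact: bigcup_measurable.
- exact: bigcup_measurable.
move=> t tl; have [r r0 nr] := isolated t.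
have tr1 : t - r < t by rewrite gtrBl.
have tr2 : t < t + r by rewrite ltrDl.
have [p] := rat_in_itvoo tr1; rewrite in_itv /= => /andP[p1 p2].
have [q] := rat_in_itvoo tr2; rewrite in_itv /= => /andP[q1 q2].
have [n In] : exists n, I n = [set` `]ratr p, ratr q[].
  by exists (pickle (p, q)); rewrite /I pickleK.
have tI : I n t by rewrite In /= in_itv /= p2 q1.
have nI : null (I n `\` [set l n]).
  apply: lP; exists t; apply: null_sub nr.
  - by apply: measurableD; [exact: mI | exact: measurable_set1].
  - by apply: measurableD; [exact: measurable_ball | exact: measurable_set1].
  - apply: setSD => s; rewrite In /= in_itv /= => /andP[s1 s2].
    by rewrite /ball /= ltr_norml; lra.
exists n => //; rewrite /G asboolT //; split => //= tn.
by apply: tl; exists n.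
Qed.

End Atoms.

End ProjectionValuedMeasure.

(** * Orthogonal decompositions *)

Section OrthogonalDecomposition.
Context (R : realType) (H : completeNormedModType R[i]).
Variable dot : {dot H for Num.conj}.
Hypothesis dot_norm : forall x : H, `|x| ^+ 2 = dot x x.
Local Notation ip := (rip dot).
Implicit Types (x y : H).

Definition orthogonal_decomposition (P : nat -> H -> H) : Prop :=
  [/\ forall n (c : R[i]) x y, P n (c *: x + y) = c *: P n x + P n y,
      forall n x y, dot (P n x) y = dot x (P n y),
      forall m n x, P m (P n x) = if m == n then P n x else 0
    & forall x, rnorm (\sum_(0 <= i < n) P i x - x) @[n --> \oo] --> 0].

Variable P : nat -> H -> H.
Hypothesis decP : orthogonal_decomposition P.

Lemma dec_linear n (c : R[i]) x y : P n (c *: x + y) = c *: P n x + P n y.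
Proof. by case: decP. Qed.

Lemma decD n x y : P n (x + y) = P n x + P n y.
Proof. by rewrite -{1}[x]scale1r dec_linear scale1r. Qed.

Lemma dec0 n : P n 0 = 0.
Proof.
have := decD n 0 0; rewrite addr0 => /eqP.
by rewrite -subr_eq0 opprD addNKr oppr_eq0 => /eqP.
Qed.

Lemma decZ n (c : R[i]) x : P n (c *: x) = c *: P n x.
Proof. by rewrite -[c *: x]addr0 dec_linear dec0 addr0. Qed.

Lemma decN n x : P n (- x) = - P n x.
Proof. by rewrite -scaleN1r decZ scaleN1r. Qed.

Lemma decPP m n x : P m (P n x) = if m == n then P n x else 0.
Proof. by case: decP. Qed.

Lemma dec_idem n x : P n (P n x) = P n x.
Proof. by rewrite decPP eqxx. Qed.

Lemma dec_dot n x y : dot (P n x) y = dot (P n x) (P n y).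
Proof. by case: decP => _ dP _ _; rewrite -dP dec_idem. Qed.

Lemma dec_dotr n x y : dot x (P n y) = dot (P n x) (P n y).
Proof. by case: decP => _ dP _ _; rewrite dP dec_idem. Qed.

Lemma dec_adj n x y : dot (P n x) y = dot x (P n y).
Proof. by case: decP. Qed.

Lemma dec_ip n x y : ip (P n x) y = ip (P n x) (P n y).
Proof. by rewrite /rip dec_dot. Qed.

Lemma dec_cvg x : rnorm (\sum_(0 <= i < n) P i x - x) @[n --> \oo] --> 0.
Proof. by case: decP. Qed.

Lemma dec_ip0 (h : nat -> H) i j : (forall n, P n (h n) = h n) -> i != j ->
  ip (h i) (h j) = 0.
Proof.
move=> Ph ij; rewrite -(Ph i) dec_ip -(Ph j) decPP (negPf ij); exact: ip0r.
Qed.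

Lemma rnorm_sum_sqr (h : nat -> H) m n : (forall n, P n (h n) = h n) ->
  rnorm (\sum_(m <= i < n) h i) ^+ 2 = \sum_(m <= i < n) rnorm (h i) ^+ 2.
Proof.
move=> Ph; elim: n => [|n ih]; first by rewrite !big_geq // rnorm0 expr0n.
have [mn|nm] := leqP m n; last by rewrite !big_geq // rnorm0 expr0n.
rewrite !big_nat_recr //= -ih !(rnorm_sqr dot_norm) ipDl !ipDr.
suff z : ip (\sum_(m <= i < n) h i) (h n) = 0 by rewrite (ipC _ (h n)) z; ring.
rewrite big_seq_cond; elim/big_ind : _ => [|x y hx hy|i]; first by rewrite ip0l.
  by rewrite ipDl hx hy addr0.
rewrite andbT mem_index_iota => /andP[_ ilt].
by apply: dec_ip0 => //; rewrite neq_ltn ilt.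
Qed.

Lemma rnorm_dist x y : `|rnorm x - rnorm y| <= rnorm (x - y).
Proof.
rewrite ler_norml; have h1 := rnormD (x - y) y; have h2 := rnormD (y - x) x.
by rewrite subrK in h1; rewrite subrK -opprB rnormN in h2; lra.
Qed.

Lemma cvg_rnorm_norm (u : nat -> H) x : rnorm (u n - x) @[n --> \oo] --> 0 ->
  rnorm (u n) @[n --> \oo] --> rnorm x.
Proof.
move=> /cvgrPdist_le h; apply/cvgrPdist_le => e e0.
apply: filterS (h _ e0) => n; rewrite sub0r normrN ger0_norm ?rnorm_ge0 // => hn.
by rewrite distrC; apply: le_trans hn; exact: rnorm_dist.
Qed.

Lemma parseval x : (\sum_(n <oo) (rnorm (P n x) ^+ 2)%:E = (rnorm x ^+ 2)%:E)%E.
Proof.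
apply/cvg_lim => //.
have E n : (\sum_(0 <= i < n) (rnorm (P i x) ^+ 2)%:E =
    (rnorm (\sum_(0 <= i < n) P i x)%R ^+ 2)%:E)%E.
  by rewrite sumEFin (rnorm_sum_sqr (h := fun i => P i x)) // => ?; rewrite dec_idem.
under eq_fun do rewrite E.
apply: cvg_EFin; first exact: nearW.
rewrite /=; under eq_fun do rewrite /= expr2.
by rewrite expr2; apply: cvgM; apply: cvg_rnorm_norm; exact: dec_cvg.
Qed.

Lemma dec_eq x y : (forall n, P n x = P n y) -> x = y.
Proof.
move=> h; apply/eqP; rewrite -subr_eq0; apply/eqP/rnorm_eq0.
have := parseval (x - y); rewrite eseries0 => [[/esym/eqP]|n _ _].
  by rewrite expf_eq0 => /eqP.
by rewrite decD decN h subrr rnorm0 expr0n.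
Qed.

Lemma dec_ip_cvg x y : \sum_(0 <= i < n) ip (P i x) (P i y) @[n --> \oo] --> ip x y.
Proof.
have E n : \sum_(0 <= i < n) ip (P i x) (P i y) = ip (\sum_(0 <= i < n) P i x) y.
  elim: n => [|n ih]; first by rewrite !big_geq // ip0l.
  by rewrite !big_nat_recr //= ih ipDl -dec_ip.
under eq_fun do rewrite E.
apply/cvgrPdist_le => e e0.
have t1 : 0 < rnorm y + 1 by rewrite ltr_wpDl // rnorm_ge0.
have e1 : 0 < e / (rnorm y + 1) by rewrite divr_gt0.
have /cvgrPdist_le/(_ _ e1) := dec_cvg x.
apply: filterS => n; rewrite sub0r normrN ger0_norm ?rnorm_ge0 // => h.
rewrite distrC -ipNl -ipDl (le_trans (rip_le dot_norm _ _)) //.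
rewrite (le_trans (ler_wpM2r (rnorm_ge0 _) h)) // mulrAC ler_pdivrMr //.
by apply: ler_wpM2l; [exact: ltW | rewrite lerDl].
Qed.

Lemma dec_ip_comb (r s : R) x y x1 y1 x2 y2 :
  (forall n, ip (P n x) (P n y) = r * ip (P n x1) (P n y1) + s * ip (P n x2) (P n y2)) ->
  ip x y = r * ip x1 y1 + s * ip x2 y2.
Proof.
move=> h.
have h1 : r * \sum_(0 <= i < n) ip (P i x1) (P i y1) +
    s * \sum_(0 <= i < n) ip (P i x2) (P i y2) @[n --> \oo] --> ip x y.
  have -> : (fun n => r * \sum_(0 <= i < n) ip (P i x1) (P i y1) +
      s * \sum_(0 <= i < n) ip (P i x2) (P i y2)) =
      (fun n => \sum_(0 <= i < n) ip (P i x) (P i y)).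
    by apply/funext => n; rewrite !mulr_sumr -big_split /=; apply: eq_bigr => i _.
  exact: dec_ip_cvg.
apply: (cvg_unique (@norm_hausdorff _ _) h1).
by apply: cvgD; apply: cvgM; by [exact: cvg_cst | exact: dec_ip_cvg].
Qed.

(** The real identity is used after multiplying the left arguments by c = 1 and by c = 'i, which
    yields the two parts of the complex one. Two terms are carried because the equation in V' is a
    sum of a stiffness and a damping form. *)
Lemma dec_dot_comb (r s : R) x y x1 y1 x2 y2 :
  (forall n, dot (P n x) (P n y) =
     r%:C * dot (P n x1) (P n y1) + s%:C * dot (P n x2) (P n y2)) ->
  dot x y = r%:C * dot x1 y1 + s%:C * dot x2 y2.
Proof.
move=> h.
have ipE (c : R[i]) : ip (c *: x) y = r * ip (c *: x1) y1 + s * ip (c *: x2) y2.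
  apply: dec_ip_comb => n; rewrite !decZ /rip !dotZl h mulrDr ReD !(mulrCA c) !ReCM.
  by [].
have := ipE 1; have := ipE 'i%C; rewrite !scale1r !dotE => -> ->.
by apply/eqP; rewrite eq_complex /=; apply/andP; split; apply/eqP; ring.
Qed.

Lemma dec_dot_eq x y x' y' :
  (forall n, dot (P n x) (P n y) = dot (P n x') (P n y')) -> dot x y = dot x' y'.
Proof.
move=> h; rewrite (@dec_dot_comb 1 0 x y x' y' 0 0) => [|n].
  by rewrite (_ : (0 : R)%:C = 0) // (_ : (1 : R)%:C = 1) // mul1r mul0r addr0.
by rewrite h (_ : (0 : R)%:C = 0) // (_ : (1 : R)%:C = 1) // mul1r mul0r addr0.
Qed.

Lemma riesz_fischer (h : nat -> H) : (forall n, P n (h n) = h n) ->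
  (\sum_(n <oo) (rnorm (h n) ^+ 2)%:E < +oo)%E -> exists x, forall n, P n x = h n.
Proof.
move=> Ph hoo.
pose s n := \sum_(0 <= i < n) rnorm (h i) ^+ 2.
have snd : nondecreasing_seq s.
  by apply/nondecreasing_seqP => n; rewrite /s big_nat_recr //= lerDl sqr_ge0.
have [M Ms] : exists M, forall n, s n <= M.
  exists (fine (\sum_(n <oo) (rnorm (h n) ^+ 2)%:E)) => n.
  rewrite -lee_fin fineK; last first.
    by rewrite ge0_fin_numE // nneseries_ge0 // => i _ _; rewrite lee_fin sqr_ge0.
  by rewrite /s -sumEFin; apply: nneseries_lim_ge => i _ _; rewrite lee_fin sqr_ge0.
have cs : cvgn s.
  by apply: nondecreasing_is_cvgn => //; exists M => _ [n _ <-].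
have [x xP] : exists x, rnorm (\sum_(0 <= i < n) h i - x) @[n --> \oo] --> 0.
  apply: rnorm_complete => e e0.
  have e2 : 0 < e ^+ 2 by rewrite exprn_gt0.
  have /cvgrPdist_lt/(_ _ e2)[N _ hN] := cs.
  exists N.
  suff S m n : (N <= m)%N -> (m <= n)%N ->
      rnorm (\sum_(0 <= i < n) h i - \sum_(0 <= i < m) h i) < e.
    move=> m n Nm Nn; have [mn|/ltnW nm] := leqP m n; last exact: S.
    by rewrite -opprB rnormN S.
  move=> Nm mn; rewrite -(ltr_pXn2r (n := 2)) ?nnegrE ?rnorm_ge0 ?ltW //.
  rewrite (big_cat_nat _ mn) //= addrAC subrr add0r rnorm_sum_sqr //.
  have -> : \sum_(m <= i < n) rnorm (h i) ^+ 2 = s n - s m.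
    by rewrite /s [X in X - _](big_cat_nat _ mn) //= addrAC subrr add0r.
  have := hN m Nm; rewrite /= ltr_norml => /andP[_ +].
  have := nondecreasing_cvgn_le snd cs n.
  lra.
exists x => n; apply/eqP; rewrite -subr_eq0; apply/eqP/rnorm_eq0.
have Pn_le y : rnorm (P n y) <= rnorm y.
  rewrite -(ler_pXn2r (n := 2)) ?nnegrE ?rnorm_ge0 // -lee_fin -[leRHS]parseval.
  apply: le_trans (nneseries_lim_ge n.+1 _); last by move=> ? _ _; rewrite lee_fin sqr_ge0.
  rewrite sumEFin lee_fin big_nat_recr //= lerDr sumr_ge0 // => ? _; exact: sqr_ge0.
have Psum k : (n < k)%N -> P n (\sum_(0 <= i < k) h i) = h n.
  move=> nk; have E j : P n (\sum_(0 <= i < j) h i) = \sum_(0 <= i < j) P n (h i).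
    elim: j => [|j ih]; first by rewrite !big_geq // dec0.
    by rewrite !big_nat_recr //= decD ih.
  rewrite E (bigD1_seq n) ?mem_index_iota ?iota_uniq //= Ph big1 ?addr0 // => i ni.
  by rewrite -(Ph i) decPP eq_sym (negPf ni).
apply/eqP; rewrite eq_le rnorm_ge0 andbT; apply/ler_addgt0Pl => e e0.
rewrite addr0; have /cvgrPdist_le/(_ _ e0)[N _ hN] := xP.
have := hN (maxn N n.+1) (leq_maxl _ _).
rewrite /= sub0r normrN ger0_norm ?rnorm_ge0 // => hx.
apply: le_trans hx; apply: le_trans (Pn_le _).
rewrite decD decN Psum; last exact: leq_maxr.
by rewrite -opprB rnormN.
Qed.

(** When w is the square of a multiplier, finiteness describes the domain of the corresponding
    diagonal operator and the value is the squared norm of its image. *)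
Definition wsum (w : nat -> R) x : \bar R := (\sum_(n <oo) (w n * rnorm (P n x) ^+ 2)%:E)%E.

Lemma wsum1 x : wsum (fun=> 1) x = (rnorm x ^+ 2)%:E.
Proof. by rewrite -parseval /wsum; apply: eq_eseriesr => n _; rewrite mul1r. Qed.

Lemma wsum_ge0 (w : nat -> R) x : (forall n, 0 <= w n) -> (0 <= wsum w x)%E.
Proof.
by move=> w0; apply: nneseries_ge0 => n _ _; rewrite lee_fin mulr_ge0 ?sqr_ge0.
Qed.

Lemma wsum_dom (w w' : nat -> R) x (C : R) : (forall n, 0 <= w n) ->
  (forall n, 0 <= w' n) -> 0 <= C ->
  (forall n, w n * rnorm (P n x) ^+ 2 <= C * w' n * rnorm (P n x) ^+ 2) ->
  (wsum w x <= C%:E * wsum w' x)%E.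
Proof.
move=> w0 w'0 C0 ww'; rewrite /wsum -nneseriesZl; last first.
  by move=> n _; rewrite lee_fin mulr_ge0 ?sqr_ge0.
apply: lee_nneseries => n; first by rewrite lee_fin mulr_ge0 ?sqr_ge0.
by move=> _; rewrite -EFinM lee_fin [leRHS]mulrA; exact: ww'.
Qed.

Lemma wsum_lty (w w' : nat -> R) x (C : R) : (forall n, 0 <= w n) ->
  (forall n, 0 <= w' n) -> 0 <= C ->
  (forall n, w n * rnorm (P n x) ^+ 2 <= C * w' n * rnorm (P n x) ^+ 2) ->
  (wsum w' x < +oo)%E -> (wsum w x < +oo)%E.
Proof.
move=> w0 w'0 C0 ww' h; apply: le_lt_trans (wsum_dom w0 w'0 C0 ww') _.
have : wsum w' x \is a fin_num by rewrite ge0_fin_numE ?wsum_ge0.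
by move=> /fineK <-; rewrite -EFinM ltry.
Qed.

Lemma rnormZc (c : R[i]) x : rnorm (c *: x) = complex.Re `|c| * rnorm x.
Proof.
apply: complexI; rewrite -rnormE normrZ rmorphM; congr (_ * _).
  by apply/esym/RRe_real; rewrite normr_real.
Qed.

Lemma wsumD (w : nat -> R) x y : (forall n, 0 <= w n) ->
  (wsum w x < +oo)%E -> (wsum w y < +oo)%E -> (wsum w (x + y)%R < +oo)%E.
Proof.
move=> w0 hx hy; apply: (@le_lt_trans _ _ (2%:E * (wsum w x + wsum w y))%E).
  rewrite /wsum -nneseriesD; try by move=> n _ _; rewrite lee_fin mulr_ge0 ?sqr_ge0.
  rewrite -nneseriesZl; last by move=> n _; rewrite adde_ge0 // lee_fin mulr_ge0 ?sqr_ge0.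
  apply: lee_nneseries => n; first by rewrite lee_fin mulr_ge0 ?sqr_ge0.
  move=> _; rewrite -EFinD -EFinM lee_fin decD -mulrDr [leRHS]mulrCA ler_wpM2l //.
  have h1 := rnormD (P n x) (P n y); have h2 := rnorm_ge0 (P n x + P n y).
  have := sqr_ge0 (rnorm (P n x) - rnorm (P n y)).
  have : rnorm (P n x + P n y) ^+ 2 <= (rnorm (P n x) + rnorm (P n y)) ^+ 2.
    by rewrite ler_sqr ?nnegrE ?addr_ge0 ?rnorm_ge0.
  lra.
have : wsum w x \is a fin_num by rewrite ge0_fin_numE ?wsum_ge0.
have : wsum w y \is a fin_num by rewrite ge0_fin_numE ?wsum_ge0.
by move=> /fineK <- /fineK <-; rewrite -EFinD -EFinM ltry.
Qed.

Lemma wsumZ (w : nat -> R) (c : R[i]) x : (forall n, 0 <= w n) ->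
  (wsum w x < +oo)%E -> (wsum w (c *: x)%R < +oo)%E.
Proof.
move=> w0; pose C := complex.Re `|c| ^+ 2.
have -> : wsum w (c *: x) = wsum (fun n => C * w n) x.
  by apply: eq_eseriesr => n _; rewrite decZ rnormZc exprMn mulrA (mulrC (w n)).
have C0 : 0 <= C := sqr_ge0 _.
by apply: (wsum_lty _ _ C0) => // n; rewrite mulr_ge0.
Qed.

Lemma wsum_fin_proj (w : nat -> R) n x : (forall n, 0 <= w n) ->
  wsum w (P n x) = (w n * rnorm (P n x) ^+ 2)%:E.
Proof.
move=> w0; rewrite /wsum (nneseriesD1 (n := n)) //; last first.
  by move=> k _; rewrite lee_fin mulr_ge0 ?sqr_ge0.
rewrite dec_idem eseries0 ?adde0 // => k _ /andP[_ kn].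
by rewrite decPP (negPf kn) rnorm0 expr0n mulr0.
Qed.

Lemma multiplier_exists (w : nat -> R) x : (wsum (fun n => w n ^+ 2)%R x < +oo)%E ->
  exists g, forall n, P n g = (w n)%:C *: P n x.
Proof.
move=> h; apply: riesz_fischer => [n|]; first by rewrite decZ dec_idem.
congr (_ < _)%E: h; apply: eq_eseriesr => n _.
by rewrite rnormZ exprMn real_normK // num_real.
Qed.

End OrthogonalDecomposition.

(** * Diagonalization of A *)

Section AtomicMeasure.
Context (R : realType) (H : completeNormedModType R[i]).
Variable dot : {dot H for Num.conj}.
Hypothesis dot_norm : forall x : H, `|x| ^+ 2 = dot x x.
Variable E : set R -> H -> H.
Hypothesis pvmE : projection_valued_measure dot E.
Variable l : nat -> R.
Hypothesis null_l : null E (~` (\bigcup_n [set l n])).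
Implicit Types (x y : H) (B : set R) (f : R -> R).

(* Only the first occurrence of a value of [l] counts. *)
Definition atom (n : nat) : H -> H := E (seqDU (fun k => [set l k]) n).

Let mB n : measurable (seqDU (fun k => [set l k]) n).
Proof. by apply: seqDU_measurable => k; exact: measurable_set1. Qed.

Lemma atom_decomposition : orthogonal_decomposition dot atom.
Proof.
split.
- by move=> n c x y; exact: (pvm_linear pvmE).
- by move=> n x y; exact: (pvm_dot pvmE).
- move=> m n x; case: eqP => [->|/eqP mn]; first exact: (pvm_idem pvmE).
  rewrite /atom -(pvmI pvmE) //.
  have /trivIsetP/(_ m n Logic.I Logic.I mn) -> := trivIset_seqDU (fun k => [set l k]).
  exact: (pvm_set0 pvmE).
- move=> x; have mD : measurable (\bigcup_k [set l k]) by exact: bigcupT_measurable.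
  have := pvm_sigma pvmE x mB (trivIset_seqDU _).
  have Dx : E (\bigcup_k [set l k]) x = x.
    by rewrite -[RHS](pvmC pvmE x mD) null_l addr0.
  by rewrite -seqDU_bigcup_eq Dx.
Qed.

(** The n-th set is [[set l n]] or empty; in the latter case [atom n] vanishes and both branches
    agree. *)
Lemma pvm_atom B n x : measurable B ->
  E B (atom n x) = if l n \in B then atom n x else 0.
Proof.
move=> mBB; have sub := @subset_seqDU _ (fun k => [set l k]) n.
rewrite /atom -(pvmI pvmE) //; case: ifPn => [/set_mem lB|lB].
  by congr (E _ x); apply/setIidPr => t /sub ->.
rewrite (_ : B `&` _ = set0) ?(pvm_set0 pvmE) //.
by apply/seteqP; split => // t [Bt /sub tl]; move: lB; rewrite -tl mem_set.
Qed.

Lemma atom_pvm B n x : measurable B ->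
  atom n (E B x) = if l n \in B then atom n x else 0.
Proof.
by move=> mBB; rewrite -pvm_atom // /atom -!(pvmI pvmE) // setIC.
Qed.

Let c x n : {nonneg R} := NngNum (sqr_ge0 (rnorm (atom n x))).

(** Parseval applied to [E B x] exhibits the scalar measure as a sum of weighted Dirac masses, so
    that spectral integrals become the series [wsum]. *)
Lemma scalar_measure_atoms x B : measurable B ->
  scalar_measure dot E x B = mseries (fun n => mscale (c x n) \d_(l n)) 0 B.
Proof.
move=> mBB; rewrite /scalar_measure -/(rip dot (E B x) x).
rewrite (pvm_ipE pvmE) // -(rnorm_sqr dot_norm).
rewrite -(parseval dot_norm atom_decomposition) /mseries.
apply: eq_eseriesr => n _; rewrite atom_pvm // -[RHS]/((rnorm (atom n x) ^+ 2)%:E * \d_(l n) B)%E diracE.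
case: ifP => _; first by rewrite mule1.
by rewrite rnorm0 expr0n mule0.
Qed.

Lemma spectral_integral_series f x : (forall t, 0 <= f t) -> measurable_fun setT f ->
  (\int[scalar_measure dot E x]_t (f t)%:E = wsum atom (f \o l) x)%E.
Proof.
move=> f0 mf.
rewrite (integral_raw _ (fun B mBB => scalar_measure_atoms x mBB)).
have mfE : measurable_fun setT (EFin \o f) by exact/measurable_EFinP.
rewrite ge0_integral_measure_series //; last by move=> t _; rewrite lee_fin.
apply: eq_eseriesr => n _.
rewrite ge0_integral_mscale //; last by move=> t _; rewrite lee_fin.
by rewrite integral_dirac // diracT mul1e -EFinM mulrC.
Qed.

Lemma spectral_domE f x : measurable_fun setT f ->
  spectral_dom dot E f x <-> (wsum atom (fun n => f (l n) ^+ 2)%R x < +oo)%E.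
Proof.
move=> mf; rewrite /spectral_dom /= (@spectral_integral_series (fun t => f t ^+ 2)) //.
  by move=> t; exact: sqr_ge0.
exact: measurable_funX.
Qed.

Lemma spectral_dom_lin f (k : R[i]) x y : measurable_fun setT f ->
  spectral_dom dot E f x -> spectral_dom dot E f y -> spectral_dom dot E f (x + k *: y).
Proof.
move=> mf; rewrite !spectral_domE // => hx hy.
have w0 n : 0 <= f (l n) ^+ 2 := sqr_ge0 _.
by apply: (wsumD atom_decomposition) => //; apply: (wsumZ atom_decomposition).
Qed.

Lemma spectral_dom_abs f x : measurable_fun setT f -> spectral_dom dot E f x ->
  (wsum atom (fun n => `|f (l n)|)%R x < +oo)%E.
Proof.
move=> mf; rewrite spectral_domE // => hx.
have h1 : (wsum atom (fun=> 1%R) x < +oo)%E.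
  by rewrite (wsum1 dot_norm atom_decomposition) ltry.
apply: (@le_lt_trans _ _ (wsum atom (fun n => f (l n) ^+ 2)%R x + wsum atom (fun=> 1%R) x)%E).
  rewrite /wsum -nneseriesD; try by move=> n _ _; rewrite lee_fin mulr_ge0 ?sqr_ge0.
  apply: lee_nneseries => n; first by rewrite lee_fin mulr_ge0 ?sqr_ge0.
  move=> _; rewrite -EFinD lee_fin -mulrDl ler_wpM2r ?sqr_ge0 //.
  have -> : f (l n) ^+ 2 = `|f (l n)| ^+ 2 by rewrite real_normK ?num_real.
  by have := sqr_ge0 (`|f (l n)| - 1); have := sqr_ge0 (`|f (l n)|); lra.
exact: lte_add_pinfty.
Qed.

(** For nonnegative f, the quadratic form at x + k y is the squared norm of sqrt(f)(A) x + k
    sqrt(f)(A) y, so the form defined by polarization is the inner product of these two images. *)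
Lemma spectral_form_ge0 f x y g : (forall t, 0 <= f t) -> measurable_fun setT f ->
  (forall n, atom n g = (f (l n))%:C *: atom n x) ->
  (wsum atom (f \o l) x < +oo)%E -> (wsum atom (f \o l) y < +oo)%E ->
  dot g y = spectral_form dot E f x y.
Proof.
move=> f0 mf gP hx hy.
have sq n : Num.sqrt (f (l n)) ^+ 2 = f (l n) by rewrite sqr_sqrtr.
have sqE z : wsum atom (fun n => Num.sqrt (f (l n)) ^+ 2) z = wsum atom (f \o l) z.
  by rewrite /wsum; apply: eq_eseriesr => n _; rewrite sq.
have [gx gxP] := multiplier_exists dot_norm atom_decomposition (etrans (f_equal (fun t => (t < +oo)%E) (sqE x)) hx).
have [gy gyP] := multiplier_exists dot_norm atom_decomposition (etrans (f_equal (fun t => (t < +oo)%E) (sqE y)) hy).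
have qE (k : R[i]) : spectral_quad dot E f (x + k *: y) = rnorm (gx + k *: gy) ^+ 2.
  rewrite /spectral_quad spectral_integral_series // -[RHS]/(fine (rnorm (gx + k *: gy) ^+ 2)%:E).
  rewrite -(parseval dot_norm atom_decomposition); congr fine.
  apply: eq_eseriesr => n _ /=.
  rewrite !(decD atom_decomposition) !(decZ atom_decomposition) gxP gyP.
  by rewrite [k *: (_ *: _)]scalerA (mulrC k) -scalerA -scalerDr rnormZ exprMn real_normK ?num_real // sq.
rewrite /spectral_form; under eq_bigr do rewrite qE.
rewrite (polarization dot_norm).
apply: (dec_dot_eq dot_norm atom_decomposition) => n; rewrite gP gxP gyP.
rewrite !dotZl [dot _ (_ *: _)]dotC dotZl rmorphM /= -dotC mulrA; congr (_ * _).
rewrite (_ : Num.conj _ = (Num.sqrt (f (l n)))%:C).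
  by rewrite -rmorphM /= -expr2 sq.
by apply: conj_Creal; apply/complex_realP; exists (Num.sqrt (f (l n))).
Qed.

Lemma spectral_quad_split f x : measurable_fun setT f ->
  (wsum atom (fun n => `|f (l n)|)%R x < +oo)%E ->
  spectral_quad dot E f x = spectral_quad dot E (fun t => Num.max (f t) 0) x -
                            spectral_quad dot E (fun t => Num.max (- f t) 0) x.
Proof.
move=> mf hx; rewrite /spectral_quad.
have mp : measurable_fun setT (fun t => Num.max (f t) 0).
  by apply: measurable_maxr => //; exact: measurable_cst.
have mn : measurable_fun setT (fun t => Num.max (- f t) 0).
  by apply: measurable_maxr; [exact: measurable_funN | exact: measurable_cst].
have fin (h : R -> R) : (forall t, 0 <= h t) -> (forall t, h t <= `|f t|) -> measurable_fun setT h ->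
    (\int[scalar_measure dot E x]_t (h t)%:E)%E \is a fin_num.
  move=> h0 hf mh; rewrite spectral_integral_series // ge0_fin_numE ?wsum_ge0 //; last by move=> n; exact: h0.
  apply: le_lt_trans hx; apply: lee_nneseries => n; first by rewrite lee_fin mulr_ge0 ?sqr_ge0 //; exact: h0.
  by move=> _; rewrite lee_fin ler_wpM2r ?sqr_ge0 //; exact: hf.
rewrite -fineB; first last.
- apply: fin => // t; first by rewrite le_max lexx orbT.
  by rewrite ge_max normr_ge0 andbT -normrN ler_norm.
- apply: fin => // t; first by rewrite le_max lexx orbT.
  by rewrite ge_max normr_ge0 andbT ler_norm.
rewrite (spectral_integralE dot_norm pvmE) integralE; congr (fine (_ - _)%E).
  rewrite (spectral_integralE dot_norm pvmE); apply: eq_integral => t _.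
  by rewrite funeposE EFin_max.
rewrite (spectral_integralE dot_norm pvmE); apply: eq_integral => t _.
by rewrite funenegE EFin_max.
Qed.

(** Both parts of f = f^+ - f^- are dominated by |f|, so each has its own multiplier vector, and
    [spectral_quad] splits without an indeterminate difference of infinities. *)
Lemma spectral_integral_mult f x : measurable_fun setT f -> spectral_dom dot E f x ->
  exists g, (forall n, atom n g = (f (l n))%:C *: atom n x) /\
    forall y, spectral_dom dot E f y -> dot g y = spectral_form dot E f x y.
Proof.
move=> mf xd.
pose fp t := Num.max (f t) 0; pose fn t := Num.max (- f t) 0.
have mp : measurable_fun setT fp.
  by apply: measurable_maxr => //; exact: measurable_cst.
have mn : measurable_fun setT fn.
  by apply: measurable_maxr; [exact: measurable_funN | exact: measurable_cst].
have fp0 t : 0 <= fp t by rewrite le_max lexx orbT.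
have fn0 t : 0 <= fn t by rewrite le_max lexx orbT.
have fpa t : fp t <= `|f t| by rewrite ge_max normr_ge0 andbT ler_norm.
have fna t : fn t <= `|f t| by rewrite ge_max normr_ge0 andbT -normrN ler_norm.
have fE t : f t = fp t - fn t.
  rewrite /fp /fn; have [h|h] := leP 0 (f t).
    by rewrite max_r ?oppr_le0 // subr0.
  by rewrite max_l ?oppr_ge0 ?ltW // opprK add0r.
have sum_lty (h : R -> R) z : (forall t, 0 <= h t) -> (forall t, h t <= `|f t|) ->
    spectral_dom dot E f z -> (wsum atom (h \o l) z < +oo)%E.
  move=> h0 hf /(spectral_dom_abs mf); apply: le_lt_trans.
  apply: lee_nneseries => n; first by rewrite lee_fin mulr_ge0 ?sqr_ge0 //; exact: h0.
  by move=> _; rewrite lee_fin ler_wpM2r ?sqr_ge0 //; exact: hf.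
have ex (h : R -> R) : (forall t, 0 <= h t) -> (forall t, h t <= `|f t|) ->
    exists g, forall n, atom n g = (h (l n))%:C *: atom n x.
  move=> h0 hf; apply: (multiplier_exists dot_norm atom_decomposition (w := h \o l)).
  move: xd; rewrite spectral_domE //; apply: le_lt_trans.
  apply: lee_nneseries => n; first by rewrite lee_fin mulr_ge0 ?sqr_ge0.
  move=> _; rewrite lee_fin ler_wpM2r ?sqr_ge0 // -[leRHS]real_normK ?num_real //.
  by rewrite ler_sqr ?nnegrE ?h0 // hf.
have [gp gpP] := ex fp fp0 fpa.
have [gn gnP] := ex fn fn0 fna.
exists (gp - gn); split.
  move=> n; rewrite (decD atom_decomposition) (decN atom_decomposition) gpP gnP fE.
  by rewrite rmorphB /= scalerBl.
move=> y yd; rewrite linearBl /=.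
rewrite (@spectral_form_ge0 fp x y gp) //; try exact: sum_lty.
rewrite (@spectral_form_ge0 fn x y gn) //; try exact: sum_lty.
rewrite /spectral_form -mulrBr -sumrB; congr (_ * _).
apply: eq_bigr => k _; rewrite -mulrBr -rmorphB /=; congr (_ * _%:C).
by rewrite -spectral_quad_split //; apply: spectral_dom_abs => //; exact: spectral_dom_lin.
Qed.

(** Every [atom n e] lies in the domain of f(A), so the weak identity, tested on these vectors only,
    already determines all components of g. *)
Lemma spectral_integral_uniq f x g : measurable_fun setT f -> spectral_dom dot E f x ->
  (forall y, spectral_dom dot E f y -> dot g y = spectral_form dot E f x y) ->
  forall n, atom n g = (f (l n))%:C *: atom n x.
Proof.
move=> mf xd g'd n; have [g0 [gP gd]] := spectral_integral_mult mf xd.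
rewrite -gP; apply: dot_inj => // e.
have ed : spectral_dom dot E f (atom n e).
  rewrite spectral_domE // (wsum_fin_proj atom_decomposition) ?ltry // => ?; exact: sqr_ge0.
rewrite ![dot (atom n _) e](pvm_dot pvmE) //.
by rewrite (g'd _ ed) (gd _ ed).
Qed.

Lemma spectral_integral_atom f x n : measurable_fun setT f -> spectral_dom dot E f x ->
  atom n (spectral_integral dot E f x) = (f (l n))%:C *: atom n x.
Proof.
move=> mf xd; have [g [_ gd]] := spectral_integral_mult mf xd.
apply: spectral_integral_uniq => //; rewrite /spectral_integral /=.
set Q := (X in xget 0 X).
have Qg : Q g := gd.
exact: xgetI Qg.
Qed.

End AtomicMeasure.

Section Diagonalization.
Context (R : realType) (H : completeNormedModType R[i]).
Variable dot : {dot H for Num.conj}.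
Hypothesis dot_norm : forall x : H, `|x| ^+ 2 = dot x x.
Variable A : operator H.
Hypothesis A_pos : positive_operator dot A.
Hypothesis A_unb : unbounded A.
Hypothesis VH_compact : compact_embedding (spaceV dot A) (spaceH H) id.
Hypothesis A_coercive : exists2 a0 : R, 0 < a0 &
  forall u, carrier (spaceV dot A) u -> rnorm u <= a0 * rnorm (fpow dot A 2^-1 u).

(* Otherwise [fpow dot A 2^-1] would be [0] on all of [H], hence [H = {0}]. *)
Lemma spectral_measure_exists : is_spectral_measure dot A (spectral_measure dot A).
Proof.
rewrite /spectral_measure; set P := (X in xget _ X).
have [[E PE]|nE] := pselect (exists E, P E); first exact: xgetI PE.
exfalso; have [a0 _ h] := A_coercive.
have E0 : spectral_measure dot A = (fun _ _ => 0).
  by apply: xgetPN => E PE; apply: nE; exists E.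
have S0 x : scalar_measure dot (fun _ _ => 0) x = mzero.
  by apply/funext => B; rewrite /scalar_measure linear0l.
have dE u : spectral_dom dot (fun _ _ => 0) (fun l => l `^ 2^-1) u.
  by rewrite /spectral_dom /= S0 integral_measure_zero ltry.
have fE u : fpow dot A 2^-1 u = 0.
  rewrite /fpow E0 /spectral_integral /=; set Q := (X in xget 0 X).
  have Q0 : Q 0.
    move=> y _; rewrite linear0l /spectral_form big1 ?mulr0 // => k _.
    by rewrite /spectral_quad S0 integral_measure_zero /= mulr0.
  have : Q (xget 0 Q) by exact: xgetI Q0.
  move=> /(_ (xget 0 Q) (dE _)); rewrite -(Q0 (xget 0 Q) (dE _)) linear0l => xx.
  by apply: (ipxx_eq0 dot_norm); rewrite /rip xx.
apply: A_unb; exists 0 => x _; rewrite mul0r.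
have : rnorm (A x) <= a0 * rnorm (fpow dot A 2^-1 (A x)).
  by apply: h; rewrite /= /fpow E0; exact: dE.
by rewrite fE rnorm0 mulr0.
Qed.

Local Notation E := (spectral_measure dot A).

Let pvmE : projection_valued_measure dot E.
Proof. by case: spectral_measure_exists. Qed.

Let mpow s : measurable_fun setT (fun t : R => t `^ s).
Proof. exact: measurable_powR. Qed.

(** The growth condition asked of f in the construction of the atoms. At negative t the power is exp
    0 = 1, since [ln] vanishes there. *)
Lemma half_powR_le (t : R) : t `^ 2^-1 <= `|t| + 1.
Proof.
have [t0|t0] := ltP t 0.
  by rewrite /powR lt_eqF // (ln0 (ltW t0)) mulr0 expR0 lerDr.
rewrite powR12_sqrt // -ler_sqr ?nnegrE ?sqrtr_ge0 ?addr_ge0 // sqr_sqrtr //.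
by rewrite ger0_norm // sqrrD1; have := sqr_ge0 t; lra.
Qed.

Lemma diagonalization : exists (P : nat -> H -> H) (m : nat -> R) (m0 : R),
  [/\ orthogonal_decomposition dot P,
      0 < m0, forall n, m0 <= m n,
      forall N : R, exists n, N <= m n /\ exists x, P n x <> 0
    & forall s x,
      (dom (fpow dot A s) x <-> (wsum P (fun n => (m n `^ s) ^+ 2)%R x < +oo)%E) /\
      (dom (fpow dot A s) x -> forall n, P n (fpow dot A s x) = (m n `^ s)%:C *: P n x)].
Proof.
have [l null_l] := atoms_exist dot_norm pvmE (fun t => powR_ge0 t 2^-1)
   (mpow _) half_powR_le VH_compact.
pose P := atom E l.
have decP : orthogonal_decomposition dot P := atom_decomposition pvmE null_l.
(* Components that are zero, and negative atoms, receive the value 1 so that m is bounded below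
   everywhere. The powers of A do not change: [powR] is 1 at a negative base. *)
pose m n := if `[< exists x, P n x <> 0 >] && (0 <= l n) then l n else 1.
have lm n x s : (l n `^ s)%:C *: P n x = (m n `^ s)%:C *: P n x.
  have [->|/eqP Px] := eqVneq (P n x) 0; first by rewrite !scaler0.
  rewrite /m asboolT /=; last by exists x.
  case: leP => // l0; rewrite powR1 /powR lt_eqF // ln0 ?ltW // mulr0 expR0.
  by [].
have lmw s x : wsum P (fun n => (l n `^ s) ^+ 2) x = wsum P (fun n => (m n `^ s) ^+ 2) x.
  apply: eq_eseriesr => n _; congr EFin; move: (lm n x s) => /(congr1 (@rnorm R H)).
  rewrite !rnormZ !ger0_norm ?powR_ge0 // => h.
  by rewrite -!exprMn h.
have fpowP s x : (dom (fpow dot A s) x <-> (wsum P (fun n => (m n `^ s) ^+ 2)%R x < +oo)%E) /\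
      (dom (fpow dot A s) x -> forall n, P n (fpow dot A s x) = (m n `^ s)%:C *: P n x).
  split; first by rewrite -lmw; exact: (spectral_domE dot_norm pvmE null_l).
  by move=> xd n; rewrite -lm; exact: (spectral_integral_atom dot_norm pvmE null_l).
have [a0 a0_gt0 coer] := A_coercive.
(* Coercivity on an eigenvector reads 1 <= a0 sqrt(l n). *)
have l_ge n x : P n x <> 0 -> 0 <= l n -> a0^-1 ^+ 2 <= l n.
  move=> Px l0.
  have d : dom (fpow dot A 2^-1) (P n x).
    apply/(fpowP _ _).1; rewrite (wsum_fin_proj decP) ?ltry // => k; exact: sqr_ge0.
  have := coer _ d.
  have -> : fpow dot A 2^-1 (P n x) = (l n `^ 2^-1)%:C *: P n x.
    suff h k : P k (fpow dot A 2^-1 (P n x)) = P k ((l n `^ 2^-1)%:C *: P n x).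
      exact: (dec_eq dot_norm decP h).
    rewrite (fpowP _ _).2 // (decZ decP).
    rewrite !(decPP decP); case: eqP => [->|_]; last by rewrite !scaler0.
    by rewrite lm.
  rewrite rnormZ ger0_norm ?powR_ge0 // mulrA ler_pMl; last first.
    rewrite lt_neqAle rnorm_ge0 andbT eq_sym; apply/eqP => /rnorm_eq0; exact: Px.
  rewrite powR12_sqrt // => h.
  rewrite -[leRHS](sqr_sqrtr l0) ler_sqr ?nnegrE ?sqrtr_ge0 ?invr_ge0 ?(ltW a0_gt0) //.
  by rewrite -ler_pdivrMl // in h; rewrite mulr1 in h.
(* The 1 in the minimum accounts for the default value in the definition of m. *)
exists P, m, (Num.min 1 (a0^-1 ^+ 2)); split => //.
- by rewrite lt_min ltr01 exprn_gt0 // invr_gt0.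
- move=> n; rewrite /m; case: ifP => [/andP[/asboolP[x Px] l0]|_].
    by rewrite ge_min (l_ge n x) ?orbT.
  by rewrite ge_min lexx.
(* If every nonzero component had m n < N, then A, acting as [l n] on the n-th component, would be
   bounded by |N|. Its positivity, tested on eigenvectors, excludes the negative atoms that m
   conceals. *)
move=> N; apply: contrapT => h.
have [_ domA AE] := spectral_measure_exists.
have AP x n : dom A x -> P n (A x) = (l n)%:C *: P n x.
  move=> Ax; apply: (spectral_integral_uniq dot_norm pvmE null_l (f := id)) => //.
    by rewrite -domA.
  by move=> y yd; apply: AE => //; rewrite domA.
have l_ge0 n x : P n x <> 0 -> 0 <= l n.
  move=> Px.
  have d : dom A (P n x).
    rewrite domA; apply/(spectral_domE dot_norm pvmE null_l _ (f := id)) => //.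
    rewrite (wsum_fin_proj decP) ?ltry // => k; exact: sqr_ge0.
  have := A_pos d; rewrite (dec_dotr decP) AP // (dec_idem decP) dotZl lecE ReCM => /andP[_].
  rewrite -/(rip dot (P n x) (P n x)) pmulr_lge0 //.
  rewrite lt_neqAle (ipxx_ge0 dot_norm) andbT eq_sym.
  by apply/eqP => /(ipxx_eq0 dot_norm).
apply: A_unb; exists `|N| => x Ax.
rewrite -(ler_pXn2r (n := 2)) ?nnegrE ?mulr_ge0 ?rnorm_ge0 // exprMn -lee_fin.
rewrite [leRHS]EFinM -(wsum1 dot_norm decP x) -(wsum1 dot_norm decP (A x)).
rewrite /wsum -nneseriesZl; last by move=> n _; rewrite lee_fin mul1r sqr_ge0.
apply: lee_nneseries => n; first by rewrite lee_fin mul1r sqr_ge0.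
move=> _; rewrite -EFinM lee_fin !mul1r -/P AP // rnormZ exprMn.
have [->|/eqP Px] := eqVneq (P n x) 0; first by rewrite rnorm0 expr0n !mulr0.
apply: ler_wpM2r; first exact: sqr_ge0.
rewrite ler_sqr ?nnegrE //.
have l0 := l_ge0 _ _ Px; rewrite ger0_norm //.
apply: le_trans (ler_norm N); apply: contrapT => /negP; rewrite -ltNge => lN.
apply: h; exists n; split; last by exists x.
by rewrite /m asboolT /=; [rewrite l0 ltW | exists x].
Qed.

End Diagonalization.

(** * Lyapunov form of a mode *)

Section Mode.
Context (R : realType) (H : completeNormedModType R[i]).
Variable dot : {dot H for Num.conj}.
Hypothesis dot_norm : forall x : H, `|x| ^+ 2 = dot x x.
Local Notation ip := (rip dot).
Local Notation HH := (H * H * H * H)%type.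
Variables (a b gamma : R).
Hypotheses (a_gt0 : 0 < a) (b_gt0 : 0 < b) (gamma_gt0 : 0 < gamma) (a_neq_b : a != b).

(* The generator on an eigenspace of [A] for the eigenvalue [mu], where
   [A^theta] acts as [d]. *)
Definition mode_op (mu d : R) (Z : HH) : HH := let: (u, v, w, z) := Z in
  (v, - ((a * mu)%:C *: u + (gamma * d)%:C *: (v + z)),
   z, - ((b * mu)%:C *: w + (gamma * d)%:C *: (v + z))).

Definition mode_ip (mu : R) (Z Z' : HH) : R :=
  let: (u, v, w, z) := Z in let: (u', v', w', z') := Z' in
  a * mu * ip u u' + ip v v' + b * mu * ip w w' + ip z z'.

Definition mode_sqr mu Z := mode_ip mu Z Z.

(* Along the undamped flow, the derivative of
   [4 (a u.z - b v.w) / (a - b) + u.v + w.z] is [2 |v + z|^2 - mode_sqr mu]. *)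
Definition lyapunov (eps mu d : R) (Z Z' : HH) : R :=
  let: (u, v, w, z) := Z in let: (u', v', w', z') := Z' in
  mode_ip mu Z Z' + eps * d / 2 *
    (4 / (a - b) * (a * (ip u z' + ip u' z) - b * (ip v w' + ip v' w))
     + (ip u v' + ip u' v) + (ip w z' + ip w' z)).

Lemma young (x y : H) (t : R) : 0 < t -> 2 * ip x y <= t * ip x x + ip y y / t.
Proof.
move=> t0; have := ipxx_ge0 dot_norm (t%:C *: x - y).
rewrite !(ipDl, ipDr, ipNl, ipNr, ipZl, ipZr) (ipC _ y x) => h.
have -> : t * ip x x + ip y y / t = 2 * ip x y +
    (t * (t * ip x x) + - (t * ip x y) + (- (t * ip x y) - - ip y y)) / t.
  by field; rewrite gt_eqF.
by rewrite lerDl divr_ge0 ?(ltW t0) //; lra.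
Qed.

Lemma youngN (x y : H) (t : R) : 0 < t -> - (t * ip x x + ip y y / t) <= 2 * ip x y.
Proof.
by move=> t0; have := young (- x) y t0; rewrite !ipNl ipNr opprK; lra.
Qed.

Lemma young_norm (x y : H) (c t : R) : 0 < t ->
  `|2 * (c * ip x y)| <= `|c| * (t * ip x x + ip y y / t).
Proof.
move=> t0; rewrite mulrCA normrM ler_wpM2l // ler_norml.
by rewrite young // youngN.
Qed.

Lemma mode_sqr_ge0 mu Z : 0 < mu -> 0 <= mode_sqr mu Z.
Proof.
case: Z => [[[u v] w] z] mu0; rewrite /mode_sqr /=.
have := ipxx_ge0 dot_norm u; have := ipxx_ge0 dot_norm v.
have := ipxx_ge0 dot_norm w; have := ipxx_ge0 dot_norm z.
have := mulr_gt0 a_gt0 mu0; have := mulr_gt0 b_gt0 mu0.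
by move=> *; rewrite !addr_ge0 // mulr_ge0 // ltW.
Qed.

Lemma ab_neq0 : a - b != 0. Proof. by rewrite subr_eq0. Qed.

Lemma mode_ipC mu Z Z' : mode_ip mu Z Z' = mode_ip mu Z' Z.
Proof.
case: Z => [[[u v] w] z]; case: Z' => [[[u' v'] w'] z'] /=.
by rewrite (ipC _ u) (ipC _ v) (ipC _ w) (ipC _ z).
Qed.

Lemma mode_ipDl mu Z1 Z2 Z : mode_ip mu (Z1 + Z2) Z = mode_ip mu Z1 Z + mode_ip mu Z2 Z.
Proof.
case: Z => [[[u v] w] z]; case: Z1 => [[[u1 v1] w1] z1]; case: Z2 => [[[u2 v2] w2] z2] /=.
by rewrite !ipDl; ring.
Qed.

Lemma mode_ipZl mu r Z1 Z : mode_ip mu (r%:C *: Z1) Z = r * mode_ip mu Z1 Z.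
Proof.
case: Z => [[[u v] w] z]; case: Z1 => [[[u1 v1] w1] z1] /=.
by rewrite !ipZl; ring.
Qed.

Lemma mode_sqrD mu Z1 Z2 : 0 < mu ->
  mode_sqr mu (Z1 + Z2) <= 2 * mode_sqr mu Z1 + 2 * mode_sqr mu Z2.
Proof.
move=> mu0; have := mode_sqr_ge0 (Z1 + (-1)%:C *: Z2) mu0.
rewrite /mode_sqr !(mode_ipDl, mode_ipZl, mode_ipC _ _ (_ + _), mode_ipC _ _ (_ *: _)).
by rewrite (mode_ipC _ Z2 Z1); lra.
Qed.

Lemma mode_sqrZ mu (c : R[i]) Z : mode_sqr mu (c *: Z) = complex.Re `|c| ^+ 2 * mode_sqr mu Z.
Proof.
case: Z => [[[u v] w] z]; rewrite /mode_sqr.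
have E x : ip (c *: x) (c *: x) = complex.Re `|c| ^+ 2 * ip x x.
  by rewrite -!(rnorm_sqr dot_norm) rnormZc exprMn.
rewrite -[LHS]/(a * mu * ip (c *: u) (c *: u) + ip (c *: v) (c *: v) +
  b * mu * ip (c *: w) (c *: w) + ip (c *: z) (c *: z)) !E /mode_ip.
by ring.
Qed.

Lemma lyapunovC eps mu d Z Z' : lyapunov eps mu d Z Z' = lyapunov eps mu d Z' Z.
Proof.
rewrite /lyapunov; have := mode_ipC mu Z Z'.
case: Z => [[[u v] w] z]; case: Z' => [[[u' v'] w'] z'] ->.
by congr (_ + _ * _); ring.
Qed.

Lemma lyapunovDl eps mu d Z1 Z2 Z :
  lyapunov eps mu d (Z1 + Z2) Z = lyapunov eps mu d Z1 Z + lyapunov eps mu d Z2 Z.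
Proof.
rewrite /lyapunov; have := mode_ipDl mu Z1 Z2 Z.
case: Z => [[[u v] w] z]; case: Z1 => [[[u1 v1] w1] z1]; case: Z2 => [[[u2 v2] w2] z2].
by move=> /= ->; rewrite !ipDl !ipDr; ring.
Qed.

Lemma lyapunovZl eps mu d r Z1 Z :
  lyapunov eps mu d (r%:C *: Z1) Z = r * lyapunov eps mu d Z1 Z.
Proof.
rewrite /lyapunov; have := mode_ipZl mu r Z1 Z.
case: Z => [[[u v] w] z]; case: Z1 => [[[u1 v1] w1] z1].
by move=> /= ->; rewrite !ipZl !ipZr; ring.
Qed.

Lemma lyapunov_i eps mu d Z : lyapunov eps mu d ('i *: Z) Z = 0.
Proof.
case: Z => [[[u v] w] z] /=; rewrite !ip_ixx !ip_il.
by rewrite (ipC _ _ ('i *: z)) !ip_il; ring.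
Qed.

(** The first term is the dissipation of the energy and the rest comes from the cross terms. Besides
    the good term - [mode_sqr] it leaves the products of u and w with the damping force, controlled
    only when d^2 = O(mu), and 2 |v + z|^2, which the dissipation absorbs for small eps. *)
Lemma lyapunov_mode_op eps mu d Z : let: (u, v, w, z) := Z in
  2 * lyapunov eps mu d (mode_op mu d Z) Z =
  - 2 * gamma * d * ip (v + z) (v + z) + eps * d *
   (2 * ip (v + z) (v + z) - mode_sqr mu Z - gamma * d *
     ((4 * a / (a - b) + 1) * ip u (v + z) + (1 - 4 * b / (a - b)) * ip w (v + z))).
Proof.
have ab := ab_neq0.
case: Z => [[[u v] w] z]; rewrite /mode_sqr /=.
rewrite !(ipDl, ipDr, ipNl, ipNr, ipZl, ipZr).
rewrite (ipC _ z v) (ipC _ v u) (ipC _ w v) (ipC _ z w).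
by field.
Qed.

Lemma lyapunov_cst (k2 : R) : 0 < k2 -> exists eps : R, 0 < eps /\
  forall mu d Z, 0 < mu -> 0 < d -> d ^+ 2 <= k2 * mu ->
  [/\ mode_sqr mu Z / 2 <= lyapunov eps mu d Z Z,
      lyapunov eps mu d Z Z <= 2 * mode_sqr mu Z
    & lyapunov eps mu d (mode_op mu d Z) Z <= - (eps * d / 4 * mode_sqr mu Z)].
Proof.
move=> k20.
pose c1 := 4 * a / (a - b) + 1; pose c2 := 1 - 4 * b / (a - b).
(* Parameter of the Young inequalities for the products of u and w with v + z: it makes d^2 t
   gamma^2 c1^2 <= a mu / 2 and d^2 t gamma^2 c2^2 <= b mu / 2, so these products cost at most a
   quarter of the energy. *)
pose t := Num.min a b / (2 * (gamma ^+ 2 * (c1 ^+ 2 + c2 ^+ 2) * k2 + 1)).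
have den0 : 0 < 2 * (gamma ^+ 2 * (c1 ^+ 2 + c2 ^+ 2) * k2 + 1).
  by rewrite mulr_gt0 // ltr_wpDl // mulr_ge0 ?(ltW k20) // mulr_ge0 ?addr_ge0 ?sqr_ge0.
have min0 : 0 < Num.min a b by rewrite lt_min a_gt0.
have t0 : 0 < t by rewrite divr_gt0.
have tE : t * (2 * (gamma ^+ 2 * (c1 ^+ 2 + c2 ^+ 2) * k2 + 1)) = Num.min a b.
  by rewrite /t divfK // gt_eqF.
have tc1 : 2 * (t * gamma ^+ 2 * c1 ^+ 2 * k2) <= a.
  apply: (@le_trans _ _ (Num.min a b)); last by rewrite ge_min lexx.
  rewrite -tE; have := mulr_ge0 (ltW t0) (mulr_ge0 (mulr_ge0 (sqr_ge0 gamma) (sqr_ge0 c2)) (ltW k20)).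
  lra.
have tc2 : 2 * (t * gamma ^+ 2 * c2 ^+ 2 * k2) <= b.
  apply: (@le_trans _ _ (Num.min a b)); last by rewrite ge_min lexx orbT.
  rewrite -tE; have := mulr_ge0 (ltW t0) (mulr_ge0 (mulr_ge0 (sqr_ge0 gamma) (sqr_ge0 c1)) (ltW k20)).
  lra.
pose C1 := `|4 / (a - b) * a|; pose C2 := `|4 / (a - b) * b|.
pose K := (C1 + C2 + 2) * (k2 / a + k2 / b + 1).
have C10 : 0 <= C1 := normr_ge0 _.
have C20 : 0 <= C2 := normr_ge0 _.
have ka : 0 < k2 / a by rewrite divr_gt0.
have kb : 0 < k2 / b by rewrite divr_gt0.
have K0 : 0 < K by apply: mulr_gt0; lra.
(* The first bound keeps the cross terms below half the energy; the second lets the dissipation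
   gamma d |v + z|^2 pay for the term in (2 + 1 / t) |v + z|^2. *)
pose eps := Num.min K^-1 (2 * gamma / (2 + t^-1)).
have t10 : 0 < 2 + t^-1 by rewrite addr_gt0 // invr_gt0.
have eps0 : 0 < eps by rewrite lt_min invr_gt0 K0 divr_gt0 // mulr_gt0.
have epsK : eps * K <= 1 by rewrite -ler_pdivlMr // div1r ge_min lexx.
have epst : eps * (2 + t^-1) <= 2 * gamma by rewrite -ler_pdivlMr // ge_min lexx orbT.
exists eps; split => // mu d [[[u v] w] z] mu0 d0 dk.
set e := mode_sqr mu _.
have uu := ipxx_ge0 dot_norm u; have vv := ipxx_ge0 dot_norm v.
have ww := ipxx_ge0 dot_norm w; have zz := ipxx_ge0 dot_norm z.
have eE : e = a * mu * ip u u + ip v v + b * mu * ip w w + ip z z by [].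
have amu := mulr_ge0 (mulr_ge0 (ltW a_gt0) (ltW mu0)) uu.
have bmu := mulr_ge0 (mulr_ge0 (ltW b_gt0) (ltW mu0)) ww.
have du x : 0 <= ip x x -> d ^+ 2 * ip x x <= k2 * mu * ip x x by move=> ?; apply: ler_wpM2r.
have e0 : 0 <= e by rewrite eE; lra.
pose kap := k2 / a + k2 / b + 1.
have uk : k2 * mu * ip u u <= k2 / a * e.
  have -> : k2 * mu * ip u u = k2 / a * (a * mu * ip u u) by field; rewrite gt_eqF.
  by apply: ler_wpM2l; [exact: ltW | rewrite eE; lra].
have wk : k2 * mu * ip w w <= k2 / b * e.
  have -> : k2 * mu * ip w w = k2 / b * (b * mu * ip w w) by field; rewrite gt_eqF.
  by apply: ler_wpM2l; [exact: ltW | rewrite eE; lra].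
have ke : k2 / a * e + k2 / b * e + e = kap * e by rewrite /kap; ring.
have ae := mulr_ge0 (ltW ka) e0; have be := mulr_ge0 (ltW kb) e0.
have Y (x y : H) (c : R) : d ^+ 2 * ip x x + ip y y <= kap * e ->
    `|c * (d * (2 * ip x y))| <= `|c| * (kap * e).
  move=> h; have := young_norm (d%:C *: x) y c ltr01.
  rewrite !(ipZl, ipZr) => h2.
  have -> : c * (d * (2 * ip x y)) = 2 * (c * (d * ip x y)) by ring.
  apply: le_trans h2 _; apply: ler_wpM2l => //; apply: le_trans h.
  by rewrite divr1; lra.
have [uz uv wv wz] : [/\ d ^+ 2 * ip u u + ip z z <= kap * e,
    d ^+ 2 * ip u u + ip v v <= kap * e, d ^+ 2 * ip w w + ip v v <= kap * e
    & d ^+ 2 * ip w w + ip z z <= kap * e].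
  have := le_trans (du _ uu) uk; have := le_trans (du _ ww) wk.
  by move: ke ae be eE amu bmu vv zz; clear; split; lra.
pose T := 4 / (a - b) * a * (d * (2 * ip u z)) - 4 / (a - b) * b * (d * (2 * ip w v))
  + 1 * (d * (2 * ip u v)) + 1 * (d * (2 * ip w z)).
have lE : lyapunov eps mu d (u, v, w, z) (u, v, w, z) = e + eps / 2 * T.
  by rewrite eE /T /= (ipC _ v w); ring.
have TK : `|T| <= K * e.
  have := Y _ _ (4 / (a - b) * a) uz; have := Y _ _ (4 / (a - b) * b) wv.
  have := Y _ _ 1 uv; have := Y _ _ 1 wz.
  have -> : K * e = C1 * (kap * e) + C2 * (kap * e) + 1 * (kap * e) + 1 * (kap * e).
    by rewrite /K /kap; ring.
  rewrite -/C1 -/C2 normr1 /T !ler_norml; clear.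
  by move=> /andP[? ?] /andP[? ?] /andP[? ?] /andP[? ?]; apply/andP; split; lra.
have TKe : eps * `|T| <= e.
  apply: (@le_trans _ _ (eps * (K * e))); first by apply: ler_wpM2l => //; exact: ltW.
  by rewrite mulrA -[leRHS]mul1r; apply: ler_wpM2r.
have T1 : eps * T <= e.
  by apply: le_trans TKe; apply: ler_wpM2l; [exact: ltW | exact: ler_norm].
have T2 : - e <= eps * T.
  rewrite lerNl -mulrN; apply: le_trans TKe.
  by apply: ler_wpM2l; [exact: ltW | rewrite -normrN; exact: ler_norm].
have [l1 l2] : e / 2 <= e + eps / 2 * T /\ e + eps / 2 * T <= 2 * e.
  by move: T1 T2 e0; clear; split; lra.
split; rewrite ?lE //.
have := lyapunov_mode_op eps mu d (u, v, w, z); rewrite -/c1 -/c2 -/e.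
set S := v + z => L.
have SS := ipxx_ge0 dot_norm S.
have y1 : - (2 * (gamma * d * (c1 * ip u S))) <= a * mu * ip u u / 2 + ip S S / t.
  have := youngN ((gamma * d * c1)%:C *: u) S t0; rewrite !(ipZl, ipZr).
  have := ler_wpM2l (mulr_ge0 (ltW t0) (mulr_ge0 (sqr_ge0 gamma) (sqr_ge0 c1))) (du _ uu).
  have := ler_wpM2r (mulr_ge0 (ltW mu0) uu) tc1.
  by clear; lra.
have y2 : - (2 * (gamma * d * (c2 * ip w S))) <= b * mu * ip w w / 2 + ip S S / t.
  have := youngN ((gamma * d * c2)%:C *: w) S t0; rewrite !(ipZl, ipZr).
  have := ler_wpM2l (mulr_ge0 (ltW t0) (mulr_ge0 (sqr_ge0 gamma) (sqr_ge0 c2))) (du _ ww).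
  have := ler_wpM2r (mulr_ge0 (ltW mu0) ww) tc2.
  by clear; lra.
have ed := mulr_gt0 eps0 d0.
have h1 : eps * d * (2 * ip S S - e - gamma * d * (c1 * ip u S + c2 * ip w S)) <=
          eps * d * ((2 + t^-1) * ip S S - 3 / 4 * e).
  apply: ler_wpM2l; first exact: ltW.
  by move: y1 y2 vv zz; rewrite eE; clear; lra.
have h2 : eps * (2 + t^-1) * (d * ip S S) <= 2 * gamma * (d * ip S S).
  by apply: ler_wpM2r => //; rewrite mulr_ge0 // ltW.
have h3 : 0 <= eps * d * e by rewrite mulr_ge0 // ltW.
by move: L h1 h2 h3; rewrite /=; clear; lra.
Qed.

Lemma mode_op_sqr_le (k2 : R) : 0 < k2 -> exists C : R, 0 < C /\
  forall mu d Z, 0 < mu -> 0 < d -> d ^+ 2 <= k2 * mu ->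
  mode_sqr mu (mode_op mu d Z) <= C * mu * mode_sqr mu Z.
Proof.
move=> k20; exists (2 * a + 2 * b + 8 * gamma ^+ 2 * k2); split.
  by rewrite addr_gt0 ?mulr_gt0 ?exprn_gt0 // addr_gt0 // mulr_gt0.
move=> mu d [[[u v] w] z] mu0 d0 dk; rewrite /mode_sqr /=.
have sq2 (x y : H) : ip (x + y) (x + y) <= 2 * ip x x + 2 * ip y y.
  have := ipxx_ge0 dot_norm (x - y).
  by rewrite !(ipDl, ipDr, ipNl, ipNr) (ipC _ y x); lra.
have uu := ipxx_ge0 dot_norm u; have vv := ipxx_ge0 dot_norm v.
have ww := ipxx_ge0 dot_norm w; have zz := ipxx_ge0 dot_norm z.
have h1 := sq2 ((a * mu)%:C *: u) ((gamma * d)%:C *: (v + z)).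
have h2 := sq2 ((b * mu)%:C *: w) ((gamma * d)%:C *: (v + z)).
have h3 := sq2 v z.
rewrite !ipNl !ipNr !opprK.
move: h1 h2; rewrite [X in _ <= 2 * X + _]ipZl ipZr [X in _ <= _ + 2 * X]ipZl ipZr.
rewrite [X in _ -> _ <= 2 * X + _ -> _]ipZl ipZr [X in _ -> _ <= _ + 2 * X -> _]ipZl ipZr.
set S := ip (v + z) (v + z) in h3 *.
have S0 : 0 <= S := ipxx_ge0 dot_norm _.
set X1 := ip (_ + _) _; set X2 := ip (_ + _) _ => h1 h2.
have dS : d ^+ 2 * S <= k2 * mu * S by exact: ler_wpM2r.
have gS : gamma ^+ 2 * (d ^+ 2 * S) <= gamma ^+ 2 * (k2 * mu * (2 * ip v v + 2 * ip z z)).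
  apply: ler_wpM2l; first exact: sqr_ge0.
  by apply: le_trans dS _; apply: ler_wpM2l => //; rewrite mulr_ge0 ?ltW.
have am : 0 < a * mu by exact: mulr_gt0.
have bm : 0 < b * mu by exact: mulr_gt0.
have gk : 0 < gamma ^+ 2 * k2 * mu by rewrite !mulr_gt0 // exprn_gt0.
have n1 := mulr_ge0 (ltW am) vv; have n2 := mulr_ge0 (ltW am) zz.
have n3 := mulr_ge0 (ltW bm) vv; have n4 := mulr_ge0 (ltW bm) zz.
have n5 := mulr_ge0 (ltW gk) (mulr_ge0 (ltW am) uu).
have n6 := mulr_ge0 (ltW gk) (mulr_ge0 (ltW bm) ww).
have n7 := mulr_ge0 (ltW am) (mulr_ge0 (ltW bm) uu).
have n8 := mulr_ge0 (ltW am) (mulr_ge0 (ltW bm) ww).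
lra.
Qed.

(** Pairing the equation with Z in the form removes i lam Z by [lyapunov_i], so the dissipation of Z
    is bounded by the pairing of F with Z. *)
Lemma mode_resolvent_decay (eps mu d lam : R) (Z F : HH) : 0 < mu -> 0 < d -> 0 < eps ->
  (forall Z, [/\ mode_sqr mu Z / 2 <= lyapunov eps mu d Z Z,
      lyapunov eps mu d Z Z <= 2 * mode_sqr mu Z
    & lyapunov eps mu d (mode_op mu d Z) Z <= - (eps * d / 4 * mode_sqr mu Z)]) ->
  ('i * lam%:C) *: Z - mode_op mu d Z = F ->
  mode_sqr mu Z <= (8 / (eps * d)) ^+ 2 * mode_sqr mu F.
Proof.
move=> mu0 d0 eps0 hl eqF.
have iE : ('i%R * lam%:C) *: Z = lam%:C *: ('i%C *: Z) by rewrite scalerA mulrC -complexiE.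
have [_ _ hM] := hl Z.
have hF : lyapunov eps mu d F Z = - lyapunov eps mu d (mode_op mu d Z) Z.
  rewrite -eqF iE -[- mode_op mu d Z]scaleN1r.
  rewrite (_ : (-1 : R[i]) = (-1 : R)%:C); last by rewrite rmorphN rmorph1.
  by rewrite lyapunovDl !lyapunovZl lyapunov_i; ring.
set s := 8 / (eps * d).
have ed : 0 < eps * d by exact: mulr_gt0.
have s0 : 0 < s by rewrite divr_gt0.
have sE : s * (eps * d) = 8 by rewrite divfK // gt_eqF.
(* Nonnegativity of the form at s F - Z plays the part of Cauchy-Schwarz; with s = 8 / (eps d) the
   term in Z on the right is absorbed. *)
have [h1 _ _] := hl (s%:C *: F + (-1)%:C *: Z).
have [_ h2 _] := hl F; have [_ h3 _] := hl Z.
have h4 := mode_sqr_ge0 (s%:C *: F + (-1)%:C *: Z) mu0.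
move: h1; rewrite !(lyapunovDl, lyapunovZl, lyapunovC _ _ _ _ (_ + _), lyapunovC _ _ _ _ (_ *: _)).
rewrite (lyapunovC _ _ _ Z F) => h1.
have h5 : 2 * mode_sqr mu Z <= s * lyapunov eps mu d F Z.
  rewrite hF; have -> : 2 * mode_sqr mu Z = s * (eps * d / 4 * mode_sqr mu Z).
    rewrite (_ : s * _ = s * (eps * d) / 4 * mode_sqr mu Z); last by field.
    by rewrite sE; field.
  by apply: ler_wpM2l; [exact: ltW | lra].
have h6 : s ^+ 2 * lyapunov eps mu d F F <= s ^+ 2 * (2 * mode_sqr mu F).
  by apply: ler_wpM2l => //; exact: sqr_ge0.
lra.
Qed.

(** From i lam Z = F + M Z one gets lam^2 |Z|^2 <= 2 |F|^2 + 2 C mu |Z|^2, and the last term is at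
    most half of the left side. *)
Lemma mode_resolvent_far (mu d lam C : R) (Z F : HH) : 0 < mu ->
  mode_sqr mu (mode_op mu d Z) <= C * mu * mode_sqr mu Z ->
  4 * C * mu <= lam ^+ 2 ->
  ('i * lam%:C) *: Z - mode_op mu d Z = F ->
  lam ^+ 2 * mode_sqr mu Z <= 4 * mode_sqr mu F.
Proof.
move=> mu0 hC hlam /eqP; rewrite subr_eq => /eqP eqF.
have h := mode_sqrD F (mode_op mu d Z) mu0.
have : mode_sqr mu (('i * lam%:C) *: Z) = lam ^+ 2 * mode_sqr mu Z.
  rewrite mode_sqrZ; congr (_ * _).
  rewrite normrM normCi mul1r normc_def /= expr0n addr0 sqrtr_sqr.
  by rewrite real_normK ?num_real.
rewrite eqF => e1; rewrite e1 in h.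
have := ler_wpM2r (mode_sqr_ge0 Z mu0) hlam.
lra.
Qed.

(** Substituting v = c u - f and z = c w - h leaves a symmetric 2 by 2 system for u and w, with
    diagonal [A1], [B1] and off-diagonal [r], solved by Cramer's formulas. These also show that the
    solution stays in the range of P n. *)
Lemma mode_resolvent_exists (P : nat -> H -> H) (n : nat) (mu d lam : R) (F : HH) :
  orthogonal_decomposition dot P -> 0 < mu -> 0 < d ->
  let: (f, g, h, k) := F in
  P n f = f -> P n g = g -> P n h = h -> P n k = k ->
  exists Z, ('i * lam%:C) *: Z - mode_op mu d Z = F /\
  let: (u, v, w, z) := Z in [/\ P n u = u, P n v = v, P n w = w & P n z = z].
Proof.
case: F => [[[f g] h] k] decP mu0 d0 Pf Pg Ph Pk.
set c := 'i * lam%:C.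
pose r := (gamma * d)%:C * c.
pose A1 := c ^+ 2 + (a * mu)%:C + r; pose B1 := c ^+ 2 + (b * mu)%:C + r.
(* The determinant is p q + i G (p + q). For lam = 0 it equals a b mu^2; otherwise its vanishing
   forces p = q = 0, hence a mu = b mu. *)
have D0 : A1 * B1 - r ^+ 2 != 0.
  have cE : c = lam%:C * 'i%C by rewrite /c complexiE mulrC.
  have c2 : c ^+ 2 = (- lam ^+ 2)%:C.
    by rewrite cE exprMn sqr_i mulrN1 rmorphN rmorphXn.
  pose p := a * mu - lam ^+ 2; pose q := b * mu - lam ^+ 2; pose G := gamma * d * lam.
  have -> : A1 * B1 - r ^+ 2 = (p * q)%:C + 'i%C * (G * (p + q))%:C.
    have -> : A1 = p%:C + G%:C * 'i%C.
      by rewrite /A1 /r c2 /p /G cE !rmorphM !rmorphB !rmorphN !rmorphM /=; ring.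
    have -> : B1 = q%:C + G%:C * 'i%C.
      by rewrite /B1 /r c2 /q /G cE !rmorphM !rmorphB !rmorphN !rmorphM /=; ring.
    have -> : r = G%:C * 'i%C by rewrite /r /G cE !rmorphM /=; ring.
    rewrite (rmorphM _ p q) (rmorphM _ G) (rmorphD _ p q) /=.
    move: p%:C q%:C G%:C 'i%C => p' q' G' i'; ring.
  apply/eqP => /(congr1 (fun t => (complex.Re t, complex.Im t))) /=.
  rewrite !mul0r !mul1r !subr0 !add0r addr0 => -[/eqP pq /eqP].
  rewrite mulf_eq0 => /orP[|].
    rewrite !mulf_eq0 (gt_eqF gamma_gt0) (gt_eqF d0) /= => /eqP l0.
    move: pq; rewrite /p /q l0 expr0n !subr0 !mulf_eq0.
    by rewrite (gt_eqF a_gt0) (gt_eqF b_gt0) (gt_eqF mu0).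
  move: pq; rewrite mulf_eq0 => /orP[] /eqP p0; rewrite p0 ?add0r ?addr0 => /eqP q0.
    have : (a - b) * mu = 0 by move: p0 q0; rewrite /p /q; lra.
    by move/eqP; rewrite mulf_eq0 (negPf ab_neq0) (gt_eqF mu0).
  have : (a - b) * mu = 0 by move: p0 q0; rewrite /p /q; lra.
  by move/eqP; rewrite mulf_eq0 (negPf ab_neq0) (gt_eqF mu0).
set D := A1 * B1 - r ^+ 2 in D0.
pose G := g + c *: f + (gamma * d)%:C *: (f + h).
pose K := k + c *: h + (gamma * d)%:C *: (f + h).
pose u := D^-1 *: (B1 *: G - r *: K); pose w := D^-1 *: (A1 *: K - r *: G).
have solve (M N t : R[i]) (X Y : H) : M * N - t ^+ 2 != 0 ->
    M *: ((M * N - t ^+ 2)^-1 *: (N *: X - t *: Y)) +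
    t *: ((M * N - t ^+ 2)^-1 *: (M *: Y - t *: X)) = X.
  move=> nz; apply: (dot_inj dot_norm) => e.
  by rewrite !(dotDl, dotNl, dotZl); field.
have e1 : A1 *: u + r *: w = G by exact: solve.
have e2 : B1 *: w + r *: u = K.
  by rewrite /u /w /D (mulrC A1); apply: solve; rewrite mulrC.
have eq_mode (x1 x2 y1 y2 s1 : H) (mu' : R) :
    (c ^+ 2 + mu'%:C + r) *: x1 + r *: x2 = s1 + c *: y1 + (gamma * d)%:C *: (y1 + y2) ->
    c *: (c *: x1 - y1) - - (mu'%:C *: x1 + (gamma * d)%:C *: ((c *: x1 - y1) + (c *: x2 - y2))) = s1.
  move=> E; apply: (dot_inj dot_norm) => e.
  have := congr1 (dot^~ e) E; rewrite /r !(dotDl, dotNl, dotZl) => E1.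
  rewrite -[RHS]addr0 -(subrr (dot s1 e + c * dot y1 e + (gamma * d)%:C * (dot y1 e + dot y2 e))).
  by rewrite -{1}E1; ring.
exists (u, c *: u - f, w, c *: w - h); split.
  rewrite /mode_op -[LHS]/(c *: u - (c *: u - f),
    c *: (c *: u - f) - - ((a * mu)%:C *: u + (gamma * d)%:C *: ((c *: u - f) + (c *: w - h))),
    c *: w - (c *: w - h),
    c *: (c *: w - h) - - ((b * mu)%:C *: w + (gamma * d)%:C *: ((c *: u - f) + (c *: w - h)))).
  rewrite !subKr; congr (_, _, _, _); first exact: eq_mode.
  rewrite [_ *: u - f + _]addrC; apply: eq_mode.
  by rewrite (addrC h f).
by rewrite /u /w /G /K !(decD decP, decN decP, decZ decP) Pf Pg Ph Pk.
Qed.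

End Mode.

(** * Energy space *)

Section EnergySpace.
Context (R : realType) (H : completeNormedModType R[i]).
Variable dot : {dot H for Num.conj}.
Hypothesis dot_norm : forall x : H, `|x| ^+ 2 = dot x x.
Variable A : operator H.
Variables (P : nat -> H -> H) (m : nat -> R) (m0 : R).
Hypothesis decP : orthogonal_decomposition dot P.
Hypothesis m0_gt0 : 0 < m0.
Hypothesis m_ge : forall n, m0 <= m n.
Hypothesis fpowP : forall s x,
  (dom (fpow dot A s) x <-> (wsum P (fun n => (m n `^ s) ^+ 2)%R x < +oo)%E) /\
  (dom (fpow dot A s) x -> forall n, P n (fpow dot A s x) = (m n `^ s)%:C *: P n x).
Variables (a b gamma theta : R).
Hypotheses (a_gt0 : 0 < a) (b_gt0 : 0 < b).
Hypothesis theta_le : theta <= 2^-1.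
Local Notation HH := (H * H * H * H)%type.
Local Notation V := (carrier (spaceV dot A)).
Local Notation X := (energy_space dot A a b).
Local Notation G := (coupled_operator dot A a b gamma theta).

Lemma m_gt0 n : 0 < m n. Proof. exact: lt_le_trans (m_ge n). Qed.

Lemma half_powR_sqr n : (m n `^ 2^-1) ^+ 2 = m n.
Proof. by rewrite powR12_sqrt ?(ltW (m_gt0 n)) // sqr_sqrtr // ltW // m_gt0. Qed.

Lemma spaceVP u : V u <-> (wsum P m u < +oo)%E.
Proof.
have -> : wsum P m u = wsum P (fun n => (m n `^ 2^-1) ^+ 2)%R u.
  by apply: eq_eseriesr => n _; rewrite half_powR_sqr.
exact: (fpowP _ _).1.
Qed.

Lemma spaceV_sqr u : V u -> ((rnorm (fpow dot A 2^-1 u) ^+ 2)%:E = wsum P m u)%E.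
Proof.
move=> Vu; rewrite -(parseval dot_norm decP); apply: eq_eseriesr => n _.
rewrite ((fpowP _ _).2 Vu) rnormZ exprMn real_normK ?num_real //.
by rewrite half_powR_sqr.
Qed.

Lemma spaceV_proj n x : V (P n x).
Proof.
apply/spaceVP; rewrite (wsum_fin_proj decP) ?ltry // => k.
by rewrite ltW // m_gt0.
Qed.

Definition PZ n (Z : HH) : HH := let: (u, v, w, z) := Z in (P n u, P n v, P n w, P n z).

Definition mode_energy n Z := mode_sqr dot a b (m n) (PZ n Z).

Lemma energyE n u v w z : mode_energy n (u, v, w, z) =
  a * (m n * rnorm (P n u) ^+ 2) + rnorm (P n v) ^+ 2 +
  (b * (m n * rnorm (P n w) ^+ 2) + rnorm (P n z) ^+ 2).
Proof. by rewrite /mode_energy /mode_sqr /= !(rnorm_sqr dot_norm); ring. Qed.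

Lemma energy_ge0 n Z : 0 <= mode_energy n Z.
Proof. by apply: mode_sqr_ge0 => //; exact: m_gt0. Qed.

Let m_ge0 n : 0 <= m n. Proof. by rewrite ltW // m_gt0. Qed.

Lemma energy_sum u v w z : (\sum_(n <oo) (mode_energy n (u, v, w, z))%:E =
  a%:E * wsum P m u + (rnorm v ^+ 2)%:E + (b%:E * wsum P m w + (rnorm z ^+ 2)%:E))%E.
Proof.
rewrite -!(parseval dot_norm decP) /wsum.
have h (c x y : R) : 0 < c -> 0 <= x -> 0 <= c * (x * y ^+ 2).
  by move=> c0 x0; rewrite mulr_ge0 ?(ltW c0) // mulr_ge0 ?sqr_ge0.
rewrite -!nneseriesZl; try by move=> n _; rewrite lee_fin mulr_ge0 ?sqr_ge0.
rewrite -!nneseriesD; try by move=> n _ _; rewrite -?EFinM ?adde_ge0 ?lee_fin ?h ?sqr_ge0.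
by apply: eq_eseriesr => n _; rewrite energyE -!EFinM -!EFinD.
Qed.

Lemma energy_carrier Z : carrier X Z <-> (\sum_(n <oo) (mode_energy n Z)%:E < +oo)%E.
Proof.
case: Z => [[[u v] w] z]; rewrite energy_sum.
have wu := @wsum_ge0 _ _ P m u m_ge0; have ww := @wsum_ge0 _ _ P m w m_ge0.
split.
  move=> /= [/spaceVP hu /spaceVP hw].
  have /fineK <- : wsum P m u \is a fin_num by rewrite ge0_fin_numE.
  have /fineK <- : wsum P m w \is a fin_num by rewrite ge0_fin_numE.
  by rewrite -!EFinM -!EFinD ltry.
have fin (c : R) (t : \bar R) : 0 < c -> (c%:E * t < +oo)%E -> (t < +oo)%E.
  by case: t => [r| |] // c0; rewrite ?ltry // gt0_muley ?lte_fin // ltxx.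
have v0 := sqr_ge0 (rnorm v); have z0 := sqr_ge0 (rnorm z).
have au : (0 <= a%:E * wsum P m u)%E by rewrite mule_ge0 // lee_fin ltW.
have bw : (0 <= b%:E * wsum P m w)%E by rewrite mule_ge0 // lee_fin ltW.
move=> h; split; apply/spaceVP.
  apply: (fin _ _ a_gt0); apply: le_lt_trans h; apply: le_trans (leeDl _ _).
    by rewrite leeDl // lee_fin.
  by rewrite adde_ge0 // lee_fin.
apply: (fin _ _ b_gt0); apply: le_lt_trans h; apply: le_trans (leeDr _ _).
  by rewrite leeDl // lee_fin.
by rewrite adde_ge0 // lee_fin.
Qed.

Lemma energy_nrm_ge0 Z : 0 <= nrm X Z.
Proof. by case: Z => [[[u v] w] z]; exact: sqrtr_ge0. Qed.

Lemma energy_parseval Z : carrier X Z ->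
  ((nrm X Z ^+ 2)%:E = \sum_(n <oo) (mode_energy n Z)%:E)%E.
Proof.
case: Z => [[[u v] w] z] [Vu Vw]; rewrite energy_sum -!spaceV_sqr //= sqr_sqrtr.
  by rewrite -!EFinM -!EFinD addrA.
have pos (c x : R) : 0 < c -> 0 <= c * x ^+ 2 by move=> c0; rewrite mulr_ge0 ?sqr_ge0 ?(ltW c0).
by apply: addr_ge0; [apply: addr_ge0; [apply: addr_ge0|]|]; rewrite ?sqr_ge0 ?pos.
Qed.

Lemma PZ_eq Z Z' : (forall n, PZ n Z = PZ n Z') -> Z = Z'.
Proof.
case: Z => [[[u v] w] z]; case: Z' => [[[u' v'] w'] z'] h.
by congr (_, _, _, _); apply: (dec_eq dot_norm decP) => n; have [] := h n.
Qed.

Lemma PZ_linear n (c : R[i]) Z Z' : PZ n (c *: Z + Z') = c *: PZ n Z + PZ n Z'.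
Proof.
case: Z => [[[u v] w] z]; case: Z' => [[[u' v'] w'] z'].
by congr (_, _, _, _); exact: (dec_linear decP).
Qed.

Lemma PZ_PZ k n Z : PZ k (PZ n Z) = if k == n then PZ n Z else 0.
Proof.
by case: Z => [[[u v] w] z] /=; rewrite !(decPP decP); case: ifP.
Qed.

(** Since m n >= m0, a summable energy also controls the displacements in H, so [riesz_fischer]
    applies to each of the four sequences separately. *)
Lemma PZ_riesz_fischer (h : nat -> HH) : (forall n, PZ n (h n) = h n) ->
  (\sum_(n <oo) (mode_sqr dot a b (m n) (h n))%:E < +oo)%E ->
  exists2 Z, carrier X Z & forall n, PZ n Z = h n.
Proof.
move=> Ph hoo.
have RF (g : nat -> H) (c : R) : 0 <= c -> (forall n, P n (g n) = g n) ->
    (forall n, rnorm (g n) ^+ 2 <= c * mode_sqr dot a b (m n) (h n)) ->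
    exists x, forall n, P n x = g n.
  move=> c0 Pg gh; apply: (riesz_fischer dot_norm decP) => //.
  have h0 n : 0 <= mode_sqr dot a b (m n) (h n) by apply: mode_sqr_ge0 => //; exact: m_gt0.
  apply: (@le_lt_trans _ _ (c%:E * (\sum_(n <oo) (mode_sqr dot a b (m n) (h n))%:E))%E).
    rewrite -nneseriesZl; last by move=> n _; rewrite lee_fin.
    apply: lee_nneseries => n; first by rewrite lee_fin sqr_ge0.
    by rewrite -EFinM lee_fin.
  have /fineK <- : (\sum_(n <oo) (mode_sqr dot a b (m n) (h n))%:E)%E \is a fin_num.
    by rewrite ge0_fin_numE // nneseries_ge0 // => n _ _; rewrite lee_fin.
  by rewrite -EFinM ltry.
have sqE n : mode_sqr dot a b (m n) (h n) =
    a * m n * rnorm (h n).1.1.1 ^+ 2 + rnorm (h n).1.1.2 ^+ 2 +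
    b * m n * rnorm (h n).1.2 ^+ 2 + rnorm (h n).2 ^+ 2.
  by case: (h n) => [[[? ?] ?] ?]; rewrite !(rnorm_sqr dot_norm).
have am0 n : a * m0 <= a * m n by rewrite ler_pM2l.
have bm0 n : b * m0 <= b * m n by rewrite ler_pM2l.
have am : 0 < a * m0 by exact: mulr_gt0.
have bm : 0 < b * m0 by exact: mulr_gt0.
have q1 n := ler_wpM2r (sqr_ge0 (rnorm (h n).1.1.1)) (am0 n).
have q2 n := ler_wpM2r (sqr_ge0 (rnorm (h n).1.2)) (bm0 n).
have q3 n := sqr_ge0 (rnorm (h n).1.1.2).
have q4 n := sqr_ge0 (rnorm (h n).2).
have q5 n := mulr_ge0 (ltW am) (sqr_ge0 (rnorm (h n).1.1.1)).
have q6 n := mulr_ge0 (ltW bm) (sqr_ge0 (rnorm (h n).1.2)).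
have [u uP] : exists x, forall n, P n x = (h n).1.1.1.
  apply: (RF (fun n => (h n).1.1.1) (a * m0)^-1); first by rewrite invr_ge0 ltW.
    by move=> n; have := Ph n; case: (h n) => [[[? ?] ?] ?] [].
  move=> n; rewrite ler_pdivlMl // sqE.
  have := q1 n; have := q2 n; have := q3 n; have := q4 n; have := q5 n; have := q6 n; lra.
have [v vP] : exists x, forall n, P n x = (h n).1.1.2.
  apply: (RF (fun n => (h n).1.1.2) 1) => //.
    by move=> n; have := Ph n; case: (h n) => [[[? ?] ?] ?] [].
  move=> n; rewrite mul1r sqE.
  have := q1 n; have := q2 n; have := q3 n; have := q4 n; have := q5 n; have := q6 n; lra.
have [w wP] : exists x, forall n, P n x = (h n).1.2.
  apply: (RF (fun n => (h n).1.2) (b * m0)^-1); first by rewrite invr_ge0 ltW.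
    by move=> n; have := Ph n; case: (h n) => [[[? ?] ?] ?] [].
  move=> n; rewrite ler_pdivlMl // sqE.
  have := q1 n; have := q2 n; have := q3 n; have := q4 n; have := q5 n; have := q6 n; lra.
have [z zP] : exists x, forall n, P n x = (h n).2.
  apply: (RF (fun n => (h n).2) 1) => //.
    by move=> n; have := Ph n; case: (h n) => [[[? ?] ?] ?] [].
  move=> n; rewrite mul1r sqE.
  have := q1 n; have := q2 n; have := q3 n; have := q4 n; have := q5 n; have := q6 n; lra.
have hP n : PZ n (u, v, w, z) = h n.
  by rewrite /= uP vP wP zP; case: (h n) => [[[? ?] ?] ?].
exists (u, v, w, z) => //; apply/energy_carrier; apply: le_lt_trans hoo.
apply: lee_nneseries => n; first by rewrite lee_fin energy_ge0.
by rewrite lee_fin /mode_energy hP.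
Qed.

Lemma powR_m_sqr s n : (m n `^ (s / 2)) ^+ 2 = m n `^ s.
Proof. by rewrite -powR_mulrn ?powR_ge0 // -powRrM divfK. Qed.

Lemma powR_m_le (s t : R) n : s <= t -> m n `^ s <= m0 `^ (s - t) * m n `^ t.
Proof.
move=> st; have mn0 : m n != 0 by rewrite gt_eqF // m_gt0.
have -> : s = (s - t) + t by rewrite subrK.
rewrite powRD ?mn0 ?implybT // addrK ler_wpM2r ?powR_ge0 //.
have -> : s - t = - (t - s) by rewrite opprB.
rewrite !powRN lef_pV2 ?posrE ?powR_gt0 ?m_gt0 //.
by apply: ge0_ler_powR; rewrite ?nnegrE ?m_ge0 ?(ltW m0_gt0) // subr_ge0.
Qed.

Lemma spaceV_fpow s u : s <= 1 -> V u -> dom (fpow dot A (s / 2)) u.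
Proof.
move=> s1 /spaceVP Vu; apply/(fpowP _ _).1.
apply: (@wsum_lty _ _ P _ m u (m0 `^ (s - 1))) Vu.
- by move=> n; exact: sqr_ge0.
- exact: m_ge0.
- exact: powR_ge0.
- move=> n; apply: ler_wpM2r; first exact: sqr_ge0.
  by rewrite powR_m_sqr -[X in _ <= _ * X](powRr1 (m_ge0 n)); exact: powR_m_le.
Qed.

Lemma dot_realZ (r : R) (x y : H) : dot (r%:C *: x) (r%:C *: y) = (r ^+ 2)%:C * dot x y.
Proof.
rewrite dotZl [dot _ (_ *: _)]dotC dotZl rmorphM /= -dotC mulrA expr2 rmorphM /=.
by congr (_ * _ * _); apply: conj_Creal; apply/complex_realP; exists r.
Qed.

(** Testing the weak equation on p = P n e isolates its n-th component; conversely the components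
    are summed by [dec_dot_comb]. *)
Lemma diagonal_form_comb (T1 T2 : H -> H) (w1 w2 : nat -> R) (r1 r2 : R) u y g :
  (forall x, V x -> forall n, P n (T1 x) = (w1 n)%:C *: P n x) ->
  (forall x, V x -> forall n, P n (T2 x) = (w2 n)%:C *: P n x) ->
  V u -> V y ->
  (forall p, V p -> r1%:C * dot (T1 u) (T1 p) + r2%:C * dot (T2 y) (T2 p) = dot g p) <->
  forall n, P n g = (r1 * w1 n ^+ 2)%:C *: P n u + (r2 * w2 n ^+ 2)%:C *: P n y.
Proof.
have E (r W : R) (t : R[i]) : r%:C * (W%:C * t) = (r * W)%:C * t.
  by rewrite mulrA -rmorphM.
move=> d1 d2 Vu Vy; split=> [h n|h p Vp].
  apply: (dot_inj dot_norm) => e; have Ve := spaceV_proj n e.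
  have proj (T : H -> H) (w : nat -> R) x :
      (forall x, V x -> forall n, P n (T x) = (w n)%:C *: P n x) -> V x ->
      dot (T x) (T (P n e)) = (w n ^+ 2)%:C * dot (P n x) e.
    move=> dT Vx; rewrite -dot_realZ -dT // (dec_adj decP); congr (dot _ _).
    apply: (dec_eq dot_norm decP) => k; rewrite dT // !(decPP decP) (decZ decP).
    by case: eqP => [->|]; rewrite ?scaler0.
  have := h _ Ve; rewrite (proj _ _ _ d1 Vu) (proj _ _ _ d2 Vy) -(dec_adj decP n g) => <-.
  by rewrite dotDl !dotZl !E.
apply/esym; apply: (dec_dot_comb dot_norm decP) => n.
rewrite (d1 _ Vu) (d1 _ Vp) (d2 _ Vy) (d2 _ Vp) !dot_realZ.
by rewrite h dotDl !dotZl !E.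
Qed.

Let d n := m n `^ theta.

Lemma representsP c u y g : V u -> V y ->
  (represents dot A (stiff_damp dot A gamma theta c u y) g <->
   forall n, P n g = (c * m n)%:C *: P n u + (gamma * d n)%:C *: P n y).
Proof.
move=> Vu Vy.
have t1 : theta <= 1 by apply: le_trans theta_le _; rewrite invf_le1 // ler1n.
have F s x : s <= 1 -> V x -> forall n, P n (fpow dot A (s / 2) x) = (m n `^ (s / 2))%:C *: P n x.
  by move=> s1 Vx; apply: (fpowP _ _).2; exact: spaceV_fpow.
have h := @diagonal_form_comb (fpow dot A (1 / 2)) (fpow dot A (theta / 2)) _ _ c gamma u y g
  (fun x => F 1 x (lexx 1)) (fun x => F theta x t1) Vu Vy.
split=> [/h e n|e].
  by rewrite e !powR_m_sqr powRr1.
by apply/h => n; rewrite e !powR_m_sqr powRr1.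
Qed.

Lemma represents_uniq l g g' :
  represents dot A l g -> represents dot A l g' -> g = g'.
Proof.
move=> h h'; apply: (dec_eq dot_norm decP) => n; apply: (dot_inj dot_norm) => e.
rewrite !(dec_adj decP).
have := h _ (spaceV_proj n e); have := h' _ (spaceV_proj n e).
by rewrite /pivot => -> ->.
Qed.

Lemma toHP l g : represents dot A l g -> toH dot A l = g.
Proof.
move=> lg; apply: (represents_uniq _ lg).
have : [set g | represents dot A l g] g by [].
exact: xgetI.
Qed.

(** Membership of Y in the energy space encodes the domain: its first and third components are v and
    z, which puts them in V, and its other two are vectors of H that represent the sums in V'. *)
Lemma coupledP Z Y : (dom G Z /\ G Z = Y) <->
  [/\ carrier X Z, carrier X Y & forall n, PZ n Y = mode_op a b gamma (m n) (d n) (PZ n Z)].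
Proof.
case: Z => [[[u v] w] z]; split.
  move=> [[[Vu Vv Vw Vz] [g gP] [k kP]] <-] /=.
  rewrite (toHP gP) (toHP kP); split => // n.
  have Vvz : V (v + z).
    by apply/spaceVP; apply: (wsumD decP) => //; apply/spaceVP.
  rewrite !(decN decP) ((representsP _ _ Vu Vvz).1 gP) ((representsP _ _ Vw Vvz).1 kP).
  by rewrite !(decD decP).
case: Y => [[[y1 y2] y3] y4] [[Vu Vw] [Vy1 Vy3] h].
have e1 : y1 = v by apply: (dec_eq dot_norm decP) => n; have [] := h n.
have e3 : y3 = z by apply: (dec_eq dot_norm decP) => n; have [] := h n.
rewrite {}e1 {}e3 in h Vy1 Vy3 *.
have Vvz : V (v + z).
  by apply/spaceVP; apply: (wsumD decP) => //; apply/spaceVP.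
have r1 : represents dot A (stiff_damp dot A gamma theta a u (v + z)) (- y2).
  apply/representsP => // n; have [e _] := h n.
  by rewrite (decN decP) e opprK (decD decP).
have r2 : represents dot A (stiff_damp dot A gamma theta b w (v + z)) (- y4).
  apply/representsP => // n; have [_ e] := h n.
  by rewrite (decN decP) e opprK (decD decP).
split; first by split; [split | exists (- y2) | exists (- y4)].
by rewrite /= (toHP r1) (toHP r2) !opprK.
Qed.

End EnergySpace.

(** * Resolvent on the imaginary axis *)

Lemma scaler_combB (K : comNzRingType) (W : lmodType K) (k c : K) (x x' y y' : W) :
  k *: (c *: x + y) - (c *: x' + y') = c *: (k *: x - x') + (k *: y - y').
Proof. by rewrite scalerDr opprD addrACA scalerBr !scalerA mulrC. Qed.

Section Resolvent.
Context (R : realType) (H : completeNormedModType R[i]).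
Variable dot : {dot H for Num.conj}.
Hypothesis dot_norm : forall x : H, `|x| ^+ 2 = dot x x.
Variable A : operator H.
Variables (P : nat -> H -> H) (m : nat -> R) (m0 : R).
Hypothesis decP : orthogonal_decomposition dot P.
Hypothesis m0_gt0 : 0 < m0.
Hypothesis m_ge : forall n, m0 <= m n.
Hypothesis fpowP : forall s x,
  (dom (fpow dot A s) x <-> (wsum P (fun n => (m n `^ s) ^+ 2)%R x < +oo)%E) /\
  (dom (fpow dot A s) x -> forall n, P n (fpow dot A s x) = (m n `^ s)%:C *: P n x).
Variables (a b gamma theta : R).
Hypotheses (a_gt0 : 0 < a) (b_gt0 : 0 < b) (gamma_gt0 : 0 < gamma) (a_neq_b : a != b).
Hypothesis theta_gt0 : 0 < theta.
Hypothesis theta_le : theta <= 2^-1.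
Local Notation ip := (rip dot).
Local Notation HH := (H * H * H * H)%type.
Local Notation V := (carrier (spaceV dot A)).
Local Notation X := (energy_space dot A a b).
Local Notation G := (coupled_operator dot A a b gamma theta).

Local Notation msqr := (mode_sqr dot a b).
Local Notation M n := (mode_op a b gamma (m n) (m n `^ theta)).
Local Notation energy := (mode_energy dot P m a b).
Local Notation PZ := (PZ P).

Let m_gt0 n : 0 < m n := m_gt0 m0_gt0 m_ge n.
Let energy0 n Z : 0 <= energy n Z := energy_ge0 dot_norm P m0_gt0 m_ge a_gt0 b_gt0 n Z.
Let parsevalX Z (CZ : carrier X Z) := energy_parseval dot_norm decP m0_gt0 m_ge fpowP a_gt0 b_gt0 CZ.
Let carrierP Z := energy_carrier dot_norm decP m0_gt0 m_ge fpowP a_gt0 b_gt0 Z.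
Let PZ_eqX Z Z' := @PZ_eq _ _ _ dot_norm P decP Z Z'.

Lemma energy_lin_carrier (k : R[i]) Z Z' : carrier X Z -> carrier X Z' -> carrier X (k *: Z + Z').
Proof.
case: Z => [[[u v] w] z]; case: Z' => [[[u' v'] w'] z'] [Vu Vw] [Vu' Vw'].
have m0' n : 0 <= m n by rewrite ltW.
have lin x y : V x -> V y -> V (k *: x + y).
  move=> /(spaceVP m0_gt0 m_ge fpowP) Vx /(spaceVP m0_gt0 m_ge fpowP) Vy.
  apply/(spaceVP m0_gt0 m_ge fpowP); apply: (wsumD decP) => //.
  exact: (wsumZ decP).
by split; exact: lin.
Qed.

Lemma energy_dom_carrier (C : R) Z Y : 0 <= C -> carrier X Z ->
  (forall n, energy n Y <= C * energy n Z) -> carrier X Y.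
Proof.
move=> C0 /carrierP hZ h; apply/carrierP.
apply: (@le_lt_trans _ _ (C%:E * \sum_(n <oo) (energy n Z)%:E)%E).
  rewrite -nneseriesZl; last by move=> n _; rewrite lee_fin.
  apply: lee_nneseries => n; first by rewrite lee_fin.
  by rewrite -EFinM lee_fin.
have /fineK <- : (\sum_(n <oo) (energy n Z)%:E)%E \is a fin_num.
  by rewrite ge0_fin_numE // nneseries_ge0 // => n _ _; rewrite lee_fin.
by rewrite -EFinM ltry.
Qed.

Lemma energy_nrm_le (C : R) Z Y : 0 <= C -> carrier X Z ->
  (forall n, energy n Y <= C ^+ 2 * energy n Z) -> nrm X Y <= C * nrm X Z.
Proof.
move=> C0 cZ h; have cY := energy_dom_carrier (sqr_ge0 C) cZ h.
have Y0 := energy_nrm_ge0 dot A a b Y; have Z0 := energy_nrm_ge0 dot A a b Z.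
rewrite -(ler_pXn2r (n := 2)) ?nnegrE ?mulr_ge0 // exprMn -lee_fin [leRHS]EFinM.
rewrite (parsevalX cY) (parsevalX cZ) -nneseriesZl; last by move=> n _; rewrite lee_fin.
apply: lee_nneseries => n; first by rewrite lee_fin.
by rewrite -EFinM lee_fin.
Qed.

Lemma opnorm_le (T : HH -> HH) (C : R) : 0 <= C ->
  (forall Z, carrier X Z -> nrm X (T Z) <= C * nrm X Z) -> (opnorm X T <= C%:E)%E.
Proof.
move=> C0 h; apply: ge_ereal_sup => _ [Z [cZ Z1] <-]; rewrite lee_fin.
by apply: le_trans (h _ cZ) _; rewrite -[leRHS]mulr1 ler_wpM2l.
Qed.

Lemma diagonal_exists (C : R) Z (h : nat -> HH) : 0 <= C -> carrier X Z ->
  (forall n, PZ n (h n) = h n) -> (forall n, msqr (m n) (h n) <= C * energy n Z) ->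
  exists2 Y, carrier X Y & forall n, PZ n Y = h n.
Proof.
move=> C0 /carrierP hZ Ph hC; apply: (PZ_riesz_fischer dot_norm decP m0_gt0 m_ge fpowP) => //.
apply: (@le_lt_trans _ _ (C%:E * \sum_(n <oo) (energy n Z)%:E)%E).
  rewrite -nneseriesZl; last by move=> n _; rewrite lee_fin.
  apply: lee_nneseries => n; first by move=> *; rewrite lee_fin; apply: mode_sqr_ge0.
  by rewrite -EFinM lee_fin.
have /fineK <- : (\sum_(n <oo) (energy n Z)%:E)%E \is a fin_num.
  by rewrite ge0_fin_numE // nneseries_ge0 // => n _ _; rewrite lee_fin.
by rewrite -EFinM ltry.
Qed.

Lemma mode_op_linear (mu e : R) (k : R[i]) Z Z' :
  mode_op a b gamma mu e (k *: Z + Z' : HH) = k *: mode_op a b gamma mu e Z + mode_op a b gamma mu e Z'.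
Proof.
case: Z => [[[u v] w] z]; case: Z' => [[[u' v'] w'] z'].
by congr (_, _, _, _); apply: (dot_inj dot_norm) => t;
  rewrite !(dotDl, dotNl, dotZl) ?(dotDl, dotNl, dotZl); ring.
Qed.

Lemma mode_sqr_eq0 n Z : msqr (m n) Z <= 0 -> Z = 0.
Proof.
case: Z => [[[u v] w] z]; rewrite /mode_sqr /= => h.
have uu := ipxx_ge0 dot_norm u; have vv := ipxx_ge0 dot_norm v.
have ww := ipxx_ge0 dot_norm w; have zz := ipxx_ge0 dot_norm z.
have am : 0 < a * m n by exact: mulr_gt0.
have bm : 0 < b * m n by exact: mulr_gt0.
have auu := mulr_ge0 (ltW am) uu; have bww := mulr_ge0 (ltW bm) ww.
have u0 : a * m n * ip u u = 0 by apply/eqP; rewrite eq_le auu andbT; lra.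
have w0 : b * m n * ip w w = 0 by apply/eqP; rewrite eq_le bww andbT; lra.
have -> : v = 0 by apply: (ipxx_eq0 dot_norm); apply/eqP; rewrite eq_le vv andbT; lra.
have -> : z = 0 by apply: (ipxx_eq0 dot_norm); apply/eqP; rewrite eq_le zz andbT; lra.
move/eqP: u0; rewrite mulf_eq0 gt_eqF //= => /eqP/(ipxx_eq0 dot_norm) ->.
by move/eqP: w0; rewrite mulf_eq0 gt_eqF //= => /eqP/(ipxx_eq0 dot_norm) ->.
Qed.

(** This is where theta <= 1/2 enters: the exponent 2 theta - 1 is nonpositive, so the ratio is
    largest at m0. *)
Lemma damping_sqr_le n : (m n `^ theta) ^+ 2 <= m0 `^ (2 * theta - 1) * m n.
Proof.
have -> : (m n `^ theta) ^+ 2 = m n `^ (2 * theta).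
  by rewrite -powR_mulrn ?powR_ge0 // -powRrM mulrC.
rewrite -[X in _ <= _ * X](powRr1 (ltW (m_gt0 n))).
by apply: (powR_m_le m0_gt0 m_ge); rewrite -ler_pdivlMl // mulr1.
Qed.

Lemma modes_lyapunov : exists eps : R, 0 < eps /\ forall n Z,
  [/\ msqr (m n) Z / 2 <= lyapunov dot a b eps (m n) (m n `^ theta) Z Z,
      lyapunov dot a b eps (m n) (m n `^ theta) Z Z <= 2 * msqr (m n) Z
    & lyapunov dot a b eps (m n) (m n `^ theta) (M n Z) Z <=
      - (eps * (m n `^ theta) / 4 * msqr (m n) Z)].
Proof.
have k0 : 0 < m0 `^ (2 * theta - 1) by exact: powR_gt0.
have [eps [e0 h]] := lyapunov_cst dot_norm a_gt0 b_gt0 gamma_gt0 a_neq_b k0.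
exists eps; split => // n Z; apply: h => //; first exact: powR_gt0.
exact: damping_sqr_le.
Qed.

Lemma mode_op_bound : exists C : R, 0 < C /\ forall n Z,
  msqr (m n) (M n Z) <= C * m n * msqr (m n) Z.
Proof.
have k0 : 0 < m0 `^ (2 * theta - 1) by exact: powR_gt0.
have [C [C0 h]] := mode_op_sqr_le dot_norm a_gt0 b_gt0 gamma_gt0 k0.
exists C; split => // n Z; apply: h => //; first exact: powR_gt0.
exact: damping_sqr_le.
Qed.

Lemma mode_resolvent_bound : exists C : R, 0 < C /\
  forall s lam n Z F, 0 < s <= 2 * theta ->
    ('i * lam%:C) *: Z - M n Z = F ->
    msqr (m n) Z <= C ^+ 2 * msqr (m n) F /\
    (`|lam| `^ s) ^+ 2 * msqr (m n) Z <= C ^+ 2 * msqr (m n) F.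
Proof.
have [eps [eps0 hL]] := modes_lyapunov; have [C1 [C10 hC]] := mode_op_bound.
have d0 : 0 < m0 `^ theta by exact: powR_gt0.
(* [rho] is the decay bound at the smallest possible eigenvalue m0. In [kap] that bound is combined
   with lam^2 < 4 C1 mu, and the powers of mu cancel. Their sum with 1 + 4 exceeds 1, so it is below
   its own square and serves in all regimes. *)
pose rho := (8 / (eps * m0 `^ theta)) ^+ 2.
pose kap := (4 * C1) `^ (2 * theta) * (8 / eps) ^+ 2.
have rho0 : 0 <= rho := sqr_ge0 _.
have kap0 : 0 <= kap by rewrite mulr_ge0 ?powR_ge0 ?sqr_ge0.
exists (1 + rho + 4 + kap); split; first by lra.
set C := 1 + rho + 4 + kap.
have CC : C <= C ^+ 2 by rewrite expr2 ler_peMr /C; lra.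
move=> s lam n Z F /andP[s0 s2] eqF.
have dn : 0 < m n `^ theta by exact: powR_gt0.
have dd : m0 `^ theta <= m n `^ theta.
  by apply: ge0_ler_powR; rewrite ?nnegrE ?(ltW m0_gt0) ?(ltW (m_gt0 n)) // ltW.
have F0 : 0 <= msqr (m n) F by exact: mode_sqr_ge0.
have Z0 : 0 <= msqr (m n) Z by exact: mode_sqr_ge0.
have up (t : R) : t <= C -> t * msqr (m n) F <= C ^+ 2 * msqr (m n) F.
  by move=> tC; apply: ler_wpM2r => //; exact: le_trans CC.
have decay := mode_resolvent_decay dot_norm a_gt0 b_gt0 (m_gt0 n) dn eps0 (hL n) eqF.
have b1 : msqr (m n) Z <= rho * msqr (m n) F.
  apply: le_trans decay _; apply: ler_wpM2r => //.
  rewrite ler_sqr ?nnegrE ?divr_ge0 ?mulr_ge0 ?(ltW eps0) ?(ltW d0) ?(ltW dn) //.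
  by rewrite ler_pM2l // lef_pV2 ?posrE ?mulr_gt0 // ler_pM2l.
split; first by apply: le_trans b1 _; apply: up; rewrite /C; lra.
have [l1|l1] := leP `|lam| 1.
  have : (`|lam| `^ s) ^+ 2 <= 1.
    have p1 : (1 : R) `^ s = 1 by rewrite powR1.
    rewrite expr_le1 ?powR_ge0 // -p1.
    by apply: ge0_ler_powR; rewrite ?nnegrE // ltW.
  move=> /(ler_wpM2r Z0); rewrite mul1r => h; apply: le_trans h _; apply: le_trans b1 _.
  by apply: up; rewrite /C; lra.
have mono (t : R) : s <= t -> (`|lam| `^ s) ^+ 2 <= (`|lam| `^ t) ^+ 2.
  by move=> st; rewrite ler_sqr ?nnegrE ?powR_ge0 // ler_powR // ltW.
have [far|near] := leP (4 * C1 * m n) (lam ^+ 2).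
  have h := mode_resolvent_far dot_norm a_gt0 b_gt0 (m_gt0 n) (hC n Z) far eqF.
  apply: (@le_trans _ _ (lam ^+ 2 * msqr (m n) Z)).
    apply: ler_wpM2r => //; rewrite -(real_normK (num_real lam)).
    have th1 : 2 * theta <= 1 by rewrite -ler_pdivlMl // mulr1.
    by have := mono 1; rewrite powRr1 //; apply; exact: le_trans s2 th1.
  by apply: le_trans h _; apply: up; rewrite /C; lra.
apply: (@le_trans _ _ ((`|lam| `^ (2 * theta)) ^+ 2 * msqr (m n) Z)).
  by apply: ler_wpM2r => //; exact: mono.
have h1 : (`|lam| `^ (2 * theta)) ^+ 2 <= (4 * C1) `^ (2 * theta) * (m n `^ theta) ^+ 2.
  have -> : (`|lam| `^ (2 * theta)) ^+ 2 = (lam ^+ 2) `^ (2 * theta).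
    by rewrite -(real_normK (num_real lam)) -(powR_mulrn 2 (powR_ge0 _ _)) -(powR_mulrn 2 (normr_ge0 lam)) powRAC.
  have -> : (m n `^ theta) ^+ 2 = m n `^ (2 * theta).
    by rewrite -powR_mulrn ?powR_ge0 // -powRrM mulrC.
  rewrite -powRM ?(ltW (m_gt0 n)) ?mulr_ge0 ?(ltW C10) //.
  apply: ge0_ler_powR; rewrite ?nnegrE ?sqr_ge0 ?mulr_ge0 ?(ltW theta_gt0) ?(ltW C10) ?(ltW (m_gt0 n)) //.
  exact: ltW.
apply: (@le_trans _ _ (kap * msqr (m n) F)); last by apply: up; rewrite /C; lra.
apply: le_trans (ler_wpM2r Z0 h1) _.
have -> : kap * msqr (m n) F = (4 * C1) `^ (2 * theta) * (m n `^ theta) ^+ 2 *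
    ((8 / (eps * m n `^ theta)) ^+ 2 * msqr (m n) F).
  by rewrite /kap; field; rewrite !gt_eqF.
by apply: ler_wpM2l => //; rewrite mulr_ge0 ?powR_ge0 ?sqr_ge0.
Qed.

Lemma PZ_lin n (k : R[i]) Z Z' : PZ n (k *: Z + Z') = k *: PZ n Z + PZ n Z'.
Proof. exact: (PZ_linear decP). Qed.

Lemma PZB n (k : R[i]) Z Z' : PZ n (k *: Z - Z') = k *: PZ n Z - PZ n Z'.
Proof.
case: Z => [[[u v] w] z]; case: Z' => [[[u' v'] w'] z'].
by congr (_, _, _, _); rewrite (decD decP) (decN decP) (decZ decP).
Qed.

Lemma energy_carrierB (k : R[i]) Z Z' : carrier X Z -> carrier X Z' -> carrier X (k *: Z - Z').
Proof.
move=> cZ cZ'; have -> : k *: Z - Z' = (-1) *: Z' + k *: Z by rewrite scaleN1r addrC.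
apply: energy_lin_carrier => //.
have -> : k *: Z = (k - 1) *: Z + Z by rewrite scalerBl scale1r subrK.
exact: energy_lin_carrier.
Qed.

Lemma resolventP (k : R[i]) Z Y : carrier X Y ->
  (dom G Z /\ k *: Z - G Z = Y) <->
  (carrier X Z /\ forall n, k *: PZ n Z - M n (PZ n Z) = PZ n Y).
Proof.
move=> cY.
have cp W := coupledP dot_norm decP m0_gt0 m_ge fpowP a b gamma theta_le Z W.
split.
  move=> [dZ eqY]; have [cZ _ h] := (cp (G Z)).1 (conj dZ erefl); split => // n.
  by rewrite -h -PZB eqY.
move=> [cZ h]; have /cp[dZ GZ] : [/\ carrier X Z, carrier X (k *: Z - Y)
    & forall n, PZ n (k *: Z - Y) = M n (PZ n Z)].
  split => //; last by move=> n; rewrite PZB -h subKr.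
  exact: energy_carrierB.
split => //; rewrite GZ; exact: (@subKr (H * H * H * H)%type).
Qed.

Section ImaginaryAxis.
Variable lam : R.
Local Notation k := ('i * lam%:C : R[i]).

Lemma mode_resolvent_inj n (Z Z' : HH) : k *: Z - M n Z = k *: Z' - M n Z' -> Z = Z'.
Proof.
move=> h; apply/eqP; rewrite -subr_eq0; apply/eqP.
have [C [_ hC]] := mode_resolvent_bound.
have eq0 : k *: (Z - Z') - M n (Z - Z') = 0.
  have -> : Z - Z' = (-1) *: Z' + Z by rewrite scaleN1r addrC.
  rewrite mode_op_linear (@scaler_combB _ (H * H * H * H)%type).
  by rewrite -h scaleN1r; exact: (@addNr (H * H * H * H)%type).
have th2 : 0 < 2 * theta <= 2 * theta by rewrite lexx andbT mulr_gt0.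
have [+ _] := hC _ _ _ _ _ th2 eq0.
rewrite [X in _ <= _ * X](_ : _ = 0) ?mulr0; first exact: mode_sqr_eq0.
by rewrite /mode_sqr /= !ip0l !mulr0 !addr0.
Qed.

Lemma resolvent_exists Y : carrier X Y ->
  exists Z, dom G Z /\ k *: Z - G Z = Y.
Proof.
move=> cY; have [C [_ hC]] := mode_resolvent_bound.
have th2 : 0 < 2 * theta <= 2 * theta by rewrite lexx andbT mulr_gt0.
have /choice[h hP] n : exists Z, k *: Z - M n Z = PZ n Y /\ PZ n Z = Z.
  case: Y cY => [[[y1 y2] y3] y4] cY.
  have dn : 0 < m n `^ theta by exact: powR_gt0.
  have := mode_resolvent_exists dot_norm a_gt0 b_gt0 gamma_gt0 a_neq_b n lam
    (PZ n (y1, y2, y3, y4)) decP (m_gt0 n) dn.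
  case; try exact: (dec_idem decP).
  by move=> [[[u v] w] z] [eqZ [Pu Pv Pw Pz]]; exists (u, v, w, z); rewrite /= Pu Pv Pw Pz.
have [Z cZ ZP] : exists2 Z, carrier X Z & forall n, PZ n Z = h n.
  apply: (diagonal_exists (sqr_ge0 C) cY) => n; first exact: (hP n).2.
  by have [+ _] := hC _ _ _ _ _ th2 (hP n).1.
by exists Z; apply/resolventP => //; split => // n; rewrite ZP; exact: (hP n).1.
Qed.

Lemma resolvent_spec Y : carrier X Y ->
  carrier X (resolvent G k Y) /\
  forall n, k *: PZ n (resolvent G k Y) - M n (PZ n (resolvent G k Y)) = PZ n Y.
Proof.
move=> cY; have [Z hZ] := resolvent_exists cY.
apply/(resolventP k _ cY); rewrite /resolvent.
by set Q := (X in xget 0 X); have QZ : Q Z := hZ; exact: xgetI QZ.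
Qed.

Lemma resolvent_eq Y Z : carrier X Y -> carrier X Z ->
  (forall n, k *: PZ n Z - M n (PZ n Z) = PZ n Y) -> resolvent G k Y = Z.
Proof.
move=> cY cZ h; have [_ h'] := resolvent_spec cY.
by apply: PZ_eqX => n; apply: (mode_resolvent_inj (n := n)); exact: etrans (h' n) (esym (h n)).
Qed.

Lemma resolvent_nrm_le (C r : R) Y : 0 < r -> 0 <= C -> carrier X Y ->
  (forall n Z F, k *: Z - M n Z = F -> r ^+ 2 * msqr (m n) Z <= C ^+ 2 * msqr (m n) F) ->
  nrm X (resolvent G k Y) <= C / r * nrm X Y.
Proof.
move=> r0 C0 cY h; have [cR hR] := resolvent_spec cY.
apply: energy_nrm_le => //; first by rewrite divr_ge0 // ltW.
move=> n; have := h _ _ _ (hR n); rewrite -/(energy n _) -/(energy n _) => hn.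
rewrite expr_div_n mulrAC ler_pdivlMr ?exprn_gt0 //.
by rewrite mulrC.
Qed.

Lemma resolvent_set_axis : resolvent_set X G k.
Proof.
split.
  move=> Y cY; have [Z hZ] := resolvent_exists cY; exists Z; split => // Z' hZ'.
  have [cZ h] := (resolventP k Z cY).1 hZ; have [cZ' h'] := (resolventP k Z' cY).1 hZ'.
  by apply: PZ_eqX => n; apply: (mode_resolvent_inj (n := n)); exact: etrans (h n) (esym (h' n)).
split.
- by move=> Y /resolvent_spec[].
- move=> c x y cx cy; have [cRx hx] := resolvent_spec cx; have [cRy hy] := resolvent_spec cy.
  apply: resolvent_eq; [exact: energy_lin_carrier..|].
  move=> n; rewrite !PZ_lin mode_op_linear -hx -hy.
  set x1 := PZ n _; set x2 := PZ n (resolvent _ _ y).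
  move: (M n x1) (M n x2) => z1 z2.
  exact: (@scaler_combB _ (H * H * H * H)%type).
- have [C [C0 hC]] := mode_resolvent_bound.
  have th2 : 0 < 2 * theta <= 2 * theta by rewrite lexx andbT mulr_gt0.
  apply: (@le_lt_trans _ _ (C / 1)%:E); last by rewrite ltry.
  apply: opnorm_le; first by rewrite divr_ge0 // ltW.
  move=> Y cY; apply: resolvent_nrm_le => //; first exact: ltW.
  by move=> n Z F eqF; rewrite expr1n mul1r; have [] := hC _ _ _ _ _ th2 eqF.
Qed.

End ImaginaryAxis.

Lemma resolvent_norm_bound s : 0 < s <= 2 * theta -> exists2 C : R, 0 < C &
  forall lam : R, resolvent_set X G ('i * lam%:C) /\
   ((`|lam| `^ s)%:E * resolvent_norm X G lam <= C%:E)%E.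
Proof.
move=> hs; have [C [C0 hC]] := mode_resolvent_bound.
exists C => // lam; split; first exact: resolvent_set_axis.
have := powR_ge0 `|lam| s; rewrite le_eqVlt => /predU1P[<-|ls].
  by rewrite mul0e lee_fin ltW.
have h : (resolvent_norm X G lam <= (C / `|lam| `^ s)%:E)%E.
  apply: opnorm_le; first by rewrite divr_ge0 // ltW.
  move=> Y cY; apply: resolvent_nrm_le => //; first exact: ltW.
  by move=> n Z F eqF; have [] := hC _ _ _ _ _ hs eqF.
have ls0 : (0 <= (`|lam| `^ s)%:E)%E by rewrite lee_fin ltW.
apply: le_trans (lee_wpmul2l ls0 h) _.
by rewrite -EFinM lee_fin mulrC divfK // gt_eqF.
Qed.

End Resolvent.

(** * Optimality *)

Section LowerBound.
Context (R : realType) (H : completeNormedModType R[i]).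
Variable dot : {dot H for Num.conj}.
Hypothesis dot_norm : forall x : H, `|x| ^+ 2 = dot x x.
Variable A : operator H.
Variables (P : nat -> H -> H) (m : nat -> R) (m0 : R).
Hypothesis decP : orthogonal_decomposition dot P.
Hypothesis m0_gt0 : 0 < m0.
Hypothesis m_ge : forall n, m0 <= m n.
Hypothesis fpowP : forall s x,
  (dom (fpow dot A s) x <-> (wsum P (fun n => (m n `^ s) ^+ 2)%R x < +oo)%E) /\
  (dom (fpow dot A s) x -> forall n, P n (fpow dot A s x) = (m n `^ s)%:C *: P n x).
Variables (a b gamma theta : R).
Hypotheses (a_gt0 : 0 < a) (b_gt0 : 0 < b) (gamma_gt0 : 0 < gamma) (a_neq_b : a != b).
Hypothesis theta_gt0 : 0 < theta.
Hypothesis theta_le : theta <= 2^-1.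
Local Notation HH := (H * H * H * H)%type.
Local Notation V := (carrier (spaceV dot A)).
Local Notation X := (energy_space dot A a b).
Local Notation G := (coupled_operator dot A a b gamma theta).

Local Notation PZ := (PZ P).
Let m_gt0 n : 0 < m n := m_gt0 m0_gt0 m_ge n.

Lemma wsum0 : wsum P m 0 = 0%E.
Proof.
by rewrite /wsum eseries0 // => n _ _; rewrite (dec0 decP) rnorm0 expr0n mulr0.
Qed.

(* The quasimode [((i lam)^-1 e, e, 0, 0)], with [e] an eigenvector for
   [m n = lam ^+ 2 / a], solves the first equation without damping. *)
Lemma resolvent_norm_ge n x : P n x <> 0 ->
  (((Num.sqrt 2 * gamma * m n `^ theta)^-1)%:E <=
   resolvent_norm X G (Num.sqrt (a * m n)))%E.
Proof.
move=> Px0; set lam := Num.sqrt (a * m n); set dn := m n `^ theta.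
have dn0 : 0 < dn by exact: powR_gt0.
have s20 : 0 < Num.sqrt 2 :> R by rewrite sqrtr_gt0.
(* With |e| = r each of the two nonzero components of F has norm 1 / sqrt 2, so F lies in the unit
   ball. *)
set r := (Num.sqrt 2 * gamma * dn)^-1.
have r0 : 0 < r by rewrite invr_gt0 !mulr_gt0.
have lam0 : 0 < lam by rewrite sqrtr_gt0 mulr_gt0.
have lam2 : lam ^+ 2 = a * m n by rewrite sqr_sqrtr // mulr_ge0 // ltW.
have nP0 : rnorm (P n x) != 0 by apply/eqP => /rnorm_eq0.
set e := (r / rnorm (P n x))%:C *: P n x.
have re : rnorm e = r.
  by rewrite /e rnormZ ger0_norm ?divfK // divr_ge0 ?rnorm_ge0 ?ltW.
have Pe k : P k e = if k == n then e else 0.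
  by rewrite /e (decZ decP) (decPP decP); case: ifP; rewrite ?scaler0.
clearbody e.
have Ve : V e.
  by have := Pe n; rewrite eqxx => <-; exact: (spaceV_proj decP m0_gt0 m_ge fpowP).
have V0 : V 0.
  by rewrite -(dec0 decP n); exact: (spaceV_proj decP m0_gt0 m_ge fpowP).
set kk := ('i * lam%:C : R[i]).
have kk0 : kk != 0.
  rewrite mulf_neq0 ?neq0Ci //; last by rewrite fmorph_eq0 gt_eqF.
have kk2 : kk ^+ 2 = - (a * m n)%:C.
  by rewrite /kk exprMn sqrCi mulN1r -rmorphXn /= lam2.
have VkZ : V (kk^-1 *: e).
  apply/(spaceVP m0_gt0 m_ge fpowP); apply: (wsumZ decP); first by move=> i; exact: ltW.
  exact/(spaceVP m0_gt0 m_ge fpowP).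
pose Z : HH := (kk^-1 *: e, e, 0, 0).
pose F : HH := (0, (gamma * dn)%:C *: e, 0, (gamma * dn)%:C *: e).
have cZ : carrier X Z by [].
have cF : carrier X F by [].
have eqZ : resolvent G kk F = Z.
  apply: (resolvent_eq dot_norm decP m0_gt0 m_ge fpowP a_gt0 b_gt0 gamma_gt0 a_neq_b
    theta_gt0 theta_le) => // k.
  rewrite /Z /F /= !(decZ decP) !(dec0 decP) Pe.
  case: eqP => [->|_]; last first.
    by congr (_, _, _, _); rewrite /= ?(scaler0, addr0, oppr0) ?(scaler0, addr0, oppr0).
  congr (_, _, _, _); rewrite ?scaler0 ?addr0 ?oppr0 ?scaler0 ?addr0 ?oppr0 ?subr0 //.
  - by rewrite /= -/kk scalerA mulfV // scale1r subrr.
  - rewrite /= -/kk opprK addrA scalerA -scalerDl -/dn.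
    have -> : kk + (a * m n)%:C * kk^-1 = 0; last by rewrite scale0r add0r.
    by rewrite -[X in X + _](mulfK kk0) -mulrDl -expr2 kk2 addNr mul0r.
  - by rewrite /= scaler0.
  - by rewrite /= scaler0 !add0r opprK.
have nF : nrm X F <= 1.
  rewrite /F -(ler_pXn2r (n := 2)) ?nnegrE ?energy_nrm_ge0 // expr1n -lee_fin.
  rewrite (energy_parseval dot_norm decP m0_gt0 m_ge fpowP a_gt0 b_gt0 cF).
  rewrite /F (energy_sum dot_norm decP m0_gt0 m_ge a_gt0 b_gt0) wsum0 !mule0 !add0e -EFinD lee_fin.
  rewrite rnormZ re ger0_norm ?mulr_ge0 ?(ltW dn0) ?(ltW gamma_gt0) //.
  have -> : gamma * dn * r = (Num.sqrt 2)^-1.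
    by rewrite /r; field; rewrite !gt_eqF.
  by rewrite exprVn sqr_sqrtr //; lra.
apply: (@le_trans _ _ (nrm X (resolvent G kk F))%:E); last first.
  by apply: ereal_sup_ubound; exists F.
(* Only the velocity component e of Z is kept in the lower bound. *)
rewrite eqZ lee_fin -[leLHS](ger0_norm (ltW r0)) -sqrtr_sqr.
have sq (c t : R) : 0 < c -> 0 <= c * t ^+ 2 by move=> c0; rewrite mulr_ge0 ?sqr_ge0 ?(ltW c0).
apply: ler_wsqrtr; rewrite re.
have := sq _ (rnorm (fpow dot A 2^-1 (kk^-1 *: e))) a_gt0.
have := sq _ (rnorm (fpow dot A 2^-1 0)) b_gt0.
have := sqr_ge0 (rnorm (0 : H)).
move: (a * _) => t1; move: (b * _) => t2; move: (rnorm _ ^+ 2) (r ^+ 2) => t3 t4; lra.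
Qed.

Hypothesis m_unb : forall N, exists n, N <= m n /\ exists x, P n x <> 0.

(** At lam = sqrt(a mu) the weight is of order mu^(r/2) and the resolvent is at least of order
    mu^(-theta), so the product grows like mu^(r/2 - theta) along the unbounded eigenvalues. *)
Lemma resolvent_norm_limsup (r : R) : 2 * theta < r ->
  limf_esup (fun lam : R => ((`|lam| `^ r)%:E * resolvent_norm X G lam)%E) abs_infty = +oo%E.
Proof.
move=> hr; rewrite limf_esupE; apply/eqP; rewrite -leye_eq.
apply: le_ereal_inf_tmp => _ [W [B _ BW] <-].
rewrite leye_eq; apply/eqP/eq_infty => N.
have q0 : 0 < r / 2 - theta by lra.
have s20 : 0 < Num.sqrt 2 :> R by rewrite sqrtr_gt0.
have ar : 0 < a `^ (r / 2) by exact: powR_gt0.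
pose N' := `|N| * (Num.sqrt 2 * gamma) / a `^ (r / 2).
have N'0 : 0 <= N' by rewrite divr_ge0 ?(ltW ar) // mulr_ge0 // mulr_ge0 ?ltW.
(* The first summand brings the product above N, the second brings lam beyond the threshold B of the
   given neighbourhood of infinity. *)
have [n [mN [x Px]]] := m_unb (N' `^ (r / 2 - theta)^-1 + (`|B| + 1) ^+ 2 / a).
have h1 : 0 <= N' `^ (r / 2 - theta)^-1 := powR_ge0 _ _.
have h2 : 0 <= (`|B| + 1) ^+ 2 / a by rewrite divr_ge0 ?sqr_ge0 ?ltW.
have am : 0 < a * m n by exact: mulr_gt0.
have lB : B < Num.sqrt (a * m n).
  apply: (@lt_le_trans _ _ (`|B| + 1)); first by have := ler_norm B; lra.
  rewrite -[leLHS]ger0_norm ?addr_ge0 // -sqrtr_sqr ler_wsqrtr // mulrC -ler_pdivrMr //; lra.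
have mq : N' <= m n `^ (r / 2 - theta).
  have N'E : N' = (N' `^ (r / 2 - theta)^-1) `^ (r / 2 - theta).
    by rewrite -powRrM mulVf ?powRr1 // lt0r_neq0.
  rewrite [leLHS]N'E; apply: ge0_ler_powR; rewrite ?nnegrE ?(ltW q0) ?powR_ge0 ?(ltW (m_gt0 n)) //.
  by move: mN h1 h2; set t1 := _ `^ _; set t2 := _ / a; lra.
apply: (@le_trans _ _ ((`|Num.sqrt (a * m n)| `^ r)%:E *
    resolvent_norm X G (Num.sqrt (a * m n)))%E); last first.
  apply: ereal_sup_ubound; exists (Num.sqrt (a * m n)) => //.
  by apply: BW => /=; rewrite ger0_norm ?sqrtr_ge0.
have lr0 : (0 <= (`|Num.sqrt (a * m n)| `^ r)%:E)%E by rewrite lee_fin powR_ge0.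
apply: le_trans (lee_wpmul2l lr0 (resolvent_norm_ge Px)).
rewrite -EFinM lee_fin ger0_norm ?sqrtr_ge0 // -powR12_sqrt ?(ltW am) // -powRrM.
rewrite [2^-1 * r]mulrC powRM ?(ltW a_gt0) ?(ltW (m_gt0 n)) //.
have -> : m n `^ (r / 2) = m n `^ (r / 2 - theta) * m n `^ theta.
  by rewrite -powRD ?subrK //; apply/implyP => _; rewrite gt_eqF.
have d0 : 0 < m n `^ theta by exact: powR_gt0.
have -> : a `^ (r / 2) * (m n `^ (r / 2 - theta) * m n `^ theta) /
    (Num.sqrt 2 * gamma * m n `^ theta) =
    m n `^ (r / 2 - theta) * (a `^ (r / 2) / (Num.sqrt 2 * gamma)).
  by field; rewrite !gt_eqF.
apply: le_trans (ler_norm N) _.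
have -> : `|N| = N' * (a `^ (r / 2) / (Num.sqrt 2 * gamma)) by rewrite /N'; field; rewrite !gt_eqF.
by apply: ler_wpM2r => //; rewrite divr_ge0 ?(ltW ar) // mulr_ge0 // ltW.
Qed.

End LowerBound.

(** * Dissipative linear flows *)

Section DissipativeFlow.
Context (R : realType) (W : lmodType R[i]) (B : W -> W -> R).
Hypothesis BC : forall x y, B x y = B y x.
Hypothesis BDl : forall x y z, B (x + y) z = B x z + B y z.
Hypothesis BZl : forall r x y, B (r%:C *: x) y = r * B x y.
Hypothesis B_ge0 : forall x, 0 <= B x x.

Lemma formDr x y z : B z (x + y) = B z x + B z y.
Proof. by rewrite !(BC z) BDl. Qed.

Lemma formZr r x y : B y (r%:C *: x) = r * B y x.
Proof. by rewrite !(BC y) BZl. Qed.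

Lemma formNl x y : B (- x) y = - B x y.
Proof. by rewrite -scaleN1r -[- 1](rmorphN1 (@real_complex R)) BZl mulN1r. Qed.

Lemma formNr x y : B y (- x) = - B y x.
Proof. by rewrite !(BC y) formNl. Qed.

Definition formE := (BDl, formDr, BZl, formZr, formNl, formNr).

Lemma form_CS x y : B x y ^+ 2 <= B x x * B y y.
Proof.
have h t : 0 <= B x x - 2 * t * B x y + t ^+ 2 * B y y.
  have := B_ge0 (x + (- t)%:C *: y); rewrite !formE (BC y x).
  by congr (_ <= _); ring.
move: (B x y) (B x x) (B y y) h (B_ge0 x) (B_ge0 y) => s p q h p0.
rewrite le_eqVlt => /predU1P[q0|q0].
  rewrite -q0 mulr0; have [->|s0] := eqVneq s 0; first by rewrite expr0n.
  have := h ((p + 1) / s); rewrite -q0 mulr0 addr0 -mulrA divfK //; lra.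
have := h (s / q).
have -> : p - 2 * (s / q) * s + (s / q) ^+ 2 * q = p - s ^+ 2 / q by field; rewrite gt_eqF.
by rewrite subr_ge0 ler_pdivrMr.
Qed.

Lemma form_sqrD x y : B (x + y) (x + y) <= 2 * B x x + 2 * B y y.
Proof. by have := B_ge0 (x - y); rewrite !formE (BC y x); lra. Qed.

(** Differentiability for the seminorm attached to B, spelled out with epsilons because W carries no
    topology. *)
Definition form_derive (f : R -> W) (t : R) (v : W) := forall e : R, 0 < e ->
  \forall h \near (0 : R)^', B ((h^-1)%:C *: (f (t + h) - f t) - v)
                               ((h^-1)%:C *: (f (t + h) - f t) - v) <= e.

Lemma form_deriveP f t v E : form_derive f t v ->
  is_derive t 1 (fun s => B (f s) E) (B v E).
Proof.
move=> df.
have lim : h^-1 *: (((fun s => B (f s) E) \o shift t) (h *: 1) - B (f t) E) @[h --> (0 : R)^']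
    --> B v E.
  apply/cvgrPdist_le => e e0.
  have E1 : 0 < B E E + 1 by rewrite ltr_wpDl.
  have e2 : 0 < e ^+ 2 / (B E E + 1) by rewrite divr_gt0 // exprn_gt0.
  apply: filterS (df _ e2) => h /=; set D := _ - v => hD.
  have -> : B v E - h^-1 *: (B (f (h *: 1 + t)) E - B (f t) E) = - B D E.
    by rewrite /D !formE addrC scaler1 [h + t]addrC /GRing.scale /=; ring.
  rewrite normrN -ler_sqr ?nnegrE ?(ltW e0) // real_normK ?num_real //.
  apply: le_trans (form_CS D E) _.
  apply: (@le_trans _ _ (e ^+ 2 / (B E E + 1) * B E E)); first exact: ler_wpM2r.
  rewrite mulrAC ler_pdivrMr // ler_pM2l ?exprn_gt0 //; lra.
apply: DeriveDef; first by apply/cvg_ex; exists (B v E).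
exact: (cvg_lim _ lim).
Qed.

Lemma form_derive_sqr f t v : form_derive f t v ->
  is_derive t 1 (fun s => B (f s) (f s)) (2 * B v (f t)).
Proof.
move=> df.
have lim : h^-1 *: (((fun s => B (f s) (f s)) \o shift t) (h *: 1) - B (f t) (f t)) @[h --> (0 : R)^']
    --> 2 * B v (f t).
  apply/cvgrPdist_le => e e0.
  have E1 : 0 < B (f t) (f t) + 1 by rewrite ltr_wpDl.
  have e2 : 0 < (e / 4) ^+ 2 / (B (f t) (f t) + 1) by rewrite divr_gt0 // exprn_gt0 // divr_gt0.
  have v1 : 0 < 4 * (1 + B v v) by rewrite mulr_gt0 // ltr_pwDl.
  have ev : 0 < e / (4 * (1 + B v v)) by rewrite divr_gt0.
  near=> h.
  have h0 : h != 0 by near: h; exact: nbhs_dnbhs_neq.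
  have hs : `|h| <= e / (4 * (1 + B v v)).
    by near: h; exact: dnbhs0_le.
  pose D := (h^-1)%:C *: (f (t + h) - f t) - v.
  have hD1 : B D D <= (e / 4) ^+ 2 / (B (f t) (f t) + 1) by rewrite /D; near: h; exact: df.
  have hD2 : B D D <= 1 by rewrite /D; near: h; exact: df.
  (* Expanding B around f t leaves two errors: the product with D, small by Cauchy-Schwarz, and h
     times the bounded square of D + v. *)
  have fE : f (t + h) = f t + h%:C *: (D + v).
    rewrite /D subrK scalerA -rmorphM mulfV // rmorph1 scale1r.
    by rewrite [RHS]addrC subrK.
  rewrite /= scaler1 [h + t]addrC fE.
  have -> : 2 * B v (f t) - h^-1 *: (B (f t + h%:C *: (D + v)) (f t + h%:C *: (D + v)) -
      B (f t) (f t)) = - (2 * B D (f t) + h * B (D + v) (D + v)).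
    move: (D) => D'; rewrite !formE (BC (f t)) (BC (f t)) (BC v D') /GRing.scale /=.
    by field.
  rewrite normrN; apply: le_trans (ler_normD _ _) _.
  have b1 : `|B D (f t)| <= e / 4.
    rewrite -ler_sqr ?nnegrE ?divr_ge0 ?(ltW e0) // real_normK ?num_real //.
    apply: le_trans (form_CS D (f t)) _.
    apply: (@le_trans _ _ ((e / 4) ^+ 2 / (B (f t) (f t) + 1) * B (f t) (f t))); first exact: ler_wpM2r.
    rewrite mulrAC ler_pdivrMr // ler_pM2l ?exprn_gt0 ?divr_gt0 //; lra.
  have b2 : `|h * B (D + v) (D + v)| <= e / 2.
    rewrite normrM (ger0_norm (B_ge0 _)).
    apply: (@le_trans _ _ (e / (4 * (1 + B v v)) * (2 * (1 + B v v)))).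
      apply: ler_pM => //; apply: le_trans (form_sqrD D v) _; lra.
    rewrite le_eqVlt; apply/orP; left; apply/eqP; field.
    by rewrite gt_eqF // ltr_pwDl.
  by rewrite normrM (ger0_norm (ler0n _ 2)); lra.
apply: DeriveDef; first by apply/cvg_ex; exists (2 * B v (f t)).
exact: (cvg_lim _ lim).
Unshelve. all: by end_near.
Qed.

Variables (M : W -> W) (C kap : R).
Hypothesis M_lin : forall r x y, M (r%:C *: x + y) = r%:C *: M x + M y.
Hypothesis C_ge0 : 0 <= C.
Hypothesis M_bound : forall x, B (M x) (M x) <= C * B x x.
Hypothesis M_diss : forall x, B (M x) x <= - (kap * B x x).

Lemma iter_lin k r x y : iter k M (r%:C *: x + y) = r%:C *: iter k M x + iter k M y.
Proof. by elim: k => //= k ->. Qed.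

Lemma iter_bound k x : B (iter k M x) (iter k M x) <= C ^+ k * B x x.
Proof.
elim: k => [|k ih] /=; first by rewrite mul1r.
by apply: le_trans (M_bound _) _; rewrite exprS -mulrA ler_wpM2l.
Qed.

Lemma iter_quotient k r x y v :
  iter k M (r%:C *: (x - y) - v) = r%:C *: (iter k M x - iter k M y) - iter k M v.
Proof.
have N1 (w : W) : - w = (- 1)%:C *: w by rewrite rmorphN1 scaleN1r.
have -> : r%:C *: (x - y) - v = (-1)%:C *: v + (r%:C *: x + (- r)%:C *: y + 0).
  rewrite addr0 -N1 addrC; congr (_ + _).
  by rewrite scalerBr rmorphN scaleNr.
have it0 : iter k M 0 = 0.
  have := iter_lin k 1 0 0; rewrite rmorph1 !scale1r addr0 => h.
  by apply: (addrI (iter k M 0)); rewrite addr0 -h.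
rewrite iter_lin -addrA !iter_lin it0 addr0.
by rewrite -N1 [LHS]addrC scalerBr rmorphN scaleNr.
Qed.

Lemma form_derive_iter k f t v : form_derive f t v ->
  form_derive (fun s => iter k M (f s)) t (iter k M v).
Proof.
move=> df e e0; have C1 : 0 < C ^+ k + 1 by rewrite ltr_wpDl // exprn_ge0.
have e1 : 0 < e / (C ^+ k + 1) by rewrite divr_gt0.
apply: filterS (df _ e1) => h hD; rewrite -iter_quotient.
apply: le_trans (iter_bound _ _) _.
apply: (@le_trans _ _ (C ^+ k * (e / (C ^+ k + 1)))); first by rewrite ler_wpM2l // exprn_ge0.
by rewrite mulrCA ger_pMr // ler_pdivrMr // mul1r lerDl.
Qed.

Variables (y : R -> W) (y0 : W).
Hypothesis ode : forall t, 0 < t -> form_derive y t (M (y t)).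
Hypothesis y_init : forall e : R, 0 < e ->
  \forall t \near (0 : R)^'+, B (y t - y0) (y t - y0) <= e.

(** exp(2 kap s) B (y s) (y s) is nonincreasing on s > 0. The factor 2 appears because y0 is reached
    only as a limit at 0+, and y s is compared with it through [form_sqrD]. *)
Lemma flow_decay t : 0 < t -> B (y t) (y t) <= 2 * expR (- (2 * kap * t)) * B y0 y0.
Proof.
move=> t0; pose psi s := expR (2 * kap * s) * B (y s) (y s).
pose dpsi' s : R := expR (2 * kap * s) * (2 * B (M (y s)) (y s)) +
  B (y s) (y s) * (expR (2 * kap * s) * (2 * kap)).
have dpsi (s : R) : 0 < s -> is_derive s (1 : R) psi (dpsi' s).
  move=> s0.
  have dq := form_derive_sqr (ode s0).
  have dl : is_derive s (1 : R) (fun s => 2 * kap * s) (2 * kap).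
    by apply: is_derive_eq; rewrite /GRing.scale /= mulr1.
  have de : is_derive s (1 : R) (fun s => expR (2 * kap * s)) (expR (2 * kap * s) * (2 * kap)).
    exact: (is_derive1_comp (is_derive_expR _) dl).
  exact: (is_deriveM de dq).
have psi_dec s : 0 < s -> s <= t -> psi t <= psi s.
  move=> s0 st.
  have pos x : x \in `[s, t]%R -> 0 < x by rewrite in_itv /= => /andP[+ _]; exact: lt_le_trans.
  have [||c /pos c0] := MVT_segment st (f := psi) (df := dpsi').
  - by move=> x; rewrite in_itv /= => /andP[/(lt_trans s0) + _]; exact: dpsi.
  - by apply: derivable_within_continuous => x /pos x0; have [] := dpsi x x0.
  move=> eq; rewrite -subr_le0 eq; apply: mulr_le0_ge0; last by rewrite subr_ge0.
  rewrite /dpsi'.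
  have -> : expR (2 * kap * c) * (2 * B (M (y c)) (y c)) +
      B (y c) (y c) * (expR (2 * kap * c) * (2 * kap)) =
      2 * expR (2 * kap * c) * (B (M (y c)) (y c) + kap * B (y c) (y c)) by ring.
  apply: mulr_ge0_le0; first by rewrite mulr_ge0 ?expR_ge0.
  by have := M_diss (y c); lra.
have psi_le : psi t <= 2 * B y0 y0.
  apply/ler_addgt0Pr => e e0; have e2 : 0 < e / 2 by rewrite divr_gt0.
  have lim1 : expR (2 * kap * s) @[s --> (0 : R)^'+] --> expR (2 * kap * 0).
    apply: cvg_at_right_filter.
    apply: (@continuous_comp R R R (fun s => 2 * kap * s) expR 0); last exact: continuous_expR.
    by apply: cvgMr; exact: cvg_id.
  have exp1 : expR (2 * kap * 0) = 1 by rewrite mulr0 expR0.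
  rewrite exp1 in lim1.
  have lim : expR (2 * kap * s) * (2 * B y0 y0 + e) @[s --> (0 : R)^'+] --> 1 * (2 * B y0 y0 + e).
    exact: cvgMl.
  rewrite mul1r in lim.
  apply: (cvgr_to_ge lim); near=> s.
  have s0 : 0 < s by near: s; exact: nbhs_right_gt.
  have st : s <= t by near: s; exact: nbhs_right_le.
  have hs : B (y s - y0) (y s - y0) <= e / 2 by near: s; exact: y_init.
  apply: le_trans (psi_dec _ s0 st) _; rewrite /psi ler_wpM2l ?expR_ge0 //.
  by have := form_sqrD (y s - y0) y0; rewrite subrK; lra.
have -> : B (y t) (y t) = expR (- (2 * kap * t)) * psi t.
  by rewrite /psi mulrA -expRD addNr expR0 mul1r.
by rewrite [leRHS]mulrAC [leRHS]mulrC; apply: ler_wpM2l; rewrite ?expR_ge0.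
Unshelve. all: by end_near.
Qed.

(** The two endpoints come in either order, since the increment h of the flow may be negative. *)
Lemma mean_value (f df : R -> R) (r x z : R) :
  (forall s, r <= s -> is_derive s (1 : R) f (df s)) -> r <= x -> r <= z ->
  exists c, [/\ r <= c, `|c - x| <= `|z - x| & f z - f x = df c * (z - x)].
Proof.
move=> dfr rx rz.
have mv p q : r <= p -> p <= q -> exists2 c, p <= c <= q & f q - f p = df c * (q - p).
  move=> rp pq.
  have [||c] := MVT_segment pq (f := f) (df := df).
  - by move=> s; rewrite in_itv /= => /andP[/ltW + _] => /(le_trans rp); exact: dfr.
  - apply: derivable_within_continuous => s; rewrite in_itv /= => /andP[/(le_trans rp) rs _].
    by have [] := dfr _ rs.
  by rewrite in_itv /= => hc eq; exists c.
have [xz|/ltW zx] := leP x z.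
  have [c /andP[xc cz] eq] := mv _ _ rx xz; exists c; split => //; first exact: le_trans xc.
  by rewrite !ger0_norm ?subr_ge0 // lerB.
have [c /andP[xc cz] eq] := mv _ _ rz zx; exists c; split => //; first exact: le_trans xc.
  by rewrite !ler0_norm ?subr_le0 // lerN2 lerB.
by rewrite -opprB eq -mulrN opprB.
Qed.

(* The mean value theorem, applied twice to [s |-> B (iter k M (y s)) D]. *)
Lemma flow_increment k t h K : 0 < t -> h != 0 -> `|h| <= t / 2 ->
  (forall s, t / 2 <= s -> B (iter k.+2 M (y s)) (iter k.+2 M (y s)) <= K) ->
  forall D, D = (h^-1)%:C *: (iter k M (y (t + h)) - iter k M (y t)) - iter k.+1 M (y t) ->
  B D D <= h ^+ 2 * K.
Proof.
move=> t0 h0 ht hK D DE.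
have K0 : 0 <= K by apply: le_trans (hK t _); [exact: B_ge0 | lra].
have [hm hp] : - (t / 2) <= h /\ h <= t / 2 by apply/andP; rewrite -ler_norml.
have th0 : 0 < t / 2 by rewrite divr_gt0.
have der j s : t / 2 <= s ->
    is_derive s (1 : R) (fun s => B (iter j M (y s)) D) (B (iter j.+1 M (y s)) D).
  move=> hs; rewrite iterSr; apply: form_deriveP; apply: form_derive_iter.
  by apply: ode; exact: lt_le_trans hs.
have [||c [tc cth e1]] := mean_value (der k) (x := t) (z := t + h); [lra | lra |].
have [||c' [tc' _ e2]] := mean_value (der k.+1) (x := t) (z := c); [lra | by [] |].
have BD : B D D = (c - t) * B (iter k.+2 M (y c')) D.
  rewrite {1}DE !formE e1 addrAC subrr add0r mulrCA mulVf // mulr1.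
  by rewrite e2 mulrC.
(* Testing the quotient against its own error D bounds B D D by the square root of h^2 K B D D;
   dividing by B D D finishes. *)
have sq : B D D ^+ 2 <= h ^+ 2 * K * B D D.
  rewrite [in leLHS]BD exprMn -mulrA; apply: ler_pM; rewrite ?sqr_ge0 //.
    rewrite -(real_normK (num_real (c - t))) -(real_normK (num_real h)).
    by rewrite ler_sqr ?nnegrE // (le_trans cth) // addrAC subrr add0r.
  by apply: le_trans (form_CS _ _) _; apply: ler_wpM2r => //; exact: hK.
have := B_ge0 D; rewrite le_eqVlt => /predU1P[<-|D0].
  by rewrite mulr_ge0 ?sqr_ge0.
by move: sq; rewrite expr2 ler_pM2r.
Qed.

End DissipativeFlow.

(** * Modes of the semigroup *)

Lemma at_right0P (R : realType) (f : R -> R) : f k @[k --> 0^'+] --> 0 ->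
  forall e : R, 0 < e -> exists2 r : R, 0 < r & forall k, 0 < k -> k < r -> `|f k| <= e.
Proof.
move=> /cvgr0Pnorm_le fe e /fe [r /= r0 hr]; exists r => // k k0 kr.
by apply: hr => //=; rewrite sub0r normrN gtr0_norm.
Qed.

(** T is linear on D only, so each combination is brought to the shape c u + v with both vectors in
    D. *)
Lemma linear_on_comb (R : realType) (W : lmodType R[i]) (D : set W) (T : W -> W)
    (c : R[i]) (x y z : W) :
  (forall k u v, D u -> D v -> D (k *: u + v)) -> linear_on D T -> D x -> D y -> D z ->
  T (c *: (x - y) - z) = c *: (T x - T y) - T z.
Proof.
move=> Dlin Tlin Dx Dy Dz.
have Du : D ((- 1) *: y + x) by exact: Dlin.
(* A multiple c u is written (c - 1) u + u, which stays in D without using 0 as a member. *)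
have [Dc Tc] : D (c *: ((- 1) *: y + x)) /\ T (c *: ((- 1) *: y + x)) = c *: T ((- 1) *: y + x).
  have -> : c *: ((- 1) *: y + x) = (c - 1) *: ((- 1) *: y + x) + ((- 1) *: y + x).
    by rewrite scalerBl scale1r subrK.
  by split; [exact: Dlin | rewrite Tlin // scalerBl scale1r subrK].
have E (a b e : W) : c *: (a - b) - e = (- 1) *: e + c *: ((- 1) *: b + a).
  by rewrite !scaleN1r [in RHS]addrC [- b + a]addrC.
by rewrite !E Tlin // Tc Tlin.
Qed.

Lemma quotient_flip (R : realType) (W : lmodType R[i]) (r : R) (x y z w : W) :
  (- r)%:C *: (x - y) - z = (r%:C *: (y - x) - w) - (z - w).
Proof. by rewrite rmorphN scaleNr -scalerN !opprB addrA subrK. Qed.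

Section Semigroup.
Context (R : realType) (H : completeNormedModType R[i]).
Variable dot : {dot H for Num.conj}.
Hypothesis dot_norm : forall x : H, `|x| ^+ 2 = dot x x.
Variable A : operator H.
Variables (P : nat -> H -> H) (m : nat -> R) (m0 : R).
Hypothesis decP : orthogonal_decomposition dot P.
Hypothesis m0_gt0 : 0 < m0.
Hypothesis m_ge : forall n, m0 <= m n.
Hypothesis fpowP : forall s x,
  (dom (fpow dot A s) x <-> (wsum P (fun n => (m n `^ s) ^+ 2)%R x < +oo)%E) /\
  (dom (fpow dot A s) x -> forall n, P n (fpow dot A s x) = (m n `^ s)%:C *: P n x).
Variables (a b gamma theta : R).
Hypotheses (a_gt0 : 0 < a) (b_gt0 : 0 < b) (gamma_gt0 : 0 < gamma).
Hypothesis theta_le : theta <= 2^-1.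
Local Notation HH := (H * H * H * H)%type.
Local Notation X := (energy_space dot A a b).
Local Notation G := (coupled_operator dot A a b gamma theta).

Local Notation msqr := (mode_sqr dot a b).
Local Notation M n := (mode_op a b gamma (m n) (m n `^ theta)).
Local Notation energy := (mode_energy dot P m a b).
Local Notation PZ := (PZ P).

Variable eps : R.
Hypothesis eps_gt0 : 0 < eps.
Hypothesis lyap : forall n Z,
  [/\ msqr (m n) Z / 2 <= lyapunov dot a b eps (m n) (m n `^ theta) Z Z,
      lyapunov dot a b eps (m n) (m n `^ theta) Z Z <= 2 * msqr (m n) Z
    & lyapunov dot a b eps (m n) (m n `^ theta) (M n Z) Z <=
      - (eps * (m n `^ theta) / 4 * msqr (m n) Z)].
Local Notation B n := (lyapunov dot a b eps (m n) (m n `^ theta)).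

Variable S : R -> HH -> HH.
Hypothesis S_contr : contraction_semigroup X S.
Hypothesis S_gen : is_generator X S G.

Let m_gt0 n : 0 < m n := m_gt0 m0_gt0 m_ge n.
Let energy0 n Z : 0 <= energy n Z := energy_ge0 dot_norm P m0_gt0 m_ge a_gt0 b_gt0 n Z.
Let parsevalX Z (CZ : carrier X Z) := energy_parseval dot_norm decP m0_gt0 m_ge fpowP a_gt0 b_gt0 CZ.
Let PZ_eqX Z Z' := @PZ_eq _ _ _ dot_norm P decP Z Z'.
Let linX (k : R[i]) Z Z' : carrier X Z -> carrier X Z' -> carrier X (k *: Z + Z') :=
  energy_lin_carrier decP m0_gt0 m_ge fpowP k (Z := Z) (Z' := Z').
Let BX (k : R[i]) Z Z' : carrier X Z -> carrier X Z' -> carrier X (k *: Z - Z') :=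
  energy_carrierB decP m0_gt0 m_ge fpowP k (Z := Z) (Z' := Z').
Let genP Z Y := coupledP dot_norm decP m0_gt0 m_ge fpowP a b gamma theta_le Z Y.
Let nrm0 Z : 0 <= nrm X Z := energy_nrm_ge0 dot A a b Z.

Lemma energy_le_nrm n Z : carrier X Z -> energy n Z <= nrm X Z ^+ 2.
Proof.
move=> cZ; rewrite -lee_fin (parsevalX cZ) (nneseriesD1 (n := n)) //.
  rewrite leeDl // nneseries_ge0 // => k _ _; by rewrite lee_fin.
by move=> k; rewrite lee_fin.
Qed.

Lemma PZZ n (c : R[i]) Z : PZ n (c *: Z) = c *: PZ n Z.
Proof. by case: Z => [[[u v] w] z]; congr (_, _, _, _); rewrite (decZ decP). Qed.

Lemma energyZ n (c : R[i]) Z : energy n (c *: Z) = complex.Re `|c| ^+ 2 * energy n Z.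
Proof. by rewrite /mode_energy PZZ mode_sqrZ. Qed.

Lemma energyB n Z Z' : energy n (Z - Z') <= 2 * energy n Z + 2 * energy n Z'.
Proof.
have -> : Z - Z' = (-1) *: Z' + Z by rewrite scaleN1r addrC.
rewrite /mode_energy (PZ_linear decP); apply: le_trans (mode_sqrD dot_norm a_gt0 b_gt0 _ _ (m_gt0 n)) _.
by rewrite mode_sqrZ // normrN1 /= expr1n mul1r addrC.
Qed.

Lemma energy_eq n Z Z' : energy n (Z - Z') <= 0 -> PZ n Z = PZ n Z'.
Proof.
rewrite /mode_energy; have -> : Z - Z' = 1 *: Z - Z' by rewrite scale1r.
rewrite (PZB decP) scale1r => h.
apply/eqP; rewrite -subr_eq0; apply/eqP.
exact: (mode_sqr_eq0 dot_norm m0_gt0 m_ge a_gt0 b_gt0 h).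
Qed.

Lemma semigroup_carrier t Z : 0 <= t -> carrier X Z -> carrier X (S t Z).
Proof. by move=> t0; have [[/(_ t t0) [+ _ _] _ _ _] _] := S_contr; apply. Qed.

Lemma semigroup_linear t : 0 <= t -> linear_on (carrier X) (S t).
Proof. by move=> t0; have [[/(_ t t0) [_ + _] _ _ _] _] := S_contr. Qed.

(** The contraction property speaks of the unit ball. Rescaling by any positive r >= [nrm X Z],
    rather than by the norm itself, also covers norm 0. *)
Lemma semigroup_nrm_le t Z : 0 <= t -> carrier X Z -> nrm X (S t Z) <= nrm X Z.
Proof.
move=> t0 cZ; have [_ /(_ t t0) hop] := S_contr.
have hle Z' : carrier X Z' -> nrm X Z' <= 1 -> nrm X (S t Z') <= 1.
  move=> cZ' nZ'; rewrite -lee_fin; apply: le_trans hop.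
  by apply: ereal_sup_ubound; exists Z'.
have nrmZ (c : R) Z' : 0 <= c -> carrier X Z' -> nrm X (c%:C *: Z') <= c * nrm X Z'.
  move=> c0 cZ'; apply: (energy_nrm_le dot_norm decP m0_gt0 m_ge fpowP a_gt0 b_gt0) => // n.
  by rewrite energyZ normc_def /= expr0n addr0 sqrtr_sqr ger0_norm.
have cz (c : R) Z' : carrier X Z' -> carrier X (c%:C *: Z') /\ S t (c%:C *: Z') = c%:C *: S t Z'.
  move=> cZ'; have -> : c%:C *: Z' = (c%:C - 1) *: Z' + Z' by rewrite scalerBl scale1r subrK.
  split; first exact: linX.
  by rewrite (semigroup_linear t0) // scalerBl scale1r subrK.
have bound r : 0 < r -> nrm X Z <= r -> nrm X (S t Z) <= r.
  move=> r0 Zr; have [c1 e1] := cz r^-1 _ cZ.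
  have h1 : nrm X (S t (r^-1%:C *: Z)) <= 1.
    apply: hle => //; apply: le_trans (nrmZ _ _ _ cZ) _; first by rewrite invr_ge0 ltW.
    by rewrite mulrC ler_pdivrMr // mul1r.
  have -> : S t Z = r%:C *: S t (r^-1%:C *: Z).
    by rewrite e1 scalerA -rmorphM divff ?gt_eqF // rmorph1 scale1r.
  apply: le_trans (nrmZ _ _ (ltW r0) _) _; first exact: semigroup_carrier.
  by rewrite -[leRHS]mulr1 ler_wpM2l // ltW.
apply/ler_addgt0Pr => e e0; apply: bound; first by rewrite ltr_wpDl.
by rewrite lerDl ltW.
Qed.

Lemma semigroup_energy_le t n Z : 0 <= t -> carrier X Z -> energy n (S t Z) <= nrm X Z ^+ 2.
Proof.
move=> t0 cZ; apply: le_trans (energy_le_nrm _ (semigroup_carrier t0 cZ)) _.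
by rewrite ler_sqr ?nnegrE //; exact: semigroup_nrm_le.
Qed.

Lemma semigroup_comb t (c : R[i]) x y z : 0 <= t -> carrier X x -> carrier X y -> carrier X z ->
  S t (c *: (x - y) - z) = c *: (S t x - S t y) - S t z.
Proof. by move=> t0 *; apply: (@linear_on_comb R (H * H * H * H)%type _ _ c x y z linX (semigroup_linear t0)). Qed.

Lemma semigroup_sub t Z Z' : 0 <= t -> carrier X Z -> carrier X Z' -> S t (Z - Z') = S t Z - S t Z'.
Proof.
move=> t0 cZ cZ'; have E (x y : HH) : x - y = (-1) *: y + x by rewrite scaleN1r addrC.
by rewrite !E (semigroup_linear t0).
Qed.

Lemma semigroupD s t Z : 0 <= s -> 0 <= t -> carrier X Z -> S (s + t) Z = S s (S t Z).
Proof. by have [[_ _ + _] _] := S_contr; apply. Qed.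

Lemma carrier_sub Z Z' : carrier X Z -> carrier X Z' -> carrier X (Z - Z').
Proof. by move=> *; have -> : Z - Z' = 1 *: Z - Z'; [rewrite scale1r | exact: BX]. Qed.

Lemma carrier_quot (c : R[i]) x y z : carrier X x -> carrier X y -> carrier X z ->
  carrier X (c *: (x - y) - z).
Proof. by move=> *; apply: BX => //; exact: carrier_sub. Qed.

(** S h commutes with S t, so the quotient at S t Z is the image under the contraction S t of the
    quotient at Z. *)
Lemma semigroup_dom t Z Y : 0 <= t -> dom G Z /\ G Z = Y -> dom G (S t Z) /\ G (S t Z) = S t Y.
Proof.
move=> t0 /S_gen [cZ cY lim]; apply/S_gen.
split; [exact: semigroup_carrier | exact: semigroup_carrier |].
apply/cvgr0Pnorm_le => e e0; have [r r0 hr] := at_right0P lim e0.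
near=> h; have h0 : 0 < h by near: h; exact: nbhs_right_gt.
have hrr : h < r by near: h; exact: nbhs_right_lt.
have -> : S h (S t Z) = S t (S h Z).
  by rewrite -!semigroupD ?(ltW h0) // addrC.
rewrite -semigroup_comb //; last by apply: semigroup_carrier => //; exact: ltW.
rewrite ger0_norm //; apply: le_trans (semigroup_nrm_le _ _) _ => //.
  by apply: carrier_quot => //; apply: semigroup_carrier => //; exact: ltW.
by have := hr h h0 hrr; rewrite ger0_norm.
Unshelve. all: by end_near.
Qed.

Lemma mode_form_le n Z : B n (PZ n Z) (PZ n Z) <= 2 * energy n Z.
Proof. by have [_ + _] := lyap n (PZ n Z). Qed.

Lemma PZ_quot n (c : R[i]) x y z : PZ n (c *: (x - y) - z) = c *: (PZ n x - PZ n y) - PZ n z.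
Proof.
case: x y z => [[[? ?] ?] ?] [[[? ?] ?] ?] [[[? ?] ?] ?].
by congr (_, _, _, _); rewrite (decD decP) (decN decP) (decZ decP) (decD decP) (decN decP).
Qed.

Lemma semigroup_mode_ode n Z t : dom G Z -> 0 < t ->
  form_derive (B n) (fun s => PZ n (S s Z)) t (M n (PZ n (S t Z))).
Proof.
move=> dZ t0 e e0; set Y := G Z.
have [cZ cY lim] := (S_gen Z Y).1 (conj dZ erefl).
have SP s (s0 : 0 <= s) := (genP _ _).1 (semigroup_dom s0 (conj dZ (erefl Y))).
have -> : M n (PZ n (S t Z)) = PZ n (S t Y) by have [_ _ ->] := SP t (ltW t0).
have [[_ _ _ /(_ Y cY) limY] _] := S_contr.
(* The minimum makes the squared norms at most e / 8; in the worst case they are multiplied by 2 in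
   [energyB] for each of two terms and by 2 in [mode_form_le], which totals e. *)
have e1 : 0 < Num.min 1 (e / 8) by rewrite lt_min ltr01 divr_gt0.
have [r1 r10 h1] := at_right0P lim e1.
have [r2 r20 h2] := at_right0P limY e1.
have small (x : R) : 0 <= x -> `|x| <= Num.min 1 (e / 8) -> x ^+ 2 <= e / 8.
  move=> x0; rewrite ger0_norm // le_min => /andP[x1 xe]; apply: le_trans xe.
  by rewrite expr2 ler_piMr.
near=> h; have h0 : h != 0 by near: h; exact: nbhs_dnbhs_neq.
have hr1 : `|h| < r1 by near: h; exact: dnbhs0_lt.
have hr2 : `|h| < r2 by near: h; exact: dnbhs0_lt.
have ht : `|h| < t by near: h; exact: dnbhs0_lt.
rewrite -PZ_quot; apply: le_trans (mode_form_le _ _) _.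
have [hp|hn] := ltP 0 h.
  rewrite gtr0_norm // in hr1.
  rewrite semigroupD ?(ltW hp) ?(ltW t0) //.
  have cS := semigroup_carrier (ltW hp) cZ.
  rewrite -semigroup_comb ?(ltW t0) //.
  have := semigroup_energy_le n (ltW t0) (carrier_quot (h^-1)%:C cS cZ cY).
  have := small _ (nrm0 _) (h1 h hp hr1); lra.
have {hn} hn : h < 0 by rewrite lt_neqAle h0.
pose k := - h; have k0 : 0 < k by rewrite oppr_gt0.
rewrite ltr0_norm // -/k in hr1 hr2 ht.
have tk0 : 0 <= t - k by rewrite subr_ge0 ltW.
have cS W : carrier X W -> carrier X (S k W) by apply: semigroup_carrier; exact: ltW.
have tE W : carrier X W -> S t W = S (t - k) (S k W).
  by move=> cW; rewrite -semigroupD ?(ltW k0) // subrK.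
have -> : t + h = t - k by rewrite /k opprK.
have cq := carrier_quot (k^-1)%:C (cS _ cZ) cZ cY.
have cd := carrier_sub (cS _ cY) cY.
(* The generator gives only right limits. For h = - k the left quotient at t is S (t - k) applied to
   the right quotient at 0, corrected by S k Y - Y, which tends to 0 by strong continuity. *)
have -> : (h^-1)%:C *: (S (t - k) Z - S t Z) - S t Y =
    S (t - k) ((k^-1)%:C *: (S k Z - Z) - Y) - S (t - k) (S k Y - Y).
  rewrite semigroup_comb ?semigroup_sub //; try exact: cS.
  rewrite -!tE // (_ : h^-1 = - k^-1); last by rewrite /k invrN opprK.
  exact: (@quotient_flip R (H * H * H * H)%type).
have := energyB n (S (t - k) ((k^-1)%:C *: (S k Z - Z) - Y)) (S (t - k) (S k Y - Y)).
have := semigroup_energy_le n tk0 cq; have := semigroup_energy_le n tk0 cd.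
have := small _ (nrm0 _) (h1 k k0 hr1); have := small _ (nrm0 _) (h2 k k0 hr2).
move=> n1 n2 n3 n4 n5; have -> : e = 2 * (2 * (e / 8) + 2 * (e / 8)) by field.
apply: ler_wpM2l => //; apply: le_trans n5 _.
by apply: lerD; apply: ler_wpM2l => //; [apply: le_trans n4 _ | apply: le_trans n3 _].
Unshelve. all: by end_near.
Qed.

Lemma semigroup_mode_init n Z (e : R) : carrier X Z -> 0 < e ->
  \forall t \near (0 : R)^'+, B n (PZ n (S t Z) - PZ n Z) (PZ n (S t Z) - PZ n Z) <= e.
Proof.
move=> cZ e0; have [[_ _ _ /(_ Z cZ) lim] _] := S_contr.
have e1 : 0 < Num.min 1 (e / 2) by rewrite lt_min ltr01 divr_gt0.
have [r r0 hr] := at_right0P lim e1.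
near=> h; have h0 : 0 < h by near: h; exact: nbhs_right_gt.
have hrr : h < r by near: h; exact: nbhs_right_lt.
have -> : PZ n (S h Z) - PZ n Z = PZ n (S h Z - Z).
  by rewrite -[X in X - _]scale1r -(PZB decP) scale1r.
apply: le_trans (mode_form_le _ _) _.
have := energy_le_nrm n (carrier_sub (semigroup_carrier (ltW h0) cZ) cZ).
have := hr h h0 hrr; rewrite ger0_norm // le_min => /andP[n1 n2].
have : nrm X (S h Z - Z) ^+ 2 <= e / 2 by apply: le_trans n2; rewrite expr2 ler_piMr.
lra.
Unshelve. all: by end_near.
Qed.

Lemma mode_form_ge0 n Z : 0 <= B n Z Z.
Proof.
have [h _ _] := lyap n Z; apply: le_trans h.
by rewrite divr_ge0 // (mode_sqr_ge0 dot_norm).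
Qed.

Lemma mode_form_diss n Z : B n (M n Z) Z <= - (eps * (m n `^ theta) / 8 * B n Z Z).
Proof.
have [_ h1 h2] := lyap n Z; apply: le_trans h2 _; rewrite lerN2.
have c0 : 0 <= eps * (m n `^ theta) / 8 by rewrite divr_ge0 // mulr_ge0 ?powR_ge0 // ltW.
have := ler_wpM2l c0 h1; lra.
Qed.

Lemma semigroup_mode_decay n Z t : dom G Z -> 0 < t ->
  B n (PZ n (S t Z)) (PZ n (S t Z)) <=
    2 * expR (- (2 * (eps * (m n `^ theta) / 8) * t)) * B n (PZ n Z) (PZ n Z).
Proof.
move=> dZ t0; have [cZ _ _] := (genP _ _).1 (conj dZ (erefl (G Z))).
apply: (@flow_decay R (H * H * H * H)%type (B n) _ _ _ _ (M n) (eps * (m n `^ theta) / 8) _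
   (fun s => PZ n (S s Z)) (PZ n Z)) => //.
- exact: lyapunovC.
- exact: lyapunovDl.
- exact: lyapunovZl.
- exact: mode_form_ge0.
- exact: mode_form_diss.
- by move=> s s0; exact: semigroup_mode_ode.
- by move=> e e0; exact: semigroup_mode_init.
Qed.

(** A finite sum of modes lies in the domain of G, since G is bounded on each mode. *)
Lemma truncation_dom (I : pred nat) N Z : carrier X Z ->
  exists2 W, dom G W & forall k, PZ k W = if (k < N)%N && I k then PZ k Z else 0.
Proof.
move=> cZ; have k2 : 0 < m0 `^ (2 * theta - 1) by exact: powR_gt0.
have [C [C0 hC]] := mode_op_bound dot_norm m0_gt0 m_ge a_gt0 b_gt0 gamma_gt0 theta_le.
have msqr0 n : msqr (m n) 0 = 0 by rewrite /mode_sqr /= !ip0l !mulr0 !addr0.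
have [W cW PW] : exists2 W, carrier X W & forall k, PZ k W = if (k < N)%N && I k then PZ k Z else 0.
  apply: (diagonal_exists dot_norm decP m0_gt0 m_ge fpowP a_gt0 b_gt0 (C := 1) ler01 cZ
    (h := fun k => if (k < N)%N && I k then PZ k Z else 0)) => k.
    case: ifP => _; first by rewrite (PZ_PZ decP) eqxx.
    by rewrite /= !(dec0 decP).
  by case: ifP => _; rewrite ?msqr0 ?mulr_ge0 // mul1r.
exists W => //; suff [Y hY] : exists Y, dom G W /\ G W = Y by case: hY.
(* The sum of the first N eigenvalues serves as a crude bound for each of them. *)
have CM0 : 0 <= C * \sum_(j < N) m j.
  by rewrite mulr_ge0 ?(ltW C0) // sumr_ge0 // => j _; exact: ltW.
have [Y cY PY] : exists2 Y, carrier X Y &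
    forall k, PZ k Y = if (k < N)%N && I k then M k (PZ k Z) else 0.
  apply: (diagonal_exists dot_norm decP m0_gt0 m_ge fpowP a_gt0 b_gt0 CM0 cZ
    (h := fun k => if (k < N)%N && I k then M k (PZ k Z) else 0)) => k.
    case: ifP => _; last by rewrite /= !(dec0 decP).
    case: Z {cZ PW} => [[[u v] w] z].
    by congr (_, _, _, _); rewrite !(decN decP, decD decP, decZ decP, dec_idem decP).
  case: ifP => [/andP[kN _]|_]; last by rewrite msqr0 mulr_ge0.
  apply: le_trans (hC _ _) _; apply: ler_wpM2r; first exact: energy0.
  apply: ler_wpM2l; first exact: ltW.
  rewrite (bigD1 (Ordinal kN)) //= lerDl sumr_ge0 // => j _; exact: ltW.
exists Y; apply/genP; split => // k; rewrite PY PW; case: ifP => // _.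
by congr (_, _, _, _); rewrite !(addr0, scaler0, oppr0).
Qed.

Lemma PZ_dom n Z : carrier X Z -> dom G (PZ n Z).
Proof.
move=> cZ; have [W dW PW] := truncation_dom (pred1 n) n.+1 cZ.
suff -> : PZ n Z = W by [].
apply: PZ_eqX => k; rewrite PW (PZ_PZ decP) /=.
by case: eqP => [->|_]; rewrite ?ltnSn ?andbF.
Qed.

(* [Z] is approximated by [PZ n Z + W] with [W] a finite sum of other modes;
   the decay of the n-th mode of the flow of [W] from [0] keeps it at [0]. *)
Lemma semigroup_mode n Z t : 0 < t -> carrier X Z -> PZ n (S t Z) = PZ n (S t (PZ n Z)).
Proof.
move=> t0 cZ; have dP := PZ_dom n cZ.
have cP : carrier X (PZ n Z) by have [] := (genP _ _).1 (conj dP (erefl _)).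
apply: energy_eq; apply/ler_addgt0Pr => e' e'0; rewrite add0r.
have [e [e0 ->]] : exists e, 0 < e /\ e' = 2 * e by exists (e' / 2); split; [rewrite divr_gt0 | field].
have tail : (\sum_(N <= k <oo) (energy k Z)%:E)%E @[N --> \oo] --> 0%E.
  apply: nneseries_tail_cvg; last by move=> k _; rewrite lee_fin.
  by apply/(energy_carrier dot_norm decP m0_gt0 m_ge fpowP a_gt0 b_gt0).
(* N is taken beyond n so that the remainder Z - P n Z - W contains only modes from N on and has
   squared norm at most e. *)
have [N nN tN] : exists2 N, (n < N)%N & (\sum_(N <= k <oo) (energy k Z)%:E <= e%:E)%E.
  have /fine_cvgP[fin /cvgr0Pnorm_le/(_ e e0) sm] := tail.
  have [N0 _ hN] := filterI fin sm.
  exists (maxn N0 n.+1); first exact: leq_maxr.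
  have [fN sN] := hN _ (leq_maxl N0 n.+1).
  by rewrite -(fineK fN) lee_fin; apply: le_trans sN; exact: ler_norm.
have [W dW PW] := truncation_dom (predC1 n) N cZ.
have cW : carrier X W by have [] := (genP _ _).1 (conj dW (erefl _)).
have PW0 : PZ n W = 0 by rewrite PW /= eqxx andbF.
have SW0 : energy n (S t W) <= 0.
  have := semigroup_mode_decay n dW t0; rewrite PW0.
  have -> : B n 0 0 = 0.
    by have := lyapunovZl dot a b eps (m n) (m n `^ theta) 0 0 0; rewrite rmorph0 scale0r mul0r.
  rewrite mulr0; have [h _ _] := lyap n (PZ n (S t W)) => h'.
  by rewrite /mode_energy; lra.
have cD : carrier X (Z - PZ n Z - W) by apply: carrier_sub => //; exact: carrier_sub.
have PD k : PZ k (Z - PZ n Z - W) = if (N <= k)%N then PZ k Z else 0.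
  have E (x y z : HH) : PZ k (x - y - z) = PZ k x - PZ k y - PZ k z.
    by rewrite -[x - y]scale1r (PZB decP) -[x in x - y]scale1r (PZB decP) !scale1r.
  rewrite E PW (PZ_PZ decP) /=; case: (ltnP k N) => [kN|Nk] /=.
    by case: eqP => [->|_]; rewrite ?subr0 subrr.
  by rewrite subr0 (gtn_eqF (leq_trans nN Nk)) subr0.
have nD : nrm X (Z - PZ n Z - W) ^+ 2 <= e.
  rewrite -lee_fin (parsevalX cD); apply: le_trans tN.
  rewrite [leRHS]eseries_cond [leRHS]eseries_mkcond; apply: lee_nneseries => k; first by rewrite lee_fin.
  move=> _; rewrite /mode_energy PD; case: ifP => _ //.
  by rewrite lee_fin /mode_sqr /= !ip0l !mulr0 !addr0.
have E : S t Z - S t (PZ n Z) = S t (Z - PZ n Z - W) + S t W.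
  rewrite (semigroup_sub (ltW t0) (carrier_sub cZ cP) cW) subrK.
  by rewrite (semigroup_sub (ltW t0) cZ cP).
rewrite E; have -> : S t (Z - PZ n Z - W) + S t W = S t (Z - PZ n Z - W) - (-1) *: S t W.
  by rewrite scaleN1r opprK.
apply: le_trans (energyB _ _ _) _; rewrite energyZ normrN1 /= expr1n mul1r.
have := semigroup_energy_le n (ltW t0) cD; lra.
Qed.

End Semigroup.

(** * Gevrey bounds *)

Section Weights.
Context (R : realType).
Implicit Types (x t eta delta : R).

Lemma expR_ge_monomial x k : 0 <= x -> x ^+ k / k`!%:R <= expR x.
Proof.
case: k => [|k] x0; first by rewrite expr0 fact0 divr1; have := expR_ge1Dx x; lra.
apply: le_trans (expR_ge1Dxn k x0); lra.
Qed.

Lemma powR_exprn x t k : 0 <= x -> (x ^+ k) `^ t = (x `^ t) ^+ k.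
Proof. by move=> x0; rewrite -(powR_mulrn k x0) -(powR_mulrn k (powR_ge0 x t)) powRAC. Qed.

Lemma powR_invl x t : 0 <= x -> x^-1 `^ t = (x `^ t)^-1.
Proof. by move=> x0; rewrite -powR_inv1 // -powRrM mulN1r powRN. Qed.

(** Bound for the norm of the k-th derivative at time t. The 3 exceeds sqrt 8, where 8 collects 4
    from the equivalence of form and energy and 2 from [flow_decay]. It is used with c = eps theta /
    4, the decay rate of the form on a block divided by mu^theta and multiplied by theta. *)
Definition gevrey_weight (theta c C : R) k t : R :=
  3 * C ^+ k * (k`!%:R / (c * t) ^+ k) `^ (2 * theta)^-1.

Variables (theta eps C : R).
Hypotheses (theta_gt0 : 0 < theta) (eps_gt0 : 0 < eps) (C_ge1 : 1 <= C).
Local Notation weight := (gevrey_weight theta (eps * theta / 4) C).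

Lemma weight_ge0 k t : 0 <= weight k t.
Proof. by rewrite !mulr_ge0 ?powR_ge0 ?exprn_ge0 // (le_trans _ C_ge1). Qed.

Lemma weight_mono k s t : 0 < s -> s <= t -> weight k t <= weight k s.
Proof.
move=> s0 st; have c0 : 0 < eps * theta / 4 by rewrite divr_gt0 // mulr_gt0.
have t0 : 0 < t by exact: lt_le_trans st.
have q u : 0 < u -> 0 < (eps * theta / 4 * u) ^+ k by move=> u0; rewrite exprn_gt0 // mulr_gt0.
apply: ler_wpM2l; first by rewrite mulr_ge0 // exprn_ge0 // (le_trans _ C_ge1).
apply: ge0_ler_powR; rewrite ?nnegrE ?divr_ge0 ?(ltW (q _ _)) ?invr_ge0 ?mulr_ge0 ?(ltW theta_gt0) //.
apply: ler_wpM2l => //; rewrite lef_pV2 ?posrE ?q //.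
have [cs ct] := (mulr_gt0 c0 s0, mulr_gt0 c0 t0).
by apply: lerXn2r; rewrite ?nnegrE ?(ltW cs) ?(ltW ct) // ler_pM2l.
Qed.

(* With [x = mu `^ theta], the bound is [(x ^+ k * e^(-c t x)) `^ theta^-1] for
   [x ^+ k * e^(-c t x) <= k! / (c t) ^+ k]. *)
Lemma weight_bound k t mu C0 : 0 < t -> 0 < mu -> 0 <= C0 <= C ^+ 2 ->
  8 * ((C0 * mu) ^+ k * expR (- (2 * (eps * mu `^ theta / 8) * t))) <= weight k t ^+ 2.
Proof.
move=> t0 mu0 /andP[C00 CC].
set c := eps * theta / 4; have c0 : 0 < c by rewrite divr_gt0 // mulr_gt0.
have d0 : 0 < mu `^ theta by exact: powR_gt0.
have ct : 0 < (c * t) ^+ k by rewrite exprn_gt0 // mulr_gt0.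
have f0 : 0 < k`!%:R :> R by rewrite ltr0n fact_gt0.
set Q := k`!%:R / (c * t) ^+ k; have Q0 : 0 < Q by rewrite divr_gt0.
pose Y := (mu `^ theta) ^+ k * expR (- (c * t * mu `^ theta)).
have Y0 : 0 <= Y by rewrite mulr_ge0 ?expR_ge0 // exprn_ge0 // ltW.
have YQ : Y <= Q.
  have x0 : 0 <= c * t * mu `^ theta by rewrite !mulr_ge0 // ltW.
  have := expR_ge_monomial k x0; rewrite ler_pdivrMr // exprMn => h.
  rewrite /Y /Q expRN ler_pdivrMr ?expR_gt0 // mulrAC ler_pdivlMr //.
  by rewrite mulrC [leRHS]mulrC.
have E : mu ^+ k * expR (- (2 * (eps * mu `^ theta / 8) * t)) = Y `^ theta^-1.
  rewrite /Y powRM ?expR_ge0 ?exprn_ge0 ?(ltW d0) // -expRM; congr (_ * expR _); last first.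
    by rewrite /c; field; rewrite gt_eqF.
  by rewrite powR_exprn ?(ltW d0) // -powRrM mulfV ?gt_eqF // powRr1 // ltW.
have E2 : Q `^ theta^-1 = (Q `^ (2 * theta)^-1) ^+ 2.
  rewrite -[RHS]powR_mulrn ?powR_ge0 // -powRrM; congr (_ `^ _).
  by field; rewrite gt_eqF.
have YQ2 : Y `^ theta^-1 <= (Q `^ (2 * theta)^-1) ^+ 2.
  rewrite -E2; apply: ge0_ler_powR; rewrite ?nnegrE ?invr_ge0 ?(ltW theta_gt0) ?(ltW Q0) //.
rewrite [(C0 * mu) ^+ k]exprMn -[C0 ^+ k * _ * _]mulrA E.
have -> : gevrey_weight theta c C k t ^+ 2 = 9 * (C ^+ k ^+ 2 * (Q `^ (2 * theta)^-1) ^+ 2).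
  by rewrite /gevrey_weight -/Q; ring.
apply: (@le_trans _ _ (8 * (C0 ^+ k * (Q `^ (2 * theta)^-1) ^+ 2))).
  by apply: ler_wpM2l => //; apply: ler_wpM2l => //; exact: exprn_ge0.
have h : C0 ^+ k <= C ^+ k ^+ 2 by rewrite exprAC; apply: lerXn2r; rewrite ?nnegrE ?sqr_ge0.
have := ler_wpM2r (sqr_ge0 (Q `^ (2 * theta)^-1)) h.
have := mulr_ge0 (exprn_ge0 k C00) (sqr_ge0 (Q `^ (2 * theta)^-1)).
by move: (C0 ^+ k * _) => z1; move: (C ^+ k ^+ 2 * _) => z2; lra.
Qed.

(** The geometric factor beta^k left after extracting eta^k is absorbed by the spare power of k!:
    with q = delta - p, the exponential series gives (beta^(1/q))^k <= k! exp(beta^(1/q)), to be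
    raised to the power q. *)
Lemma weight_gevrey t0 eta delta : 0 < t0 -> 0 < eta -> (2 * theta)^-1 < delta ->
  exists C1, forall k, weight k t0 <= C1 * eta ^+ k * k`!%:R `^ delta.
Proof.
move=> t00 eta0 hd; set c := eps * theta / 4.
have c0 : 0 < c by rewrite divr_gt0 // mulr_gt0.
set p := (2 * theta)^-1; have p0 : 0 < p by rewrite invr_gt0 mulr_gt0.
have q0 : 0 < delta - p by rewrite subr_gt0.
have ct : 0 < c * t0 by exact: mulr_gt0.
have C_gt0 : 0 < C by exact: lt_le_trans C_ge1.
set beta := C / ((c * t0) `^ p * eta).
have beta0 : 0 < beta by rewrite divr_gt0 // mulr_gt0 // powR_gt0.
exists (3 * expR (beta `^ (delta - p)^-1) `^ (delta - p)) => k.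
have f0 : 0 < k`!%:R :> R by rewrite ltr0n fact_gt0.
have wE : weight k t0 = 3 * (beta ^+ k * eta ^+ k * k`!%:R `^ p).
  rewrite /gevrey_weight -/c -/p powRM ?invr_ge0 ?exprn_ge0 ?(ltW ct) ?(ltW f0) //.
  rewrite powR_invl ?exprn_ge0 ?(ltW ct) // powR_exprn ?(ltW ct) //.
  have cp0 : 0 < (c * t0) `^ p by exact: powR_gt0.
  have -> : beta ^+ k * eta ^+ k = C ^+ k / (c * t0) `^ p ^+ k.
    by rewrite -exprMn -expr_div_n; congr (_ ^+ _); rewrite /beta; field; rewrite !gt_eqF.
  by rewrite -!mulrA; congr (_ * (_ * _)); rewrite mulrC.
have bk : beta ^+ k <= (expR (beta `^ (delta - p)^-1) * k`!%:R) `^ (delta - p).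
  have -> : beta ^+ k = ((beta `^ (delta - p)^-1) ^+ k) `^ (delta - p).
    rewrite -powR_exprn ?(ltW beta0) // -powRrM mulVf ?gt_eqF // powRr1 //.
    by rewrite exprn_ge0 // ltW.
  apply: ge0_ler_powR; rewrite ?nnegrE ?(ltW q0) ?exprn_ge0 ?powR_ge0 ?mulr_ge0 ?expR_ge0 ?(ltW f0) //.
  by rewrite -ler_pdivrMr // expR_ge_monomial // powR_ge0.
rewrite powRM ?expR_ge0 ?(ltW f0) // in bk.
have fE : k`!%:R `^ delta = k`!%:R `^ (delta - p) * k`!%:R `^ p :> R.
  by rewrite -powRD ?subrK //; apply/implyP => _; rewrite gt_eqF.
have ef : 0 <= eta ^+ k * k`!%:R `^ p by rewrite mulr_ge0 ?powR_ge0 // exprn_ge0 // ltW.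
rewrite wE fE; have := ler_wpM2r ef bk.
move: (_ `^ (delta - p)) => z1; move: (_ `^ (delta - p)) => z2.
move: (beta ^+ k) (eta ^+ k) (_ `^ p) => z3 z4 z5; lra.
Qed.

End Weights.

Section Gevrey.
Context (R : realType) (H : completeNormedModType R[i]).
Variable dot : {dot H for Num.conj}.
Hypothesis dot_norm : forall x : H, `|x| ^+ 2 = dot x x.
Variable A : operator H.
Variables (P : nat -> H -> H) (m : nat -> R) (m0 : R).
Hypothesis decP : orthogonal_decomposition dot P.
Hypothesis m0_gt0 : 0 < m0.
Hypothesis m_ge : forall n, m0 <= m n.
Hypothesis fpowP : forall s x,
  (dom (fpow dot A s) x <-> (wsum P (fun n => (m n `^ s) ^+ 2)%R x < +oo)%E) /\
  (dom (fpow dot A s) x -> forall n, P n (fpow dot A s x) = (m n `^ s)%:C *: P n x).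
Variables (a b gamma theta : R).
Hypotheses (a_gt0 : 0 < a) (b_gt0 : 0 < b) (gamma_gt0 : 0 < gamma).
Hypothesis theta_gt0 : 0 < theta.
Hypothesis theta_le : theta <= 2^-1.
Local Notation HH := (H * H * H * H)%type.
Local Notation V := (carrier (spaceV dot A)).
Local Notation X := (energy_space dot A a b).
Local Notation G := (coupled_operator dot A a b gamma theta).
Local Notation msqr := (mode_sqr dot a b).
Local Notation M n := (mode_op a b gamma (m n) (m n `^ theta)).
Local Notation energy := (mode_energy dot P m a b).
Local Notation PZ := (PZ P).

Variable eps : R.
Hypothesis eps_gt0 : 0 < eps.
Hypothesis lyap : forall n Z,
  [/\ msqr (m n) Z / 2 <= lyapunov dot a b eps (m n) (m n `^ theta) Z Z,
      lyapunov dot a b eps (m n) (m n `^ theta) Z Z <= 2 * msqr (m n) Z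
    & lyapunov dot a b eps (m n) (m n `^ theta) (M n Z) Z <=
      - (eps * (m n `^ theta) / 4 * msqr (m n) Z)].
Local Notation B n := (lyapunov dot a b eps (m n) (m n `^ theta)).

Variable C0 : R.
Hypothesis C0_gt0 : 0 < C0.
Hypothesis M_bound : forall n Z, msqr (m n) (M n Z) <= C0 * m n * msqr (m n) Z.

Variable S : R -> HH -> HH.
Hypothesis S_contr : contraction_semigroup X S.
Hypothesis S_gen : is_generator X S G.

Local Notation weight := (gevrey_weight theta (eps * theta / 4) (1 + C0)).

Let m_gt0 n : 0 < m n := m_gt0 m0_gt0 m_ge n.
Let energy0 n Z : 0 <= energy n Z := energy_ge0 dot_norm P m0_gt0 m_ge a_gt0 b_gt0 n Z.
Let C1_ge1 : 1 <= 1 + C0. Proof. by rewrite lerDl ltW. Qed.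
Let w0 k t : 0 <= weight k t := weight_ge0 theta eps C1_ge1 k t.
Let PZ_eqX Z Z' := @PZ_eq _ _ _ dot_norm P decP Z Z'.
Let linX (k : R[i]) Z Z' : carrier X Z -> carrier X Z' -> carrier X (k *: Z + Z') :=
  energy_lin_carrier decP m0_gt0 m_ge fpowP k (Z := Z) (Z' := Z').
Let CM0 n : 0 <= C0 * m n. Proof. by rewrite mulr_ge0 // ltW. Qed.

Lemma semigroup_modeP n Z t : 0 < t -> carrier X Z ->
  PZ n (S t Z) = PZ n (S t (PZ n Z)).
Proof.
exact: (semigroup_mode dot_norm decP m0_gt0 m_ge fpowP a_gt0 b_gt0 gamma_gt0 theta_le
  eps_gt0 lyap S_contr S_gen).
Qed.

(** The decay estimate needs initial data in the domain; [PZ n Z] always is, and [semigroup_modeP]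
    lets it replace Z in the n-th mode. *)
Lemma mode_iter_bound k n Z t : 0 < t -> carrier X Z ->
  msqr (m n) (iter k (M n) (PZ n (S t Z))) <= weight k t ^+ 2 * energy n Z.
Proof.
move=> t0 cZ; have dP : dom G (PZ n Z).
  exact: (PZ_dom dot_norm decP m0_gt0 m_ge fpowP a_gt0 b_gt0 gamma_gt0 theta_le).
have h1 : msqr (m n) (iter k (M n) (PZ n (S t Z))) <= (C0 * m n) ^+ k * msqr (m n) (PZ n (S t Z)).
  exact: (iter_bound (B := mode_ip dot a b (m n)) (CM0 n) (M_bound n)).
have := semigroup_mode_decay dot_norm decP m0_gt0 m_ge fpowP a_gt0 b_gt0 theta_le
  eps_gt0 lyap S_contr S_gen n dP t0.
rewrite -semigroup_modeP // (PZ_PZ decP) eqxx; set e := expR _ => h2.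
have e0 : 0 <= e := expR_ge0 _.
have h3 := mode_form_le P lyap n Z.
have [h4 _ _] := lyap n (PZ n (S t Z)).
have h5 : msqr (m n) (PZ n (S t Z)) <= 8 * e * energy n Z.
  have := ler_wpM2l e0 h3; lra.
apply: le_trans h1 _.
apply: (@le_trans _ _ ((C0 * m n) ^+ k * (8 * e * energy n Z))).
  by apply: ler_wpM2l => //; exact: exprn_ge0.
(* [C0] bounds squared norms, whereas the constant of the weight bounds norms and must be at least
   1; 1 + C0 meets both demands. *)
have C0C : 0 <= C0 <= (1 + C0) ^+ 2.
  have -> : (1 + C0) ^+ 2 = C0 + (1 + C0 + C0 ^+ 2) by ring.
  by rewrite (ltW C0_gt0) lerDl addr_ge0 ?sqr_ge0 // addr_ge0 // ltW.
have := ler_wpM2r (energy0 n Z) (weight_bound theta_gt0 eps_gt0 k t0 (m_gt0 n) C0C).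
by rewrite -/e; lra.
Qed.

Lemma PZ_iter k n Z : PZ n Z = Z -> PZ n (iter k (M n) Z) = iter k (M n) Z.
Proof.
move=> PZZ; elim: k => //= k; case: (iter k _ _) => [[[u v] w] z] [Pu Pv Pw Pz].
by congr (_, _, _, _); rewrite ?(decN decP, decD decP, decZ decP) ?Pu ?Pv ?Pw ?Pz.
Qed.

(** The vector G^k S(t) Z, given through its blocks so that no domain of a power of G has to be
    followed; the blocks are summable by [mode_iter_bound]. *)
Definition derivative k t Z : HH :=
  xget 0 [set Y | carrier X Y /\ forall n, PZ n Y = iter k (M n) (PZ n (S t Z))].

Lemma derivativeP k t Z : 0 < t -> carrier X Z -> carrier X (derivative k t Z) /\
  forall n, PZ n (derivative k t Z) = iter k (M n) (PZ n (S t Z)).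
Proof.
move=> t0 cZ; have [Y cY PY] : exists2 Y, carrier X Y & forall n, PZ n Y = iter k (M n) (PZ n (S t Z)).
  apply: (diagonal_exists dot_norm decP m0_gt0 m_ge fpowP a_gt0 b_gt0 (sqr_ge0 (weight k t)) cZ
    (h := fun n => iter k (M n) (PZ n (S t Z)))) => n; last exact: mode_iter_bound.
  by apply: PZ_iter; rewrite (PZ_PZ decP) eqxx.
rewrite /derivative; set Q := (X in xget _ X).
have QY : Q Y by [].
exact: (xgetI _ QY).
Qed.

Lemma derivative_nrm_le k t Z : 0 < t -> carrier X Z ->
  nrm X (derivative k t Z) <= weight k t * nrm X Z.
Proof.
move=> t0 cZ; apply: (energy_nrm_le dot_norm decP m0_gt0 m_ge fpowP a_gt0 b_gt0) => // n.
rewrite /mode_energy (derivativeP k t0 cZ).2; exact: mode_iter_bound.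
Qed.

Lemma derivative_linear k t : 0 < t -> linear_on (carrier X) (derivative k t).
Proof.
move=> t0 c x y cx cy; have [_ Px] := derivativeP k t0 cx; have [_ Py] := derivativeP k t0 cy.
have [_ Pxy] := derivativeP k t0 (linX c cx cy).
apply: PZ_eqX => n; rewrite Pxy (PZ_linear decP) Px Py.
rewrite (semigroup_linear S_contr (ltW t0)) // (PZ_linear decP).
elim: k {Px Py Pxy} => //= k ->; exact: (mode_op_linear dot_norm).
Qed.

(** Second-order estimate in each block: for |h| <= t / 2 the flow is only observed at times s >= t
    / 2, where the weight of order k + 2 is at most its value at t / 2. The bound is independent of
    n and linear in [nrm X Z], hence yields convergence in operator norm. *)
Lemma derivative_increment k t h Z : 0 < t -> h != 0 -> `|h| <= t / 2 -> carrier X Z ->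
  nrm X ((h^-1)%:C *: (derivative k (t + h) Z - derivative k t Z) - derivative k.+1 t Z) <=
  `|h| * (2 * weight k.+2 (t / 2)) * nrm X Z.
Proof.
move=> t0 h0 ht cZ.
have th : 0 < t + h by have := ler_norm (- h); rewrite normrN; lra.
have [cA PA] := derivativeP k th cZ; have [cB PB] := derivativeP k t0 cZ.
have [cD PD] := derivativeP k.+1 t0 cZ.
apply: (energy_nrm_le dot_norm decP m0_gt0 m_ge fpowP a_gt0 b_gt0) => //.
  by apply: mulr_ge0 => //; apply: mulr_ge0 => //; exact: w0.
move=> n; rewrite /mode_energy (PZ_quot decP) PA PB PD.
set W := _ - iter k.+1 _ _.
have [+ _ _] := lyap n W.
have dP : dom G (PZ n Z).
  exact: (PZ_dom dot_norm decP m0_gt0 m_ge fpowP a_gt0 b_gt0 gamma_gt0 theta_le).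
have Mb x : B n (M n x) (M n x) <= 4 * (C0 * m n) * B n x x.
  have [_ + _] := lyap n (M n x); have [+ _ _] := lyap n x.
  have := M_bound n x; have := CM0 n; move: (C0 * m n) => z z0 b1 b2 b3.
  have := ler_wpM2l z0 b2; lra.
have : B n W W <= h ^+ 2 * (2 * (weight k.+2 (t / 2) ^+ 2 * energy n Z)).
  have M4 : 0 <= 4 * (C0 * m n) by rewrite mulr_ge0.
  apply: (@flow_increment R (H * H * H * H)%type (B n) _ _ _ _ (M n) (4 * (C0 * m n)) _ M4 Mb
    (fun s => PZ n (S s (PZ n Z))) _ k t h) => //.
  - exact: lyapunovC.
  - exact: lyapunovDl.
  - exact: lyapunovZl.
  - exact: (mode_form_ge0 dot_norm m0_gt0 m_ge a_gt0 b_gt0 lyap).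
  - by move=> r x y; exact: (mode_op_linear dot_norm).
  - move=> s s0; exact: (semigroup_mode_ode dot_norm decP m0_gt0 m_ge fpowP a_gt0 b_gt0 theta_le
      lyap S_contr S_gen n dP s0).
  - move=> s hs; have t2 : 0 < t / 2 by rewrite divr_gt0.
    have s0 : 0 < s by exact: lt_le_trans hs.
    rewrite -semigroup_modeP //.
    have [_ + _] := lyap n (iter k.+2 (M n) (PZ n (S s Z))).
    move=> /le_trans; apply; apply: ler_wpM2l => //.
    apply: le_trans (mode_iter_bound _ _ s0 cZ) _; apply: ler_wpM2r => //.
    by rewrite ler_sqr ?nnegrE //; exact: weight_mono.
  - by rewrite -!semigroup_modeP.
rewrite -/(energy n Z); move: (weight k.+2 (t / 2)) => w.
rewrite !exprMn (real_normK (num_real h)).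
move: (h ^+ 2) (w ^+ 2) (energy n Z) => z1 z2 z3; lra.
Qed.

Lemma carrier0 : carrier X 0.
Proof.
have V0 : V 0 by rewrite -(dec0 decP 0); exact: (spaceV_proj decP m0_gt0 m_ge fpowP).
by [].
Qed.

Lemma semigroup_gevrey delta : (2 * theta)^-1 < delta -> gevrey X S delta.
Proof.
move=> hd; exists derivative.
  split.
  - move=> t Z t0 cZ; apply: PZ_eqX => n; by rewrite (derivativeP 0 t0 cZ).2.
  - move=> k t t0; split.
    + by move=> Z cZ; have [] := derivativeP k t0 cZ.
    + exact: derivative_linear.
    + apply: (@le_lt_trans _ _ (weight k t)%:E); last by rewrite ltry.
      by apply: opnorm_le => // Z cZ; exact: derivative_nrm_le.
  - move=> k t t0.
    pose K := 2 * weight k.+2 (t / 2); have K0 : 0 <= K by rewrite mulr_ge0.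
    have lim0 : (`|h| * K)%:E @[h --> (0 : R)^'] --> 0%E.
      apply: cvg_EFin; first exact: nearW.
      have -> : fine \o (fun h : R => (`|h| * K)%:E) = (fun h => `|h| * K) by [].
      rewrite -[X in _ --> X](mul0r K); apply: cvgMl.
      apply/cvgr0Pnorm_le => e e0; near=> h; rewrite normr_id.
      by near: h; exact: dnbhs0_le.
    apply: (squeeze_cvge _ (cvg_cst 0%E) lim0).
    have t2 : 0 < t / 2 by rewrite divr_gt0.
    near=> h; have h0 : h != 0 by near: h; exact: nbhs_dnbhs_neq.
    have ht : `|h| <= t / 2 by near: h; exact: dnbhs0_le.
    apply/andP; split; last first.
      apply: opnorm_le; first by rewrite mulr_ge0.
      by move=> Z cZ; exact: derivative_increment.
    (* The operator norm is a supremum over the unit ball, which contains 0, so it is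
       nonnegative. *)
    apply: (@le_trans _ _ (nrm X ((h^-1)%:C *: (derivative k (t + h) 0 - derivative k t 0)
      - derivative k.+1 t 0))%:E); first by rewrite lee_fin (energy_nrm_ge0 dot A a b).
    apply: ereal_sup_ubound; exists 0 => //=.
    split; first exact: carrier0.
    have msqr0 n : energy n 0 <= 0 ^+ 2 * energy n 0.
      by rewrite /mode_energy /= !(dec0 decP) /mode_sqr /= !ip0l !mulr0 !addr0.
    have := energy_nrm_le dot_norm decP m0_gt0 m_ge fpowP a_gt0 b_gt0 (lexx 0) carrier0 msqr0.
    by rewrite mul0r => /le_trans; apply.
move=> K eta cK K0 eta0.
have [->|/set0P[t1 Kt1]] := eqVneq K set0; first by exists 0 => t n.
(* The compact set K has a least element t0 > 0, and the weight decreases in time, so the constant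
   at t0 serves on all of K. *)
have [|t0 Kt0 ht0] := @compact_EVT_min R R id K (ex_intro _ t1 Kt1) cK.
  by apply: continuous_subspaceT => x; exact: cvg_id.
rewrite inE in Kt0; have t00 : 0 < t0 by exact: K0.
have [C1 hC1] := weight_gevrey theta_gt0 eps_gt0 C1_ge1 t00 eta0 hd.
exists C1 => t k Kt.
have t_ge : t0 <= t by apply: ht0; rewrite inE.
have tp : 0 < t by exact: K0.
apply: (@le_trans _ _ (weight k t)%:E).
  by apply: opnorm_le => // Z cZ; exact: derivative_nrm_le.
rewrite lee_fin; apply: le_trans (hC1 k); exact: weight_mono.
Unshelve. all: by end_near.
Qed.

End Gevrey.

(** On the second branch, 3 theta / (1 + 2 theta) <= 2 theta amounts to 4 theta >= 1. *)
Lemma decay_exponent_bounds (R : realType) (theta : R) : 0 < theta <= 2^-1 ->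
  0 < decay_exponent theta <= 2 * theta.
Proof.
move=> /andP[t0 t2]; rewrite /decay_exponent; have [_|t4] := leP theta 4^-1.
  by rewrite lexx andbT mulr_gt0.
have d0 : 0 < 1 + 2 * theta by rewrite addr_gt0 // mulr_gt0.
rewrite divr_gt0 ?mulr_gt0 //= ler_pdivrMr //.
have t4' : 1 <= 4 * theta by rewrite -ler_pdivrMl // mulr1 ltW.
have := mulr_ge0 (ltW t0) (_ : 0 <= 4 * theta - 1); rewrite subr_ge0 => /(_ t4').
lra.
Qed.

Theorem theorem1p2 (R : realType) (H : completeNormedModType R[i])
    (dot : {dot H for Num.conj})
    (dot_norm : forall x : H, `|x| ^+ 2 = dot x x)
    (A : operator H)
    (A_sa : self_adjoint dot A)
    (A_pos : positive_operator dot A)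
    (A_unb : unbounded A)
    (VH_dense : dense_embedding (spaceV dot A) (spaceH H) id)
    (VH_compact : compact_embedding (spaceV dot A) (spaceH H) id)
    (HV'_dense : dense_embedding (spaceH H) (spaceV' dot A) (pivot dot))
    (HV'_compact : compact_embedding (spaceH H) (spaceV' dot A) (pivot dot))
    (A_coercive : exists2 a0 : R, 0 < a0 &
       forall u, carrier (spaceV dot A) u ->
         rnorm u <= a0 * rnorm (fpow dot A 2^-1 u))
    (a b gamma : R) (a_gt0 : 0 < a) (b_gt0 : 0 < b) (gamma_gt0 : 0 < gamma)
    (a_neq_b : a != b) :
  [/\ forall (theta : R) (S : R -> (H * H * H * H) -> (H * H * H * H)),
        0 < theta <= 2^-1 ->
        contraction_semigroup (energy_space dot A a b) S ->
        is_generator (energy_space dot A a b) S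
          (coupled_operator dot A a b gamma theta) ->
        forall delta : R, (decay_exponent theta)^-1 < delta ->
          gevrey (energy_space dot A a b) S delta,
      forall theta : R, 0 < theta <= 2^-1 ->
        exists2 C : R, 0 < C &
          forall lambda : R,
            resolvent_set (energy_space dot A a b)
              (coupled_operator dot A a b gamma theta) ('i * lambda%:C) /\
            ((`|lambda| `^ decay_exponent theta)%:E *
             resolvent_norm (energy_space dot A a b)
               (coupled_operator dot A a b gamma theta) lambda <= C%:E)%E
    & forall theta r : R, 0 < theta < 2^-1 -> 2 * theta < r <= 1 ->
        limf_esup (fun lambda : R =>
            ((`|lambda| `^ r)%:E *
             resolvent_norm (energy_space dot A a b)
               (coupled_operator dot A a b gamma theta) lambda)%E)
          abs_infty = +oo%E].
Proof.
have [P [m [m0 [decP m0_gt0 m_ge m_unb fpowP]]]] :=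
  diagonalization dot_norm A_pos A_unb VH_compact A_coercive.
split.
- move=> theta S /andP[t0 t2] S_contr S_gen delta hdelta.
  have [eps [eps0 lyap]] := modes_lyapunov dot_norm m0_gt0 m_ge a_gt0 b_gt0 gamma_gt0 a_neq_b t2.
  have [C0 [C00 hC]] := mode_op_bound dot_norm m0_gt0 m_ge a_gt0 b_gt0 gamma_gt0 t2.
  have t0t2 : 0 < theta <= 2^-1 by rewrite t0.
  have /andP[s0 s2] := decay_exponent_bounds t0t2.
  apply: (semigroup_gevrey dot_norm decP m0_gt0 m_ge fpowP a_gt0 b_gt0 gamma_gt0 t0 t2
    eps0 lyap C00 hC S_contr S_gen).
  (* The Gevrey bound holds above 1 / (2 theta), which is at most 1 / s because s <= 2 theta. *)
  apply: le_lt_trans hdelta; rewrite lef_pV2 ?posrE ?mulr_gt0 //.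
- move=> theta t02; have hs := decay_exponent_bounds t02; have /andP[t0 t2] := t02.
  exact: (resolvent_norm_bound dot_norm decP m0_gt0 m_ge fpowP a_gt0 b_gt0 gamma_gt0 a_neq_b t0 t2 hs).
- move=> theta r /andP[t0 /ltW t2] /andP[tr _].
  exact: (resolvent_norm_limsup dot_norm decP m0_gt0 m_ge fpowP a_gt0 b_gt0 gamma_gt0
    a_neq_b t0 t2 m_unb tr).
Qed.
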